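(* There is a polynomial-time algorithm for the problem $\textsc{Hyp-AUT}$: given a hypergraph $X=(V,E)$, a partition of the vertex set into color classes $V=V_1\cup\cdots\cup V_r$, and subgroups $G_i\le\mathrm{Sym}(V_i)$ ($1\le i\le r$), each given as an explicit list of permutations, compute a generating set for $\mathrm{Aut}(X)\cap(G_1\times\cdots\times G_r)$.
   Context: For a hypergraph $X=(V,E)$ with $E\subseteq 2^V$, $\mathrm{Aut}(X)$ is the group of permutations $\pi$ of $V$ such that for every $e\subseteq V$, $e\in E$ iff $\pi(e)\in E$. The input size includes the explicit lists of elements of the groups $G_i$ (so the running time is polynomial in $|V|$, $|E|$ and $\max_i|G_i|$). *)

(* Defs.v *)
From HB Require Import structures.
From mathcomp Require Import all_boot all_order all_fingroup.
Set Implicit Arguments. Unset Strict Implicit. Unset Printing Implicit Defensive.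

Inductive sym := blank | zero | one | lbr | rbr.
Inductive move := mL | mR | mS.

Record TM := {
  tm_state : finType;
  tm_start : tm_state;
  tm_halt  : tm_state -> bool;
  tm_delta : tm_state -> sym -> tm_state * sym * move
}.

(* configuration: state, left tape (reversed, nearest cell first),
   symbol under the head, right tape *)
Record config (M : TM) := Config {
  cf_state : tm_state M;
  cf_left  : seq sym;
  cf_head  : sym;
  cf_right : seq sym
}.

Definition hd_sym (s : seq sym) : sym := if s is a :: _ then a else blank.
Definition tl_sym (s : seq sym) : seq sym := behead s.

Definition tm_step (M : TM) (c : config M) : config M :=
  if @tm_halt M (cf_state c) then c else
  let: (q', a, m) := @tm_delta M (cf_state c) (cf_head c) in
  match m with
  | mS => @Config M q' (cf_left c) a (cf_right c)
  | mR => @Config M q' (a :: cf_left c) (hd_sym (cf_right c)) (tl_sym (cf_right c))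
  | mL => @Config M q' (tl_sym (cf_left c)) (hd_sym (cf_left c)) (a :: cf_right c)
  end.

Definition tm_init (M : TM) (w : seq sym) : config M :=
  @Config M (tm_start M) [::] (hd_sym w) (tl_sym w).

Definition tm_run (M : TM) (t : nat) (w : seq sym) : config M :=
  iter t (@tm_step M) (tm_init M w).

Definition tm_output (M : TM) (c : config M) : seq sym := cf_head c :: cf_right c.

Definition enc_nat (k : nat) : seq sym := nseq k one ++ [:: zero].
Definition enc_list (T : Type) (e : T -> seq sym) (s : seq T) : seq sym :=
  lbr :: flatten (map e s) ++ [:: rbr].
Definition enc_nats (s : seq nat) : seq sym := enc_list enc_nat s.
Definition enc_natss (s : seq (seq nat)) : seq sym := enc_list enc_nats s.
Definition enc_natsss (s : seq (seq (seq nat))) : seq sym := enc_list enc_natss s.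

(*   vertex set V = {0, ..., n-1};                                     *)
(*   edges : each edge is a strictly increasing list of vertices;      *)
(*   groups : groups`_i is the explicit list of elements of G_i, each  *)
(*     permutation given as the list of images [g 0; ...; g (n-1)]     *)
(*     (a permutation of V fixing every vertex outside V_i).           *)

Record instance := Instance {
  inst_n : nat;
  inst_edges : seq (seq nat);
  inst_classes : seq (seq nat);
  inst_groups : seq (seq (seq nat))
}.

Definition enc_instance (I : instance) : seq sym :=
  enc_nat (inst_n I) ++ enc_natss (inst_edges I) ++
  enc_natss (inst_classes I) ++ enc_natsss (inst_groups I).

Definition valid_perm (n : nat) (s : seq nat) : bool := perm_eq s (iota 0 n).

Definition seq_fun (n : nat) (s : seq nat) (i : 'I_n) : 'I_n :=
  odflt i (insub (nth 0 s i)).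
Definition perm_of (n : nat) (s : seq nat) : {perm 'I_n} :=
  odflt 1%g [pick p : {perm 'I_n} | [forall i, p i == seq_fun s i]].

Definition perms_of (n : nat) (L : seq (seq nat)) : {set {perm 'I_n}} :=
  [set p : {perm 'I_n} | has (fun s => perm_of n s == p) L].

Definition well_formed (I : instance) : bool :=
  let n := inst_n I in
  [&&
      all (fun e => sorted ltn e && all (fun v => v < n) e) (inst_edges I),
      uniq (inst_edges I),
      all (fun c => (c != [::]) && uniq c) (inst_classes I),
      perm_eq (flatten (inst_classes I)) (iota 0 n),
      size (inst_groups I) == size (inst_classes I),
      all (fun L => uniq L && all (valid_perm n) L) (inst_groups I) &
      all (fun iL : nat * seq (seq nat) =>
             let: (i, L) := iL in
             let c := nth [::] (inst_classes I) i in
             all (fun s => all (fun v => (v \in c) || (nth 0 s v == v)) (iota 0 n)) L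
             && group_set (perms_of n L))
          (zip (iota 0 (size (inst_groups I))) (inst_groups I))].

Definition edge_set (I : instance) : {set {set 'I_(inst_n I)}} :=
  [set e : {set 'I_(inst_n I)} |
     has (fun l => [set i : 'I_(inst_n I) | nat_of_ord i \in l] == e) (inst_edges I)].

Definition hyp_aut (I : instance) : {set {perm 'I_(inst_n I)}} :=
  [set p : {perm 'I_(inst_n I)} |
     [forall e : {set 'I_(inst_n I)}, (e \in edge_set I) == (p @: e \in edge_set I)]].

(* G_1 x ... x G_r, as the (internal direct) product inside Sym(V) *)
Definition prod_groups (I : instance) : {set {perm 'I_(inst_n I)}} :=
  <<\bigcup_(L <- inst_groups I) perms_of (inst_n I) L>>%g.

Definition target_group (I : instance) : {set {perm 'I_(inst_n I)}} :=
  hyp_aut I :&: prod_groups I.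

Definition correct_output (I : instance) (out : seq sym) : Prop :=
  exists (gens : seq (seq nat)) (k : nat),
    [/\ out = enc_natss gens ++ nseq k blank,
        all (valid_perm (inst_n I)) gens &
        <<perms_of (inst_n I) gens>>%g = target_group I].

(* Main.v *)
From HB Require Import structures.
From mathcomp Require Import all_boot all_order all_fingroup.
From mathcomp Require Import zify.
Require Import Defs.

(* A coset of a subgroup of Sym(V) is represented by a list that generates it under
   (x, y, z) |-> x y^-1 z; the empty list represents the empty set, and a union of cosets that is
   itself a coset is represented by the concatenation of lists.  Any such list is shrunk to
   polynomial size by sifting its elements through a table indexed by (first moved point, image).

   The colour classes are processed from the last one to the first one.  With W the union of the
   classes that precede the current position, and for all edges e and f, one maintains the coset
   Iso(e, f) of the elements of the product of the remaining groups that map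
   {e' \ W | e' in E, e' and e agree on W} onto {f' \ W | f' in E, f' and f agree on W}.  Adding
   the class of G_i on the left, Iso(e, f) becomes the union, over the g in G_i that match the
   traces on V_i, of g times the intersection of the old Iso(e', f') over the pairs (e', f')
   matched by g.  For W empty this is Aut(X) inside the product of the G_i.

   The intersection of two cosets A and B is the set of the pairs (a, b) of A x B that agree on
   V_1, ..., V_r.  The condition on V_i says that a^-1 b is trivial on V_i; since a^-1 b restricted
   to V_i lies in G_i restricted to V_i, this is a transporter computation in an orbit of size at
   most |G_i|, done with Schreier generators.

   Polynomial time is handled by a class of functions closed under composition, pairing, case
   analysis and size-bounded folds; their programs run on a machine with four stacks, which a
   Turing machine simulates by keeping the stacks one after the other, separated by blanks. *)

Set Implicit Arguments. Unset Strict Implicit. Unset Printing Implicit Defensive.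

(** * Simulating stacks on a Turing machine *)

(** The product of the G_i is too large to be listed, and intersecting cosets of arbitrary
    permutation groups is at least as hard as graph isomorphism. Both obstacles are avoided because
    each G_i is given by its elements: one class at a time can be enumerated, and the orbits that
    occur are no longer than the list of G_i. The subproblems are indexed by pairs of edges because
    the sub-hypergraph left by a trace on W is named by any edge with that trace, so there are at
    most |E|^2 of them. They are cosets, possibly empty, rather than groups, because an element g
    may exchange the traces on its class. The functions shown to be polynomial-time are total, so
    size bounds must hold for malformed arguments too and not only for lists of permutations. *)

Definition sym_code (a : sym) : option (bool * bool) :=
  match a with
  | blank => None | zero => Some (false, false) | one => Some (false, true)
  | lbr => Some (true, false) | rbr => Some (true, true)
  end.
Definition sym_decode (o : option (bool * bool)) : sym :=
  match o with
  | None => blank | Some (false, false) => zero | Some (false, true) => one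
  | Some (true, false) => lbr | Some (true, true) => rbr
  end.
Lemma sym_codeK : cancel sym_code sym_decode. Proof. by case. Qed.
(** Control states below remember tape symbols, so [sym] has to be a finite type. *)
HB.instance Definition _ := Finite.copy sym (can_type sym_codeK).

Definition tape := (seq sym * sym * seq sym)%type.

Definition act (a : sym) (m : move) (t : tape) : tape :=
  let: (l, _, r) := t in
  match m with
  | mS => (l, a, r)
  | mR => (a :: l, hd_sym r, tl_sym r)
  | mL => (tl_sym l, hd_sym l, a :: r)
  end.

(** Unlike [tm_step], a run never idles in a halting state. The halting states of a component can
    therefore be given outgoing transitions in a larger machine, and the number of steps is
    exact. *)
Inductive runs (M : TM) : nat -> tm_state M -> tape -> tm_state M -> tape -> Prop :=
| runs0 q t : runs 0 q t q t
| runsS n q t q' a m q2 t2 :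
    ~~ @tm_halt M q -> @tm_delta M q t.1.2 = (q', a, m) ->
    runs n q' (act a m t) q2 t2 -> runs n.+1 q t q2 t2.

Lemma runs_trans M n m q t q1 t1 q2 t2 :
  @runs M n q t q1 t1 -> runs m q1 t1 q2 t2 -> runs (n + m) q t q2 t2.
Proof.
elim=> // {}n {}q {}t q' a mv q3 t3 hq hd _ IH /IH H.
by rewrite addSn; apply: runsS hq hd H.
Qed.

Definition config_of (M : TM) (q : tm_state M) (t : tape) : config M :=
  @Config M q t.1.1 t.1.2 t.2.

Lemma runs_iter M n q t q' t' :
  @runs M n q t q' t' -> iter n (@tm_step M) (config_of q t) = config_of q' t'.
Proof.
elim=> // {}n {}q {}t {}q' a mv q3 t3 hq hd _ IH.
rewrite iterSr -{}IH; congr iter; move: hd; case: t => [[l h] r] /= hd.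
by rewrite /tm_step /= (negbTE hq) hd; case: mv {hd}.
Qed.

Definition seq_sim (s s' : seq sym) := forall n, nth blank s n = nth blank s' n.
Definition teq (t t' : tape) : Prop :=
  [/\ seq_sim t.1.1 t'.1.1, t.1.2 = t'.1.2 & seq_sim t.2 t'.2].

Lemma seq_sim_hd s s' : seq_sim s s' -> hd_sym s = hd_sym s'.
Proof. by move=> /(_ 0); case: s; case: s'. Qed.
Lemma seq_sim_tl s s' : seq_sim s s' -> seq_sim (tl_sym s) (tl_sym s').
Proof. by move=> H n; rewrite /tl_sym !nth_behead. Qed.
Lemma seq_sim_cons a s s' : seq_sim s s' -> seq_sim (a :: s) (a :: s').
Proof. by move=> H [|n] /=. Qed.
Lemma seq_sim_cat u s s' : seq_sim s s' -> seq_sim (u ++ s) (u ++ s').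
Proof. by move=> H; elim: u => //= a u /(seq_sim_cons a). Qed.
Lemma seq_sim_blank : seq_sim [:: blank] [::].
Proof. by case=> [|[]]. Qed.
Lemma teq_refl t : teq t t. Proof. by []. Qed.
Lemma teq_sym t u : teq t u -> teq u t.
Proof. by case=> *; split=> // n; symmetry. Qed.
Lemma teq_trans t u v : teq t u -> teq u v -> teq t v.
Proof. by case=> A1 A2 A3 [B1 B2 B3]; split=> [n||n]; rewrite ?A1 ?A2 ?A3. Qed.

Lemma teq_act a m t u : teq t u -> teq (act a m t) (act a m u).
Proof.
case: t u => [[l h] r] [[l' h'] r'] [/= A1 A2 A3]; case: m; split=> //=;
  by [exact: seq_sim_hd | exact: seq_sim_tl | exact: seq_sim_cons].
Qed.

Lemma runs_teq M n q t q' t' u : @runs M n q t q' t' -> teq t u ->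
  exists2 u', runs n q u q' u' & teq t' u'.
Proof.
move=> H; elim: H u => {n q t q' t'}.
  by move=> q t u tu; exists u => //; constructor.
move=> n q t q' a m q2 t2 hq hd _ IH u tu.
have [u' ru tu'] := IH _ (teq_act a m tu).
by exists u' => //; apply: runsS ru => //; case: tu => _ <- _.
Qed.

(** The label of the halting state is the result of a run; it selects the machine that continues. *)
Record lm := LM { lm_tm :> TM; lm_lab : tm_state lm_tm -> sym }.

(* The specification of a machine is modulo trailing blanks on both sides of the tape. *)
Definition does (M : lm) (n : nat) (t : tape) (a : sym) (t' : tape) : Prop :=
  forall u, teq t u -> exists q' u',
    [/\ runs n (tm_start M) u q' u', tm_halt q', lm_lab q' = a & teq t' u'].

Lemma doesI (M : lm) n t q' t' : runs n (tm_start M) t q' t' -> tm_halt q' ->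
  does M n t (@lm_lab M q') t'.
Proof.
by move=> r h u tu; have [u' ru tu'] := runs_teq r tu; exists q', u'.
Qed.

Lemma does_teq M n t a t' u u' :
  does M n t a t' -> teq t u -> teq t' u' -> does M n u a u'.
Proof.
move=> H tu tu' v uv; have [q [v' [A B C D]]] := H v (teq_trans tu uv).
by exists q, v'; split=> //; apply: teq_trans D; apply: teq_sym.
Qed.

(** * Sequencing, branching and looping of machines *)

Section Comb.
Variables (M0 : lm) (Ms : sym -> lm) (back : sym -> bool).

Definition comb_state : finType :=
  (tm_state M0 + {a : sym & tm_state (Ms a)})%type.

(** One combinator for all control: when [M0] halts with label a, [Ms a] takes over, and [M0] is
    restarted after it if [back a]. Each passage costs one step that leaves the tape as it is,
    whence the successors in the running times below. *)
Definition comb_tm : TM := {|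
  tm_state := comb_state;
  tm_start := inl (tm_start M0);
  tm_halt := fun q : comb_state => match q with
    | inl _ => false
    | inr (existT a q) => tm_halt q && ~~ back a
    end;
  tm_delta := fun (q : comb_state) (x : sym) => match q with
    | inl q => if tm_halt q
               then (inr (existT _ (lm_lab q) (tm_start (Ms (lm_lab q)))) : comb_state, x, mS)
               else let: (q', y, m) := tm_delta q x in (inl q', y, m)
    | inr (existT a q) => if tm_halt q then (inl (tm_start M0), x, mS)
               else let: (q', y, m) := tm_delta q x in (inr (existT _ a q'), y, m)
    end |}.

Definition comb : lm := @LM comb_tm (fun q : comb_state =>
  match q with inl _ => blank | inr (existT a q) => lm_lab q end).

Lemma act_id t : act t.1.2 mS t = t. Proof. by case: t => [[]]. Qed.

Lemma comb_runs_l n q t q' t' : @runs M0 n q t q' t' ->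
  @runs comb n (inl q : comb_state) t (inl q' : comb_state) t'.
Proof.
elim=> {n q t q' t'} [q t|n q t q' a m q2 t2 hq hd _ IH]; first by constructor.
by apply: runsS IH => //=; rewrite (negbTE hq) hd.
Qed.

Lemma comb_runs_r a n q t q' t' : @runs (Ms a) n q t q' t' ->
  @runs comb n (inr (existT _ a q) : comb_state) t (inr (existT _ a q') : comb_state) t'.
Proof.
elim=> {n q t q' t'} [q t|n q t q' b m q2 t2 hq hd _ IH]; first by constructor.
by apply: runsS IH => //=; rewrite (negbTE hq) ?hd.
Qed.

Lemma comb_runs n t a t1 m b t2 : does M0 n t a t1 -> does (Ms a) m t1 b t2 ->
  forall u, teq t u -> exists (q : tm_state (Ms a)) u', [/\ runs (n + m.+1) (tm_start comb) u
     (inr (existT _ a q) : comb_state) u', tm_halt q, lm_lab q = b & teq t2 u'].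
Proof.
move=> H1 H2 u tu; have [q1 [u1 [r1 h1 la t1u1]]] := H1 u tu; subst a.
have [q2 [u2 [r2 h2 lb t2u2]]] := H2 _ t1u1.
exists q2, u2; split=> //.
apply: runs_trans (comb_runs_l r1) _; apply: runsS => //=; first by rewrite h1.
by rewrite act_id; apply: comb_runs_r r2.
Qed.

Lemma does_comb n t a t1 m b t2 : ~~ back a ->
  does M0 n t a t1 -> does (Ms a) m t1 b t2 -> does comb (n + m.+1) t b t2.
Proof.
move=> nb H1 H2 u tu; have [q [u' [r h lb tu']]] := comb_runs H1 H2 tu.
by exists (inr (existT _ a q) : comb_state), u'; split=> //=; rewrite h.
Qed.

Lemma does_loop n t a t1 m b t2 p c t3 : back a ->
  does M0 n t a t1 -> does (Ms a) m t1 b t2 -> does comb p t2 c t3 ->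
  does comb (n + m.+1 + p.+1) t c t3.
Proof.
move=> ba H1 H2 H3 u tu; have [q [u' [r h lb tu']]] := comb_runs H1 H2 tu.
have [q3 [u3 [r3 h3 lc tu3]]] := H3 _ tu'.
exists q3, u3; split=> //; apply: runs_trans r _.
apply: runsS => /=; rewrite ?h ?ba //.
by rewrite act_id.
Qed.

End Comb.

Definition tseq (M1 M2 : lm) : lm := comb M1 (fun=> M2) (fun=> false).

Lemma does_seq M1 M2 n t a t1 m b t2 :
  does M1 n t a t1 -> does M2 m t1 b t2 -> does (tseq M1 M2) (n + m.+1) t b t2.
Proof. by move=> H1 H2; apply: does_comb H1 H2. Qed.

Definition tskip : lm :=
  @LM {| tm_state := unit; tm_start := tt; tm_halt := fun=> true;
         tm_delta := fun q x => (q, x, mS) |} (fun=> blank).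

Lemma does_skip t : does tskip 0 t blank t.
Proof. by apply: (@doesI tskip _ _ tt) => //; constructor. Qed.

Fixpoint tpow (M : lm) (i : nat) : lm :=
  if i is i'.+1 then tseq M (tpow M i') else tskip.

Definition tp (l w : seq sym) : tape := (l, hd_sym w, tl_sym w).

Lemma teq_tp l l' w w' : seq_sim l l' -> seq_sim w w' -> teq (tp l w) (tp l' w').
Proof. by move=> A B; split=> //=; [exact: seq_sim_hd | exact: seq_sim_tl]. Qed.

Definition tright : lm :=
  @LM {| tm_state := bool; tm_start := false; tm_halt := id;
         tm_delta := fun q x => (x == blank, x, mR) |} (fun=> blank).

Lemma does_right l s r : blank \notin s ->
  does tright (size s).+1 (tp l (s ++ blank :: r)) blank (tp (blank :: rev s ++ l) r).
Proof.
move=> bs; apply: (@doesI tright _ _ true) => //=.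
elim: s l bs => [|a s IH] l /=.
  by move=> _; apply: runsS => //=; constructor.
rewrite inE negb_or => /andP[na bs]; apply: runsS => //=.
by rewrite eq_sym (negbTE na) rev_cons cat_rcons; apply: IH.
Qed.

(** The first two states step over the blank that ends the block to be crossed, and the scan stops
    at the blank before the block. For the first stack, [home] provides this blank on the left. *)
Definition tleft : lm :=
  @LM {| tm_state := option (option bool); tm_start := None;
         tm_halt := fun q => q == Some (Some true);
         tm_delta := fun (q : option (option bool)) x => match q with
           | None => (Some None, x, mL)
           | Some None => (Some (Some false), x, mL)
           | Some (Some _) => if x == blank then (Some (Some true), x, mR)
                              else (Some (Some false), x, mL)
           end |} (fun=> blank).

Lemma does_left l s w : blank \notin s ->
  does tleft (size s + 3) (tp (blank :: rev s ++ blank :: l) w) blank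
    (tp (blank :: l) (s ++ blank :: w)).
Proof.
move=> bs.
have step2 : forall s w, blank \notin s -> seq_sim w w ->
  @runs tleft (size s).+1 (Some (Some false))
   (tl_sym (rev s ++ blank :: l), hd_sym (rev s ++ blank :: l), w) (Some (Some true))
    (tp (blank :: l) (s ++ w)).
  move=> {bs w}s; elim/last_ind: s => [|s a IH] w //=.
    by move=> _ _; apply: runsS => //=; constructor.
  rewrite mem_rcons inE negb_or => /andP[na bs] _.
  rewrite size_rcons rev_rcons /=; apply: runsS => //=; first by rewrite eq_sym (negbTE na).
  by rewrite cat_rcons; apply: IH.
have E : teq (tp (blank :: rev s ++ blank :: l) w)
  (blank :: rev s ++ blank :: l, hd_sym w, tl_sym w) by [].
(* When w is empty, the cell under the head becomes an explicit blank of the right tape. *)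
have W : teq (tp (blank :: l) (s ++ blank :: hd_sym w :: tl_sym w))
    (tp (blank :: l) (s ++ blank :: w)).
  apply: teq_tp => //; apply: seq_sim_cat; apply: seq_sim_cons; case: w {E} => //=.
  exact: seq_sim_blank.
apply: does_teq W; last exact: E.
apply: (@doesI tleft _ _ (Some (Some true))) => //=.
rewrite addn3; apply: runsS => //=; apply: runsS => //=.
by apply: step2.
Qed.

(** The state carries the symbol displaced by the last write, so the block moves one cell to the
    right, over its own terminator. *)
Definition tins (c : sym) : lm :=
  @LM {| tm_state := option sym; tm_start := Some c; tm_halt := fun q => q == None;
         tm_delta := fun (q : option sym) x =>
           (if x == blank then None else Some x, odflt blank q, mR) |} (fun=> blank).

Lemma does_ins c l s r : blank \notin s ->
  does (tins c) (size s).+1 (tp l (s ++ blank :: r)) blank (tp (rev s ++ c :: l) r).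
Proof.
move=> bs; apply: (@doesI (tins c) _ _ None) => //=.
suff H d : @runs (tins c) (size s).+1 (Some d) (tp l (s ++ blank :: r)) None
  (tp (rev s ++ d :: l) r) by apply: H.
elim: s d l bs => [|a s IH] d l /=.
  by move=> _; apply: runsS => //=; constructor.
rewrite inE negb_or => /andP[na bs]; apply: runsS => //=.
by rewrite eq_sym (negbTE na) rev_cons cat_rcons; apply: IH.
Qed.

(* The states are: step right, read a symbol, write it one cell to the left. *)
Definition tdel : lm :=
  @LM {| tm_state := option (option (option sym)); tm_start := None;
         tm_halt := fun q => q == Some None;
         tm_delta := fun (q : option (option (option sym))) x => match q with
           | None => (Some (Some None), x, mR)
           | Some (Some None) => (Some (Some (Some x)), x, mL)
           | Some (Some (Some y)) => (if y == blank then Some None else None, y, mR)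
           | Some None => (q, x, mS)
           end |} (fun=> blank).

Lemma does_del h l s r : blank \notin s ->
  does tdel (3 * (size s).+1) (tp l (h :: s ++ blank :: r)) blank
    (tp (blank :: rev s ++ l) (blank :: r)).
Proof.
move=> bs; apply: (@doesI tdel _ _ (Some None)) => //=.
elim: s h l bs => [|a s IH] h l /=.
  by move=> _; do 3 apply: runsS => //=; constructor.
rewrite inE negb_or => /andP[na bs]; rewrite mulnS.
do 2 apply: runsS => //=; apply: runsS => //=.
by rewrite eq_sym (negbTE na) rev_cons cat_rcons; apply: IH.
Qed.

Definition tread : lm :=
  @LM {| tm_state := option sym; tm_start := None; tm_halt := fun q => q != None;
         tm_delta := fun (q : option sym) x => (Some x, x, mS) |} (fun q => odflt blank q).

Lemma does_read t : does tread 1 t t.1.2 t.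
Proof.
apply: (@doesI tread _ _ (Some t.1.2)) => //=; apply: runsS => //=.
by rewrite act_id; constructor.
Qed.

(** * Stacks written on the tape *)

Definition store := seq (seq sym).
Definition flat (S : store) : seq sym := flatten [seq s ++ [:: blank] | s <- S].
Definition pure (S : store) := all (fun s : seq sym => blank \notin s) S.

Lemma flat_cons s S : flat (s :: S) = s ++ blank :: flat S.
Proof. by rewrite /flat /= -catA. Qed.
Lemma flat_cat S1 S2 : flat (S1 ++ S2) = flat S1 ++ flat S2.
Proof. by rewrite /flat map_cat flatten_cat. Qed.
Lemma flat_rcons S s : flat (rcons S s) = flat S ++ s ++ [:: blank].
Proof. by rewrite -cats1 flat_cat flat_cons. Qed.

Lemma does_rights l w S : pure S ->
  does (tpow tright (size S)) (size (flat S) + size S) (tp l (flat S ++ w)) blank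
    (tp (rev (flat S) ++ l) w).
Proof.
elim: S l => [|s S IH] l /=; first by move=> _; apply: does_skip.
case/andP=> bs pS; rewrite flat_cons rev_cat rev_cons cat_rcons -!catA /=.
have := does_seq (@does_right l s (flat S ++ w) bs) (IH _ pS).
by rewrite size_cat /= !addnS !addSn addnA.
Qed.

Lemma does_lefts w S : pure S ->
  does (tpow tleft (size S)) (size (flat S) + 3 * size S) (tp (rev (flat S) ++ [:: blank]) w)
    blank (tp [:: blank] (flat S ++ w)).
Proof.
elim/last_ind: S w => [|S s IH] w; first by move=> _; apply: does_skip.
rewrite /pure all_rcons => /andP[bs pS].
have [l El] : exists l, rev (flat S) ++ [:: blank] = blank :: l.
  case/lastP: S {IH pS} => [|S s']; first by exists [::].
  by rewrite flat_rcons !rev_cat -!catA /=; eexists.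
rewrite flat_rcons !rev_cat -!catA El size_rcons /=.
have := does_seq (@does_left l s w bs).
rewrite -El => /(_ _ _ _ _ (IH _ pS)); rewrite El.
rewrite !size_cat /=; congr does; lia.
Qed.

(** Each inserted blank replaces the terminator consumed by the insertion before it. The last one is
    still missing at the end: the left tape must receive one more blank to be that of the shifted
    stacks. *)
Lemma does_inss l S : pure S ->
  exists2 l', rev (flat S) ++ blank :: l = blank :: l' &
  does (tpow (tins blank) (size S)) (size (flat S) + size S) (tp l (flat S)) blank
    (tp l' [::]).
Proof.
elim: S l => [|s S IH] l /=; first by exists l => //; apply: does_skip.
case/andP=> bs pS; have [l' El' D] := IH (rev s ++ blank :: l) pS.
exists l'; first by rewrite flat_cons rev_cat rev_cons cat_rcons -!catA /=.
have := does_seq (@does_ins blank l s (flat S) bs) D.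
by rewrite flat_cons size_cat /= !addnS !addSn addnA.
Qed.

Lemma does_dels l h S : pure S ->
  does (tpow tdel (size S)) (3 * size (flat S) + size S) (tp l (h :: flat S)) blank
    (tp (rev (flat S) ++ l) [:: if S is [::] then h else blank]).
Proof.
elim: S l h => [|s S IH] l h /=; first by move=> _; apply: does_skip.
case/andP=> bs pS; rewrite flat_cons rev_cat rev_cons cat_rcons -!catA /=.
have := does_seq (@does_del h l s (flat S) bs) (IH _ blank pS).
have -> : (if S is [::] then blank else blank) = blank by case: (S).
rewrite size_cat /=; congr does; lia.
Qed.

(** Stack 0 holds the values, stacks 1 and 2 are scratch space, stack 3 is a unary counter that
    controls loops. *)
Definition K := 4.

(** The final [tright] steps over a fresh blank cell, which becomes the terminator of the last
    stack. *)
Definition tpush i a := tseq (tpow tright i) (tseq (tins a)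
  (tseq (tpow (tins blank) (K - i.+1)) (tseq tright (tpow tleft K)))).
Definition tlook i := tseq (tpow tright i) tread.
Definition tfix i (a : sym) :=
  if a == blank then tpow tleft i else tseq (tpow tdel (K - i)) (tpow tleft K).

(* The stacks are stored one after the other, each followed by a blank, the head being on the
   first cell of the first stack.  [tlook i] moves to stack [i] and reads its top,
   [tfix i a] pops it (unless [a] is blank, i.e. the stack is empty) and returns home. *)
Definition home (S : store) : tape := tp [:: blank] (flat S).

Lemma does_push S1 s S2 a : pure (S1 ++ s :: S2) -> a != blank -> size (S1 ++ s :: S2) = K ->
  exists2 n, n <= 10 * (size (flat (S1 ++ s :: S2)) + 10) &
  does (tpush (size S1) a) n (home (S1 ++ s :: S2)) blank (home (S1 ++ (a :: s) :: S2)).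
Proof.
move=> pS na szS.
have pS' : pure (S1 ++ (a :: s) :: S2).
  by move: pS; rewrite /pure !all_cat /= inE (eq_sym blank) (negbTE na).
move: pS; rewrite {1}/pure all_cat /= => /and3P[p1 bs p2].
have sz' : size (S1 ++ (a :: s) :: S2) = K by move: szS; rewrite !size_cat.
rewrite /tpush; have -> : K - (size S1).+1 = size S2 by move: szS; rewrite size_cat /=; lia.
have D1 := @does_rights [:: blank] (flat (s :: S2)) S1 p1.
rewrite -flat_cat flat_cons in D1.
have D2 := @does_ins a (rev (flat S1) ++ [:: blank]) s (flat S2) bs.
have [l' El' D3] := @does_inss (rev s ++ a :: rev (flat S1) ++ [:: blank]) S2 p2.
have D4 : does tright 1 (tp l' [::]) blank (tp (blank :: l') [::]).
  apply: does_teq (@does_right l' [::] [::] isT) _ _; apply: teq_tp => //.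
  exact: seq_sim_blank.
have D5 := @does_lefts [::] _ pS'; rewrite cats0 sz' in D5.
have E : rev (flat (S1 ++ (a :: s) :: S2)) ++ [:: blank] = blank :: l'.
  by rewrite -El' flat_cat flat_cons !rev_cat rev_cons rev_cons -!cats1 -!catA.
rewrite E in D5.
have := does_seq D1 (does_seq D2 (does_seq D3 (does_seq D4 D5))).
eexists; last by eassumption.
move: szS; rewrite !flat_cat !flat_cons ?size_cat /= ?size_cat /=; rewrite /K; lia.
Qed.

Lemma does_look S1 s S2 : pure (S1 ++ s :: S2) ->
  does (tlook (size S1)) (size (flat S1) + size S1 + 2) (home (S1 ++ s :: S2))
    (hd_sym s) (tp (rev (flat S1) ++ [:: blank]) (flat (s :: S2))).
Proof.
rewrite {1}/pure all_cat /= => /and3P[p1 bs p2].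
have D1 := @does_rights [:: blank] (flat (s :: S2)) S1 p1.
rewrite -flat_cat in D1.
have := does_seq D1 (@does_read _); congr does.
by rewrite flat_cons; case: (s).
Qed.

Lemma does_fix S1 s S2 : pure (S1 ++ s :: S2) -> size (S1 ++ s :: S2) = K ->
  exists2 n, n <= 10 * (size (flat (S1 ++ s :: S2)) + 5) &
  does (tfix (size S1) (hd_sym s)) n (tp (rev (flat S1) ++ [:: blank]) (flat (s :: S2)))
   blank (home (S1 ++ behead s :: S2)).
Proof.
rewrite {1}/pure all_cat /= => /and3P[p1 bs p2] szS.
rewrite /tfix; case: eqP => [hb|/eqP hb].
  have -> : s = [::] by case: s bs hb {szS} => //= a s; rewrite inE => /norP[/eqP n _] /= e; case: n.
  have := @does_lefts (flat ([::] :: S2)) S1 p1.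
  rewrite -flat_cat => D; eexists; last exact: D.
  move: szS; rewrite !flat_cat !flat_cons !size_cat /= /K; lia.
case: s bs hb szS => //= a s bs hb szS.
have {}bs : blank \notin s by move: bs; rewrite inE => /norP[].
have -> : K - size S1 = size (s :: S2) by move: szS; rewrite size_cat /=; lia.
have D1 := @does_dels (rev (flat S1) ++ [:: blank]) a (s :: S2).
rewrite /pure /= bs p2 catA -rev_cat -flat_cat in D1.
have p3 : pure (S1 ++ s :: S2) by rewrite /pure all_cat /= bs p1.
have := @does_lefts [:: blank] _ p3.
have -> : size (S1 ++ s :: S2) = K by move: szS; rewrite !size_cat.
move/(does_seq (D1 isT)) => D2.
eexists; last first.
  apply: does_teq D2 (teq_refl _) _; apply: teq_tp => //.
  rewrite -[X in seq_sim _ X]cats0; apply: seq_sim_cat; exact: seq_sim_blank.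
move: szS; rewrite !flat_cat !flat_cons ?size_cat /= ?size_cat /= /K; lia.
Qed.

(** * Stack programs and their compilation *)

Inductive cmd :=
| Skip
| Push (i : nat) (a : sym)
| Seq (c1 c2 : cmd)
| Case (i : nat) (f : sym -> cmd)
| Loop (i : nat) (f : sym -> cmd).

Fixpoint comp (c : cmd) : lm :=
  match c with
  | Skip => tskip
  | Push i a => tpush i a
  | Seq c1 c2 => tseq (comp c1) (comp c2)
  | Case i f => comb (tlook i) (fun a => tseq (tfix i a) (comp (f a))) (fun=> false)
  | Loop i f => comb (tlook i)
      (fun a => tseq (tfix i a) (if a == blank then tskip else comp (f a)))
      (fun a => a != blank)
  end.

Definition pop i (S : store) := set_nth [::] S i (behead (nth [::] S i)).

(* [Case] pops stack [i] and branches on the popped symbol ([blank] if the stack is empty);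
   [Loop] does so repeatedly until the stack is empty. *)
Inductive exec : cmd -> nat -> store -> store -> Prop :=
| ESkip S : exec Skip 0 S S
| EPush i a S : i < K -> a != blank ->
    exec (Push i a) 1 S (set_nth [::] S i (a :: nth [::] S i))
| ESeq c1 c2 n m S S1 S2 : exec c1 n S S1 -> exec c2 m S1 S2 ->
    exec (Seq c1 c2) (n + m).+1 S S2
| ECase i f n S S1 : i < K -> exec (f (hd_sym (nth [::] S i))) n (pop i S) S1 ->
    exec (Case i f) n.+1 S S1
| EStop i f S : i < K -> nth [::] S i = [::] -> exec (Loop i f) 1 S S
| ELoop i f n m S S1 S2 : i < K -> nth [::] S i != [::] ->
    exec (f (hd_sym (nth [::] S i))) n (pop i S) S1 ->
    exec (Loop i f) m S1 S2 -> exec (Loop i f) (n + m).+1 S S2.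

Lemma store_split (i : nat) (S : store) : i < size S ->
  exists S1 s S2, [/\ S = S1 ++ s :: S2, size S1 = i, nth [::] S i = s &
     forall x, set_nth [::] S i x = S1 ++ x :: S2].
Proof.
elim: S i => // s S IH [|i] /=; first by exists [::], s, S.
rewrite ltnS => /IH [S1 [s' [S2 [e0 e1 e2 e3]]]].
by exists (s :: S1), s', S2; rewrite /= e1 e2 -e0; split=> // x; rewrite e3.
Qed.

(** A unit of cost adds at most one symbol to the stacks and takes a bounded number of sweeps over
    the tape. The bound holds for every m above the initial size plus n, so that all parts of a run
    can share a single estimate. *)
Lemma exec_sound c n S S' : exec c n S S' -> pure S -> size S = K ->
  [/\ pure S', size S' = K, size (flat S') <= size (flat S) + n &
   forall m, size (flat S) + n <= m ->
     exists t b, t <= n * (40 * (m + 10)) /\ does (comp c) t (home S) b (home S')].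
Proof.
elim=> {c n S S'}.
- move=> S pS sS; split=> //; first by rewrite addn0.
  by move=> m _; exists 0, blank; split=> //; apply: does_skip.
- move=> i a S iK na pS sS; have [S1 [s [S2 [E1 E2 E3 E4]]]] := @store_split i S ltac:(by rewrite sS).
  rewrite E3 E4; subst S; subst i.
  have [n nb D] := does_push pS na sS.
  split.
  + by move: pS; rewrite /pure !all_cat /= inE (eq_sym blank) (negbTE na).
  + by rewrite -sS !size_cat.
  + by rewrite !flat_cat !flat_cons !size_cat /=; lia.
  + by move=> m hm; exists n, blank; split=> //; lia.
- move=> c1 c2 n m S S1 S2 _ IH1 _ IH2 pS sS.
  have [p1 s1 z1 D1] := IH1 pS sS; have [p2 s2 z2 D2] := IH2 p1 s1.
  split=> //; first by lia.
  move=> M hM; have [t1 [b1 [h1 {}D1]]] := D1 M ltac:(lia).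
  have [t2 [b2 [h2 {}D2]]] := D2 M ltac:(lia).
  exists (t1 + t2.+1), b2; split; last exact: does_seq D1 D2.
  by rewrite mulSn mulnDl; lia.
- move=> i f n S S1 iK _ IH pS sS.
  have [T1 [s [T2 [E1 E2 E3 E4]]]] := @store_split i S ltac:(by rewrite sS).
  rewrite /pop E3 E4 in IH; subst S; subst i.
  have [pp sp lp] : [/\ pure (T1 ++ behead s :: T2), size (T1 ++ behead s :: T2) = K &
       size (flat (T1 ++ behead s :: T2)) <= size (flat (T1 ++ s :: T2))].
    split; last by rewrite !flat_cat !flat_cons !size_cat /= size_behead; lia.
      by move: pS; rewrite /pure !all_cat /= => /and3P[-> h ->];
        rewrite andbT /=; apply: contra h; apply: mem_behead.
    by rewrite -sS !size_cat.
  have [p1 s1 z1 D1] := IH pp sp.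
  split=> //; first by lia.
  move=> M hM; have [t1 [b1 [h1 {}D1]]] := D1 M ltac:(lia).
  have [t2 h2 D2] := does_fix pS sS.
  eexists; exists b1; split; last first.
    apply: does_comb (does_look pS) (does_seq D2 D1) => //.
  have : size (flat T1) + size T1 <= M + 4.
    by move: sS hM; rewrite !flat_cat !size_cat /= /K; lia.
  by rewrite mulSn; lia.
- move=> i f S iK e pS sS.
  have [T1 [s [T2 [E1 E2 E3 E4]]]] := @store_split i S ltac:(by rewrite sS).
  split=> //; first by lia.
  move=> M hM; rewrite e in E3; subst S s; subst i.
  have [t2 h2 D2] := does_fix pS sS.
  eexists; exists blank; split; last first.
    by apply: does_comb (does_look pS) (does_seq D2 (@does_skip _)).
  have : size (flat T1) + size T1 <= M + 4.
    by move: sS hM; rewrite !flat_cat !size_cat /= /K; lia.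
  by rewrite mul1n; lia.
- move=> i f n m S S1 S2 iK ne _ IH _ IH2 pS sS.
  have [T1 [s [T2 [E1 E2 E3 E4]]]] := @store_split i S ltac:(by rewrite sS).
  rewrite /pop E3 E4 in IH; rewrite E3 in ne; subst S; subst i.
  have [pp sp lp] : [/\ pure (T1 ++ behead s :: T2), size (T1 ++ behead s :: T2) = K &
       size (flat (T1 ++ behead s :: T2)) <= size (flat (T1 ++ s :: T2))].
    split; last by rewrite !flat_cat !flat_cons !size_cat /= size_behead; lia.
      by move: pS; rewrite /pure !all_cat /= => /and3P[-> h ->];
        rewrite andbT /=; apply: contra h; apply: mem_behead.
    by rewrite -sS !size_cat.
  have [p1 s1 z1 D1] := IH pp sp.
  have [p2 s2 z2 D2] := IH2 p1 s1.
  split=> //; first by lia.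
  move=> M hM; have [t1 [b1 [h1 {}D1]]] := D1 M ltac:(lia).
  have [t2 [b2 [h2 {}D2]]] := D2 M ltac:(lia).
  have [t3 h3 D3] := does_fix pS sS.
  have hb : hd_sym s != blank.
    move: pS; rewrite /pure all_cat /= => /and3P[_ h _].
    by case: s h ne {D3 D2 IH E3 E4 pp sp lp sS z1 D1 hM h3} => //= a s; rewrite inE eq_sym => /norP[].
  have D4 : does (if hd_sym s == blank then tskip else comp (f (hd_sym s))) t1
     (home (T1 ++ behead s :: T2)) b1 (home S1) by rewrite (negbTE hb).
  eexists; exists b2; split; last first.
    by apply: does_loop (does_look pS) (does_seq D3 D4) D2.
  have : size (flat T1) + size T1 <= M + 4.
    by move: sS hM; rewrite !flat_cat !size_cat /= /K; lia.
  by rewrite mulSn mulnDl; lia.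
Qed.

(** * Polynomial-time functions on encoded data *)

Inductive tree := Leaf | Node (l r : tree).

(** Preorder notation is self-delimiting: values can be piled up on a stack without separators, and
    the code of a pair contains those of its components as segments. *)
Fixpoint code (t : tree) : seq sym :=
  if t is Node l r then one :: code l ++ code r else [:: zero].

Lemma code_pure t : blank \notin code t.
Proof. by elim: t => //= l IHl r IHr; rewrite inE mem_cat negb_or /= negb_or IHl. Qed.

Lemma code_gt0 t : 0 < size (code t). Proof. by case: t. Qed.

(** * Basic programs on piles of encoded values *)

Definition st (b : bool) (v x y c : seq sym) : store :=
  if b then [:: v; x; y; c] else [:: v; y; x; c].
Definition tmp (b : bool) := if b then 1 else 2.

(** Stack 3 counts the subtrees still to be moved: a node replaces one of them by two, a leaf
    completes one. The flag b chooses the scratch stack that receives the code. *)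
Definition mvT b := Seq (Push 3 zero) (Loop 3 (fun=> Case 0 (fun a =>
  match a with
  | zero => Push (tmp b) zero
  | one => Seq (Push (tmp b) one) (Seq (Push 3 zero) (Push 3 zero))
  | _ => Skip
  end))).

Lemma EPush' i a S S' : i < K -> a != blank ->
  S' = set_nth [::] S i (a :: nth [::] S i) -> exec (Push i a) 1 S S'.
Proof. by move=> h1 h2 ->; apply: EPush. Qed.

Ltac ex_push := apply: EPush'; [by []|by []|reflexivity].

Lemma exec_mvT b t v x y : exists2 n, n <= 12 * size (code t) &
  exec (mvT b) n (st b (code t ++ v) x y [::]) (st b v (rev (code t) ++ x) y [::]).
Proof.
rewrite /mvT; set L := Loop _ _.
(* The remainder of the loop is a parameter of the claim, so that the runs for the two subtrees of a
   node can be chained. *)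
have H : forall t v x m p S', exec L p (st b v (rev (code t) ++ x) y (nseq m zero)) S' ->
  exists2 q, q <= p + 8 * size (code t) & exec L q (st b (code t ++ v) x y (nseq m.+1 zero)) S'.
  elim=> [|l IHl r IHr] {}v {}x m p S' /= ex.
    exists (2 + p).+1; first by lia.
    apply: ELoop ex => //; first by case: (b).
    by case: (b); apply: ECase => //=; ex_push.
  rewrite rev_cons rev_cat -cats1 -!catA cat1s in ex.
  have [q1 h1 e1] := IHr _ _ _ _ _ ex; have [q2 h2 e2] := IHl _ _ _ _ _ e1.
  exists (6 + q2).+1; first by rewrite size_cat; lia.
  rewrite -catA; apply: ELoop e2 => //; first by case: (b).
  case: (b); apply: ECase => //=; apply: (@ESeq _ _ 1 3); try ex_push;
  by apply: (@ESeq _ _ 1 1); ex_push.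
have [q h1 h2] := H t v x 0 1 (st b v (rev (code t) ++ x) y [::])
  ltac:(by apply: EStop => //; case: (b)).
exists (1 + q).+1; first by have := code_gt0 t; lia.
by apply: (@ESeq _ _ 1 q _ _ _ _ h2); case: (b); ex_push.
Qed.

Definition flush b := Loop (tmp b) (fun a => Push 0 a).

Lemma exec_flush b (w v y : seq sym) : blank \notin w ->
  exec (flush b) (2 * size w + 1) (st b v (rev w) y [::]) (st b (w ++ v) [::] y [::]).
Proof.
elim/last_ind: w v => [|w a IH] v; first by move=> _; apply: EStop; case: b.
rewrite mem_rcons inE negb_or => /andP[na bw]; rewrite rev_rcons size_rcons.
have -> : 2 * (size w).+1 + 1 = (1 + (2 * size w + 1)).+1 by lia.
have := IH (a :: v) bw; rewrite cat_rcons; apply: ELoop; [by case: (b)|by case: (b)|].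
by case: (b); apply: EPush' => //=; rewrite eq_sym.
Qed.

Definition clear b := Loop (tmp b) (fun=> Skip).

Lemma exec_clear b w v y :
  exec (clear b) (size w + 1) (st b v w y [::]) (st b v [::] y [::]).
Proof.
elim: w => [|a w IH]; first by apply: EStop; case: b.
by rewrite addSn -[size w + 1]add0n; apply: ELoop IH; case: (b) => //=; apply: ESkip.
Qed.

Definition V1 v : store := [:: v; [::]; [::]; [::]].

Definition does_on (c : cmd) m (v v' : seq sym) := exists2 n, n <= m & exec c n (V1 v) (V1 v').

Lemma does_on_seq c1 c2 m1 m2 v1 v2 v3 : does_on c1 m1 v1 v2 -> does_on c2 m2 v2 v3 ->
  does_on (Seq c1 c2) (m1 + m2).+1 v1 v3.
Proof.
case=> n1 h1 e1 [n2 h2 e2]; exists (n1 + n2).+1; first by lia.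
exact: ESeq e1 e2.
Qed.

Lemma does_on_le c m m' v v' : does_on c m v v' -> m <= m' -> does_on c m' v v'.
Proof. by case=> n h e h'; exists n => //; apply: leq_trans h h'. Qed.

Definition cdup := Seq (mvT true) (Seq
  (Loop 1 (fun a => Seq (Push 0 a) (Push 2 a)))
  (Seq (Loop 2 (fun a => Push 1 a)) (flush true))).

Lemma does_dup t v : does_on cdup (30 * size (code t)) (code t ++ v) (code t ++ code t ++ v).
Proof.
have [n h e] := exec_mvT true t v [::] [::]; rewrite cats0 in e.
have e1 : forall w v y : seq sym, blank \notin w ->
   exec (Loop 1 (fun a => Seq (Push 0 a) (Push 2 a))) (4 * size w + 1)
     [:: v; rev w; y; [::]] [:: w ++ v; [::]; w ++ y; [::]].
  elim/last_ind=> [|w a IH] u y; first by move=> _; apply: EStop.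
  rewrite mem_rcons inE negb_or => /andP[na bw]; rewrite rev_rcons size_rcons.
  have -> : 4 * (size w).+1 + 1 = (3 + (4 * size w + 1)).+1 by lia.
  have := IH (a :: u) (a :: y) bw; rewrite !cat_rcons; apply: ELoop => //=.
  by apply: (@ESeq _ _ 1 1); (apply: EPush'; [by []|by rewrite /= eq_sym|reflexivity]).
have e2 : forall w v y : seq sym, blank \notin w ->
   exec (Loop 2 (fun a => Push 1 a)) (2 * size w + 1)
     [:: v; y; w; [::]] [:: v; rev w ++ y; [::]; [::]].
  elim=> [|a w IH] u y; first by move=> _; apply: EStop.
  rewrite inE negb_or => /andP[na bw] /=.
  have -> : 2 * (size w).+1 + 1 = (1 + (2 * size w + 1)).+1 by lia.
  have := IH u (a :: y) bw; rewrite rev_cons cat_rcons; apply: ELoop => //=.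
  by apply: EPush'; [by []|by rewrite /= eq_sym|reflexivity].
have := e1 _ v [::] (code_pure t); have := e2 _ (code t ++ v) [::] (code_pure t).
rewrite !cats0 => f2 f1.
have f3 := exec_flush true (code t ++ v) [::] (code_pure t).
eexists; last exact: (ESeq e (ESeq f1 (ESeq f2 f3))).
by have := code_gt0 t; lia.
Qed.

Definition cswap := Seq (mvT true) (Seq (mvT false) (Seq (flush true) (flush false))).

Lemma does_swap t u v : does_on cswap (20 * (size (code t) + size (code u)))
  (code t ++ code u ++ v) (code u ++ code t ++ v).
Proof.
have [n1 h1 e1] := exec_mvT true t (code u ++ v) [::] [::]; rewrite cats0 in e1.
have [n2 h2 e2] := exec_mvT false u v [::] (rev (code t)); rewrite cats0 in e2.
have e3 := exec_flush true v (rev (code u)) (code_pure t).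
have e4 := exec_flush false (code t ++ v) [::] (code_pure u).
eexists; last exact: (ESeq e1 (ESeq e2 (ESeq e3 e4))).
by have := code_gt0 t; have := code_gt0 u; lia.
Qed.

Definition cdrop := Seq (mvT true) (clear true).

Lemma does_drop t v : does_on cdrop (20 * size (code t)) (code t ++ v) v.
Proof.
have [n1 h1 e1] := exec_mvT true t v [::] [::]; rewrite cats0 in e1.
eexists; last exact: (ESeq e1 (exec_clear true (rev (code t)) v [::])).
by have := code_gt0 t; rewrite size_rev; lia.
Qed.

Lemma does_push0 (a : sym) v : a != blank -> does_on (Push 0 a) 1 v (a :: v).
Proof. by move=> na; exists 1 => //; apply: EPush'. Qed.

Lemma does_case0 f a v m v' : does_on (f a) m v v' -> does_on (Case 0 f) m.+1 (a :: v) v'.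
Proof. by case=> n h e; exists n.+1 => //; apply: ECase. Qed.

Fixpoint cconst (w : seq sym) : cmd :=
  if w is a :: w' then Seq (cconst w') (Push 0 a) else Skip.

Lemma exec_const (w v x y z : seq sym) : blank \notin w ->
  exec (cconst w) (2 * size w) [:: v; x; y; z] [:: w ++ v; x; y; z].
Proof.
elim: w => [|a w IH] /=; first by move=> _; apply: ESkip.
rewrite inE negb_or eq_sym => /andP[na /IH H].
have -> : 2 * (size w).+1 = (2 * size w + 1).+1 by lia.
by apply: ESeq H _; apply: EPush'.
Qed.

Lemma does_const (w v : seq sym) : blank \notin w -> does_on (cconst w) (2 * size w) v (w ++ v).
Proof. by move=> bw; exists (2 * size w) => //; apply: exec_const. Qed.

(** Meant for pairs: the code starts with [one], and its second symbol tells whether the first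
    component is a leaf, in use the exhausted list of a fold. Stack 3 is empty while c runs, as c
    requires, and is refilled to continue. *)
Definition cwhile c := Seq (Push 3 zero) (Loop 3 (fun=> Case 0 (fun=> Case 0 (fun a =>
  if a is zero then Seq (Push 0 zero) (Push 0 one)
  else Seq (Push 0 one) (Seq (Push 0 one) (Seq c (Push 3 zero))))))).

Lemma ppow_le n a b : a <= b -> (n + 2) ^ a <= (n + 2) ^ b.
Proof. by move=> h; rewrite leq_pexp2l // addn2. Qed.

(** * Polynomial bounds *)

Lemma ppow_gt0 n a : 0 < (n + 2) ^ a. Proof. by rewrite expn_gt0 addn2. Qed.

Lemma ppow_const n a : a <= (n + 2) ^ a.
Proof. by apply: ltnW; apply: ltn_expl; rewrite addn2. Qed.

Lemma ppow_add n a b : (n + 2) ^ a + (n + 2) ^ b <= (n + 2) ^ (a + b + 1).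
Proof.
rewrite expnD expn1 addn2.
have := @ppow_le n a (a + b) ltac:(lia); have := @ppow_le n b (a + b) ltac:(lia).
rewrite addn2; move: (n.+2 ^ (a + b)) => z; nia.
Qed.

(** As the base is at least 2, single powers of n + 2 dominate constants and are closed, up to
    domination, under sums, products and composition. *)
Definition isP (p : nat -> nat) := exists k, forall n, p n <= (n + 2) ^ k.

Lemma isP_le p q : isP q -> (forall n, p n <= q n) -> isP p.
Proof. by case=> k h H; exists k => n; apply: leq_trans (h n). Qed.
Lemma isP_id : isP id.
Proof. by exists 1 => n; rewrite expn1 leq_addr. Qed.
Lemma isP_const c : isP (fun=> c).
Proof. by exists c => n; apply: ppow_const. Qed.
Lemma isP_add p q : isP p -> isP q -> isP (fun n => p n + q n).
Proof.
case=> a ha [b hb]; exists (a + b + 1) => n.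
by apply: leq_trans (ppow_add n a b); apply: leq_add.
Qed.
Lemma isP_mul p q : isP p -> isP q -> isP (fun n => p n * q n).
Proof.
case=> a ha [b hb]; exists (a + b) => n.
by rewrite expnD; apply: leq_mul.
Qed.
Lemma isP_pow c k : isP (fun n => (n + c) ^ k).
Proof.
elim: k => [|k IH]; first by apply: isP_le (isP_const 1) _ => n.
by apply: isP_le (isP_mul (isP_add isP_id (isP_const c)) IH) _ => n; rewrite expnS.
Qed.
Lemma isP_comp p q : isP p -> isP q -> isP (fun n => p (q n)).
Proof.
case=> a ha [b hb].
have [k hk] := isP_pow 2 a.
exists ((b + 2) * a) => n; apply: leq_trans (ha _) _.
rewrite expnM; case: a {ha hk} => [|a]; first by rewrite !expn0.
rewrite leq_exp2r //; apply: leq_trans (_ : (n + 2) ^ b + 2 <= _); first by rewrite leq_add2r.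
by rewrite expnD; have := ppow_gt0 n b; move: ((n + 2) ^ b) => z; nia.
Qed.

(** * Functions computed in polynomial time *)

Class Enc (A : Type) := enc : A -> tree.

Definition sz {A} {EA : Enc A} (a : A) : nat := size (code (enc a)).

#[global] Instance enc_tree : Enc tree := id.
#[global] Instance enc_unit : Enc unit := fun=> Leaf.
#[global] Instance enc_natI : Enc nat := fun n => iter n (Node Leaf) Leaf.
#[global] Instance enc_bool : Enc bool := fun b : bool => if b then Node Leaf Leaf else Leaf.
#[global] Instance enc_seq A (EA : Enc A) : Enc (seq A) :=
  fun s => foldr (fun a t => Node (enc a) t) Leaf s.
#[global] Instance enc_prod A B (EA : Enc A) (EB : Enc B) : Enc (A * B)%type :=
  fun p => Node (enc p.1) (enc p.2).
#[global] Instance enc_sym : Enc sym := fun a =>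
  enc (match a with blank => 0 | zero => 1 | one => 2 | lbr => 3 | rbr => 4 end).

(* The argument is on the top of the first stack, the other stacks are empty, and the number of
   steps does not depend on the values [v] below the argument. *)
Definition PT {A B} {EA : Enc A} {EB : Enc B} (f : A -> B) :=
  exists c k, forall a v,
    does_on c ((sz a + 2) ^ k) (code (enc a) ++ v) (code (enc (f a)) ++ v).

Lemma PT_intro A B (EA : Enc A) (EB : Enc B) (f : A -> B) c p : isP p ->
  (forall a v, does_on c (p (sz a)) (code (enc a) ++ v) (code (enc (f a)) ++ v)) -> PT f.
Proof.
case=> k hk H; exists c, k => a v.
exact: does_on_le (H a v) (hk _).
Qed.

(** The program has to write its output, one symbol per step at most. *)
Lemma PT_size A B (EA : Enc A) (EB : Enc B) (f : A -> B) : PT f ->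
  exists2 p, isP p & forall a, sz (f a) <= p (sz a).
Proof.
case=> c [k H]; exists (fun n => n + (n + 2) ^ k).
  exact: isP_add isP_id (isP_pow _ _).
move=> a; have [n hn e] := H a [::]; rewrite !cats0 in e.
have := exec_sound e; rewrite /=.
rewrite !code_pure => /(_ isT erefl) [_ _ h _].
move: h hn; rewrite /flat /= !size_cat /= /sz; lia.
Qed.

Lemma code_pairE A B (EA : Enc A) (EB : Enc B) (p : A * B) :
  code (enc p) = one :: code (enc p.1) ++ code (enc p.2).
Proof. by []. Qed.

Lemma sz_pair A B (EA : Enc A) (EB : Enc B) (p : A * B) : sz p = (sz p.1 + sz p.2).+1.
Proof. by rewrite /sz code_pairE /= size_cat. Qed.

Lemma sz_cons A (EA : Enc A) (a : A) s : sz (a :: s) = (sz a + sz s).+1.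
Proof. by rewrite /sz [LHS]/= size_cat. Qed.

Section Basic.
Context {A B C : Type} {EA : Enc A} {EB : Enc B} {EC : Enc C}.

Lemma PT_ext (f g : A -> B) : f =1 g -> PT g -> PT f.
Proof. by move=> e [c [k H]]; exists c, k => a v; rewrite e. Qed.

Lemma PT_cast (f : A -> B) : (forall a, enc (f a) = enc a) -> PT f.
Proof.
move=> e; apply: (@PT_intro _ _ _ _ _ Skip _ (isP_const 0)) => a v; rewrite e.
by exists 0 => //; apply: ESkip.
Qed.

Lemma PT_const (b : B) : PT (fun _ : A => b).
Proof.
apply: (@PT_intro _ _ _ _ _ (Seq cdrop (cconst (code (enc b)))) (fun n => (20 * n + 2 * sz b).+1)).
  apply: (isP_le (q := fun n => 20 * n + (2 * sz b).+1)); last by move=> n; lia.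
  exact: isP_add (isP_mul (isP_const _) isP_id) (isP_const _).
by move=> a v; apply: does_on_seq (does_drop _ _) (does_const _ (code_pure _)).
Qed.

Lemma PT_comp (g : B -> C) (f : A -> B) : PT g -> PT f -> PT (fun a => g (f a)).
Proof.
move=> Pg Pf; have [p pp hp] := PT_size Pf.
move: Pg Pf => [cg [kg Hg]] [cf [kf Hf]].
apply: (@PT_intro _ _ _ _ _ (Seq cf cg) (fun n => ((n + 2) ^ kf + (p n + 2) ^ kg) + 1)).
  apply: isP_add (isP_const 1); apply: isP_add (isP_pow _ _) _.
  exact: (isP_comp (isP_pow 2 kg) pp).
move=> a v; rewrite addn1.
apply: does_on_seq (Hf a v) _; apply: does_on_le (Hg _ v) _.
by case: kg {Hg} => [|kg]; rewrite ?expn0 // leq_exp2r // leq_add2r.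
Qed.

Lemma PT_pair (f : A -> B) (g : A -> C) : PT f -> PT g -> PT (fun a => (f a, g a)).
Proof.
move=> Pf Pg; have [p pp hp] := PT_size Pg.
move: Pf Pg => [cf [kf Hf]] [cg [kg Hg]].
apply: (@PT_intro _ _ _ _ _ (Seq cdup (Seq cg (Seq cswap (Seq cf (Push 0 one)))))
   (fun n => (30 * n + ((n + 2) ^ kg + (20 * (p n + n) + ((n + 2) ^ kf))))+ 5)).
  apply: isP_add (isP_const 5); apply: isP_add; first exact: isP_mul (isP_const _) isP_id.
  apply: isP_add (isP_pow _ _) _; apply: isP_add (isP_pow _ _).
  by apply: isP_mul (isP_const _) _; apply: isP_add pp isP_id.
move=> a v.
have := does_on_seq (does_dup (enc a) v) (does_on_seq (Hg a _) (does_on_seq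
  (does_swap (enc (g a)) (enc a) v) (does_on_seq (Hf a _)
  (@does_push0 one _ isT)))).
rewrite code_pairE /= -catA => D; apply: does_on_le D _.
by have := hp a; rewrite /sz; lia.
Qed.

End Basic.

Lemma PT_id A (EA : Enc A) : PT (fun a : A => a).
Proof. exact: PT_cast. Qed.

Lemma PT_fst A B (EA : Enc A) (EB : Enc B) : PT (fun a : A * B => a.1).
Proof.
apply: (@PT_intro _ _ _ _ _ (Case 0 (fun=> Seq cswap cdrop)) (fun n => 50 * n + 2)).
  exact: isP_add (isP_mul (isP_const _) isP_id) (isP_const _).
move=> [a b] v; rewrite code_pairE /= -catA.
pose proof (does_on_seq (does_swap (enc a) (enc b) v) (does_drop (enc b) (code (enc a) ++ v))) as D.
apply: does_on_le (@does_case0 (fun=> Seq cswap cdrop) one _ _ _ D) _.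
by rewrite sz_pair /sz /=; lia.
Qed.

Lemma PT_snd A B (EA : Enc A) (EB : Enc B) : PT (fun a : A * B => a.2).
Proof.
apply: (@PT_intro _ _ _ _ _ (Case 0 (fun=> cdrop)) (fun n => 50 * n + 2)).
  exact: isP_add (isP_mul (isP_const _) isP_id) (isP_const _).
move=> [a b] v; rewrite code_pairE /= -catA.
pose proof (does_drop (enc a) (code (enc b) ++ v)) as D.
apply: does_on_le (@does_case0 (fun=> cdrop) one _ _ _ D) _.
by rewrite sz_pair /sz /=; lia.
Qed.

Definition is_node (t : tree) := if t is Node _ _ then true else false.

(* The branching behind every destructor: on a leaf continue with [f],
   on a node view the value as an element of [Y] and continue with [g]. *)
Lemma PT_case X Y A B (EX : Enc X) (EY : Enc Y) (EA : Enc A) (EB : Enc B)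
    (s : X -> A) (f h : X -> B) (g : X * Y -> B) :
  PT s -> PT f -> PT g ->
  (forall x, (enc (s x) = Leaf /\ h x = f x) \/
     exists2 y, enc (s x) = enc y /\ is_node (enc y) & h x = g (x, y)) ->
  PT h.
Proof.
move=> Ps Pf Pg H; have [p pp hp] := PT_size Ps.
move: Ps Pf Pg => [cs [ks Hs]] [cf [kf Hf]] [cg [kg Hg]].
apply: (@PT_intro _ _ _ _ _ (Seq cdup (Seq cs (Case 0 (fun a => if a is zero then cf else
   Seq (Push 0 one) (Seq cswap (Seq (Push 0 one) cg))))))
   (fun n => 30 * n + ((n + 2) ^ ks + ((n + 2) ^ kf + (20 * (p n + n) + (n + p n + 3) ^ kg))) + 10)).
  apply: isP_add (isP_const _); apply: isP_add; first exact: isP_mul (isP_const _) isP_id.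
  apply: isP_add (isP_pow _ _) _; apply: isP_add (isP_pow _ _) _.
  have pnp : isP (fun n => p n + n) by apply: isP_add pp isP_id.
  apply: isP_add; first exact: isP_mul (isP_const _) pnp.
  by apply: (isP_comp (isP_pow 3 kg)); apply: isP_add isP_id pp.
move=> x v; set G := fun a : sym => _.
have hpx := hp x; rewrite /sz in hpx.
case: (H x) => [[e ->]|[y [e ny] ->]].
  have D2 := @does_case0 G zero _ _ _ (Hf x v).
  apply: does_on_le; first apply: does_on_seq (does_dup (enc x) v) _.
    by apply: does_on_seq (Hs x _) _; rewrite e; exact: D2.
  by rewrite /sz; lia.
have [w ew] : exists w, code (enc y) = one :: w by case: (enc y) ny => //= l r _; eexists.
have Hxy := Hg (x, y) v; rewrite code_pairE /= -catA in Hxy.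
apply: does_on_le; first apply: does_on_seq (does_dup (enc x) v) _.
  apply: does_on_seq (Hs x _) _; rewrite e ew; apply: does_case0.
  apply: does_on_seq (@does_push0 one _ isT) _; rewrite -cat_cons -ew.
  apply: does_on_seq (does_swap _ _ v) _.
  exact: does_on_seq (@does_push0 one _ isT) Hxy.
have : (sz (x, y) + 2) ^ kg <= (sz x + p (sz x) + 3) ^ kg.
  case: (kg) => [|k]; first by rewrite !expn0.
  by rewrite leq_exp2r // sz_pair /sz -e /=; lia.
by move: hpx; rewrite e /sz; lia.
Qed.

Lemma does_while_stop c v : does_on (cwhile c) 10 (one :: zero :: v) (one :: zero :: v).
Proof.
eexists; last first.
  apply: ESeq; first by apply: EPush'.
  apply: ELoop => //; last by apply: EStop.
  apply: ECase => //; apply: ECase => //=.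
  by apply: ESeq; apply: EPush'.
by [].
Qed.

Lemma does_while_step c v m u m' u' : does_on c m (one :: one :: v) u ->
  does_on (cwhile c) m' u u' -> does_on (cwhile c) (m + m' + 10) (one :: one :: v) u'.
Proof.
case=> n h e [n' h' e']; rewrite /cwhile in e' *.
(* The initial push of the remaining run is dropped, since the loop body ends with the same push. *)
inversion e' as [| |c1 c2 n1 n2 S S1 S2 e1 e2 | | |]; subst.
inversion e1 as [|i0 a0 S0 hi ha| | | |]; subst.
eexists; last first.
  apply: ESeq; first by apply: EPush'.
  apply: ELoop e2 => //.
  apply: ECase => //; apply: ECase => //=.
  apply: (@ESeq _ _ 1 _ _ (V1 (one :: v))); first by ex_push.
  apply: (@ESeq _ _ 1 _ _ (V1 (one :: one :: v))); first by ex_push.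
  by apply: ESeq e _; ex_push.
by lia.
Qed.

(** * Size-bounded folds *)

Section Fold.
Context {X A B : Type} {EX : Enc X} {EA : Enc A} {EB : Enc B}.
Variables (l : X -> seq A) (b0 : X -> B) (F : X * (B * A) -> B).

Let fold x b s := foldl (fun b a => F (x, (b, a))) b s.

Let G (p : seq A * (X * B)) : seq A * (X * B) :=
  if p.1 is a :: s then (s, (p.2.1, F (p.2.1, (p.2.2, a)))) else p.

Let PG : PT F -> PT G.
Proof.
move=> PF.
apply: (@PT_case _ (A * seq A)%type _ _ _ _ _ _ (fun p => p.1) (fun p => p) G
  (fun q : (seq A * (X * B)) * (A * seq A) =>
     (q.2.2, (q.1.2.1, F (q.1.2.1, (q.1.2.2, q.2.1)))))).
- exact: PT_fst.
- exact: PT_id.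
- have P12 : PT (fun q : (seq A * (X * B)) * (A * seq A) => q.1.2).
    exact: PT_comp (PT_snd _ _) (PT_fst _ _).
  apply: PT_pair; first exact: PT_comp (PT_snd _ _) (PT_snd _ _).
  apply: PT_pair; first exact: PT_comp (PT_fst _ _) P12.
  apply: PT_comp PF _; apply: PT_pair; first exact: PT_comp (PT_fst _ _) P12.
  apply: PT_pair; first exact: PT_comp (PT_snd _ _) P12.
  exact: PT_comp (PT_fst _ _) (PT_snd _ _).
- by move=> [[|a s] [x b]]; [left | right; exists (a, s)].
Qed.

Let fold_loop c k M x s b v :
  (forall a v, does_on c ((sz a + 2) ^ k) (code (enc a) ++ v) (code (enc (G a)) ++ v)) ->
  (forall i, (sz (drop i s, (x, fold x b (take i s))) + 2) ^ k <= M) ->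
  does_on (cwhile c) ((size s).+1 * (M + 10)) (code (enc (s, (x, b))) ++ v)
     (code (enc (Nil A, (x, fold x b s))) ++ v).
Proof.
move=> H; elim: s b => [|a s IH] b hM.
  by apply: does_on_le (does_while_stop _ _) _; lia.
have h0 := hM 0; rewrite drop0 take0 /= in h0.
have H1 := IH (F (x, (b, a))) (fun i => hM i.+1).
apply: does_on_le; first apply: does_while_step H1.
  exact: (H (a :: s, (x, b)) v).
rewrite [in X in _ <= X]mulSn; move: h0; rewrite /fold /=. lia.
Qed.

(** Iterating a polynomial-time step may produce exponentially long values; hence the hypothesis
    that all intermediate accumulators are polynomial in the input. The loop runs on triples of the
    remaining list, the input and the accumulator. *)
Lemma PT_foldl : PT l -> PT b0 -> PT F ->
  (exists2 q, isP q & forall x i, sz (fold x (b0 x) (take i (l x))) <= q (sz x)) ->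
  PT (fun x => foldl (fun b a => F (x, (b, a))) (b0 x) (l x)).
Proof.
move=> Pl Pb /PG PG' [q Pq hq].
have Pi : PT (fun x => (l x, (x, b0 x))) by apply: PT_pair Pl _; apply: PT_pair (PT_id _) Pb.
have Po : PT (fun p : seq A * (X * B) => p.2.2) by apply: PT_comp; apply: PT_snd.
have [pl Ppl hpl] := PT_size Pl.
have [pi Ppi hpi] := PT_size Pi.
move: Pi Po PG' => [ci [ki Hi]] [co [ko Ho]] [c [k H]].
pose M n := (pl n + (n + q n) + 2 + 2) ^ k.
have Psum : isP (fun n => pl n + (n + q n) + 2).
  by apply: isP_add (isP_const _); apply: isP_add => //; apply: isP_add isP_id _.
have PM : isP M by apply: (isP_comp (isP_pow 2 k)).
apply: (@PT_intro _ _ _ _ _ (Seq ci (Seq (cwhile c) co)) (fun n =>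
   (n + 2) ^ ki + ((pl n).+1 * (M n + 10) + (n + q n + 5) ^ ko) + 2)).
  apply: isP_add (isP_const _); apply: isP_add (isP_pow _ _) _.
  apply: isP_add; last first.
    apply: (isP_comp (isP_pow 5 ko)); exact: isP_add isP_id _.
  apply: isP_mul; last by apply: isP_add PM (isP_const _).
  apply: (isP_le (q := fun n => pl n + 1)); last by move=> n; rewrite addn1.
  by apply: isP_add Ppl (isP_const _).
have szl (s : seq A) : size s < sz s.
  by elim: s => // a s IH; rewrite sz_cons /=; lia.
have szd (s : seq A) i : sz (drop i s) <= sz s.
  elim: s i => [|a s IH] [|i] //=.
  by apply: leq_trans (IH i) _; rewrite sz_cons; lia.
move=> x v; apply: does_on_le; first apply: does_on_seq (Hi x v) _.
  apply: does_on_seq (fold_loop v H _) (Ho _ _).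
  move=> i; apply: (leq_trans _ (leqnn (M (sz x)))).
  rewrite /M; case: (k) => [|k']; first by rewrite !expn0.
  rewrite leq_exp2r // leq_add2r !sz_pair /=.
  by have := szd (l x) i; have := hpl x; have := hq x i; lia.
have h1 : size (l x) < pl (sz x) by apply: leq_trans (szl _) (hpl x).
have h2 : (sz (Nil A, (x, fold x (b0 x) (l x))) + 2) ^ ko <= (sz x + q (sz x) + 5) ^ ko.
  case: (ko) => [|k']; first by rewrite !expn0.
  rewrite leq_exp2r // !sz_pair /=.
  by have := hq x (size (l x)); rewrite take_size /sz /=; lia.
have : (size (l x)).+1 * (M (sz x) + 10) <= (pl (sz x)).+1 * (M (sz x) + 10).
  by apply: leq_mul => //; lia.
by move: h2; rewrite /sz /=; lia.
Qed.
End Fold.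

(** * Polynomial-time operations on lists, numbers and booleans *)

Lemma PT_fst' X (EX : Enc X) A B (EA : Enc A) (EB : Enc B) (f : X -> A * B) :
  PT f -> PT (fun x => (f x).1).
Proof. by move=> Pf; exact (PT_comp (PT_fst _ _) Pf). Qed.
Lemma PT_snd' X (EX : Enc X) A B (EA : Enc A) (EB : Enc B) (f : X -> A * B) :
  PT f -> PT (fun x => (f x).2).
Proof. by move=> Pf; exact (PT_comp (PT_snd _ _) Pf). Qed.

(** Non-empty lists, positive numbers and [true] have the codes of pairs, so their constructors cost
    nothing beyond pairing. *)
Lemma PT_cons X (EX : Enc X) A (EA : Enc A) (f : X -> A) (g : X -> seq A) :
  PT f -> PT g -> PT (fun x => f x :: g x).
Proof.
move=> Pf Pg;
  apply: (PT_comp (f := fun x => (f x, g x)) (g := fun p : A * seq A => p.1 :: p.2));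
  last exact: PT_pair.
by apply: PT_cast; case.
Qed.

Lemma PT_succ X (EX : Enc X) (f : X -> nat) : PT f -> PT (fun x => (f x).+1).
Proof.
move=> Pf; apply: (PT_comp (g := fun p : unit * nat => p.2.+1)
  (f := fun x => (tt, f x))); first by apply: PT_cast; case=> [[]].
by apply: PT_pair => //; apply: PT_const.
Qed.

Lemma PT_if X (EX : Enc X) A (EA : Enc A) (b : X -> bool) (f g : X -> A) :
  PT b -> PT f -> PT g -> PT (fun x => if b x then f x else g x).
Proof.
move=> Pb Pf Pg; apply: (PT_case (Y := (unit * unit)%type) (g := fun p => f p.1) Pb Pg).
  exact (PT_comp Pf (PT_fst _ _)).
by move=> x; case: (b x); [right; exists (tt, tt) | left].
Qed.

Lemma PT_match X (EX : Enc X) A B (EA : Enc A) (EB : Enc B) (s : X -> seq A) (f : X -> B)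
    (g : X -> A -> seq A -> B) :
  PT s -> PT f -> PT (fun p : X * (A * seq A) => g p.1 p.2.1 p.2.2) ->
  PT (fun x => if s x is a :: t then g x a t else f x).
Proof.
move=> Ps Pf Pg; apply: (PT_case (Y := (A * seq A)%type) Ps Pf Pg).
by move=> x; case: (s x) => [|a t]; [left | right; exists (a, t)].
Qed.

Lemma PT_pred X (EX : Enc X) (f : X -> nat) : PT f -> PT (fun x => (f x).-1).
Proof.
move=> Pf; apply: (PT_case (Y := (unit * nat)%type) (f := f) (g := fun p => p.2.2) Pf Pf).
  by do 2 apply: PT_snd'; apply: PT_id.
by move=> x; case: (f x) => [|n]; [left | right; exists (tt, n)].
Qed.

Lemma PT_iszero X (EX : Enc X) (f : X -> nat) : PT f -> PT (fun x => f x == 0).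
Proof.
move=> Pf; apply: (PT_case (Y := (unit * nat)%type) (f := fun=> true) (g := fun=> false) Pf).
- exact: PT_const.
- exact: PT_const.
by move=> x; case: (f x) => [|n]; [left | right; exists (tt, n)].
Qed.

Lemma PT_neg X (EX : Enc X) (b : X -> bool) : PT b -> PT (fun x => ~~ b x).
Proof. by move=> Pb; apply: PT_if => //; apply: PT_const. Qed.
Lemma PT_and X (EX : Enc X) (b c : X -> bool) : PT b -> PT c -> PT (fun x => b x && c x).
Proof. by move=> Pb Pc; apply: PT_if => //; apply: PT_const. Qed.
Lemma PT_or X (EX : Enc X) (b c : X -> bool) : PT b -> PT c -> PT (fun x => b x || c x).
Proof. by move=> Pb Pc; apply: PT_if => //; apply: PT_const. Qed.
Lemma PT_imp X (EX : Enc X) (b c : X -> bool) : PT b -> PT c -> PT (fun x => b x ==> c x).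
Proof. by move=> Pb Pc; apply: PT_if => //; apply: PT_const. Qed.
Lemma PT_eqb X (EX : Enc X) (b c : X -> bool) : PT b -> PT c -> PT (fun x => b x == c x).
Proof.
move=> Pb Pc; apply: (PT_ext (g := fun x => if b x then c x else ~~ c x)).
  by move=> x; case: (b x); case: (c x).
by apply: PT_if => //; apply: PT_neg.
Qed.

(** The growth allowed at each step is independent of the accumulator, so sizes add up instead of
    compounding. All folds below are justified in this form. *)
Lemma PT_foldl_add X (EX : Enc X) A B (EA : Enc A) (EB : Enc B) (l : X -> seq A) (b0 : X -> B)
    (step : X -> B -> A -> B) :
  PT l -> PT b0 -> PT (fun p : X * (B * A) => step p.1 p.2.1 p.2.2) ->
  (exists2 q, isP q & forall x b a, sz (step x b a) <= sz b + q (sz x + sz a)) ->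
  PT (fun x => foldl (step x) (b0 x) (l x)).
Proof.
move=> Pl Pb Ps [q [k hk] hq].
have [pl Ppl hpl] := PT_size Pl; have [pb Ppb hpb] := PT_size Pb.
apply: (PT_foldl (F := fun p => step p.1 p.2.1 p.2.2)) => //.
exists (fun n => pb n + pl n * (n + pl n + 2) ^ k).
  apply: isP_add => //; apply: isP_mul => //.
  by apply: (isP_comp (isP_pow 2 k)); apply: isP_add isP_id _.
move=> x i /=.
have H : forall s b, sz s <= sz (l x) ->
    sz (foldl (step x) b s) <= sz b + size s * (sz x + sz (l x) + 2) ^ k.
  elim=> [|a s IH] b h /=; first by rewrite addn0.
  rewrite sz_cons in h; apply: leq_trans (IH _ _) _; first by lia.
  rewrite mulSn addnA leq_add2r; apply: leq_trans (hq _ _ _) _.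
  rewrite leq_add2l; apply: leq_trans (hk _) _.
  by case: (k) => [|k']; [rewrite !expn0 | rewrite leq_exp2r //; lia].
have h1 : sz (take i (l x)) <= sz (l x).
  elim: (l x) i => [|a s IH] [|i] //=; rewrite !sz_cons ?ltnS ?leq_add2l //.
have h2 (s : seq A) : size s <= sz s.
  by elim: s => // a s IH; rewrite sz_cons /=; lia.
apply: leq_trans (H _ _ h1) _.
apply: leq_add (hpb _) _; apply: leq_mul.
  by apply: leq_trans (h2 _) (leq_trans h1 (hpl _)).
case: (k) => [|k']; first by rewrite !expn0.
by rewrite leq_exp2r // leq_add2r leq_add2l.
Qed.

(* [pt_user] and its successors are the extension points of [pt], redefined each time new
   functions have been shown to be polynomial-time. *)
Ltac pt_user := fail.
Ltac pt_step := lazymatch goal with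
  | |- PT (fun _ => ?c) => exact (PT_const c)
  | |- PT (fun x => x) => exact (PT_id _)
  | |- PT fst => exact (PT_fst _ _)
  | |- PT snd => exact (PT_snd _ _)
  | |- PT (fun x => (@?a x, @?b x)) => refine (PT_pair _ _)
  | |- PT (fun x => fst (@?a x)) => refine (PT_fst' _)
  | |- PT (fun x => snd (@?a x)) => refine (PT_snd' _)
  | |- PT (fun x => (@?a x) :: (@?b x)) => refine (PT_cons _ _)
  | |- PT (fun x => S (@?a x)) => refine (PT_succ _)
  | |- PT (fun x => predn (@?a x)) => refine (PT_pred _)
  | |- PT (fun x => ~~ (@?a x)) => refine (PT_neg _)
  | |- PT (fun x => (@?a x) && (@?b x)) => refine (PT_and _ _)
  | |- PT (fun x => (@?a x) || (@?b x)) => refine (PT_or _ _)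
  | |- PT (fun x => (@?a x) ==> (@?b x)) => refine (PT_imp _ _)
  | |- _ => pt_user
  end.
Ltac pt := repeat pt_step.

Lemma PT_rel A B (EA : Enc A) (EB : Enc B) (f : A -> B) : PT f ->
  exists2 q, isP q & (forall a, sz (f a) <= q (sz a)) /\ {homo q : m n / m <= n}.
Proof.
move=> Pf; have [p [k hk] hp] := PT_size Pf; exists (fun n => (n + 2) ^ k).
  exact: isP_pow.
split=> [a|m n h]; first exact: leq_trans (hp a) (hk _).
by case: (k) => [|k']; rewrite ?expn0 // leq_exp2r // leq_add2r.
Qed.

Lemma PT_catrev X (EX : Enc X) A (EA : Enc A) (f g : X -> seq A) :
  PT f -> PT g -> PT (fun x => catrev (f x) (g x)).
Proof.
move=> Pf Pg; apply: (PT_ext (g := fun x => foldl (fun b a => a :: b) (g x) (f x))).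
  by move=> x; elim: (f x) (g x) => //= a s IH t; apply: IH.
apply: (PT_foldl_add (step := fun x b a => a :: b)) => //; first by pt.
exists (fun n => n + 1); first exact: isP_add isP_id (isP_const _).
by move=> x b a; rewrite sz_cons; lia.
Qed.

Lemma PT_rev X (EX : Enc X) A (EA : Enc A) (f : X -> seq A) : PT f -> PT (fun x => rev (f x)).
Proof. by move=> Pf; apply: PT_catrev => //; apply: PT_const. Qed.

Lemma PT_cat X (EX : Enc X) A (EA : Enc A) (f g : X -> seq A) :
  PT f -> PT g -> PT (fun x => f x ++ g x).
Proof.
move=> Pf Pg; apply: (PT_ext (g := fun x => catrev (rev (f x)) (g x))).
  by move=> x; rewrite catrevE revK.
by apply: PT_catrev => //; apply: PT_rev.
Qed.

Lemma PT_map X (EX : Enc X) A B (EA : Enc A) (EB : Enc B) (f : X -> A -> B) (l : X -> seq A) :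
  PT l -> PT (fun p : X * A => f p.1 p.2) -> PT (fun x => map (f x) (l x)).
Proof.
move=> Pl Pf.
apply: (PT_ext (g := fun x => rev (foldl (fun b a => f x a :: b) [::] (l x)))).
  move=> x; rewrite -[LHS]revK; congr rev.
  suff H s t : foldl (fun b a => f x a :: b) t s = catrev (map (f x) s) t.
    by rewrite H catrevE cats0.
  by elim: s t => //= a s IH t; apply: IH.
apply: PT_rev; apply: (PT_foldl_add (step := fun x b a => f x a :: b)) => //.
- exact: PT_const.
- pt; apply: (PT_comp (f := fun p : X * (seq B * A) => (p.1, p.2.2)) Pf); pt.
- have [q Pq [hq mq]] := PT_rel Pf.
  exists (fun n => q (n + 1) + 1).
    apply: isP_add (isP_const _); apply: isP_comp Pq _; exact: isP_add isP_id (isP_const _).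
  by move=> x b a; rewrite sz_cons; have := hq (x, a); rewrite sz_pair /= -addn1; lia.
Qed.

Lemma sz_cat A (EA : Enc A) (s t : seq A) : sz (s ++ t) <= sz s + sz t.
Proof. by elim: s => [|a s IH] /=; rewrite ?sz_cons //; lia. Qed.

Lemma PT_flatten X (EX : Enc X) A (EA : Enc A) (f : X -> seq (seq A)) : PT f -> PT (fun x => flatten (f x)).
Proof.
move=> Pf; apply: (PT_ext (g := fun x => foldl (fun b a => b ++ a) [::] (f x))).
  move=> x; rewrite -[LHS]cat0s; elim: (f x) [::] => [|a s IH] t /=; first by rewrite cats0.
  by rewrite catA IH.
apply: (PT_foldl_add (step := fun x b a => b ++ a)) => //; first exact: PT_const.
  apply: (PT_comp (f := fun p : X * (seq A * seq A) => p.2) (g := fun q => q.1 ++ q.2)).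
    by apply: PT_cat; pt.
  by pt.
exists (fun n => n); first exact: isP_id.
by move=> x b a; have := sz_cat EA b a; lia.
Qed.

Lemma PT_filter X (EX : Enc X) A (EA : Enc A) (p : X -> A -> bool) (l : X -> seq A) :
  PT l -> PT (fun q : X * A => p q.1 q.2) -> PT (fun x => filter (p x) (l x)).
Proof.
move=> Pl Pp; apply: (PT_ext
  (g := fun x => flatten (map (fun a => if p x a then [:: a] else [::]) (l x)))).
  by move=> x; elim: (l x) => //= a s ->; case: ifP.
apply: PT_flatten; apply: (PT_map (f := fun x a => if p x a then [:: a] else [::])) => //.
by apply: PT_if => //; pt.
Qed.

Lemma PT_nilp X (EX : Enc X) A (EA : Enc A) (l : X -> seq A) : PT l -> PT (fun x => nilp (l x)).
Proof.
move=> Pl; apply: (PT_ext (g := fun x => if l x is a :: t then false else true)).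
  by move=> x; case: (l x).
by apply: PT_match => //; apply: PT_const.
Qed.

Lemma PT_head X (EX : Enc X) A (EA : Enc A) (d : X -> A) (l : X -> seq A) : PT d -> PT l ->
  PT (fun x => head (d x) (l x)).
Proof.
move=> Pd Pl; apply: (PT_match (g := fun _ a _ => a)) => //; pt.
Qed.

Lemma PT_behead X (EX : Enc X) A (EA : Enc A) (l : X -> seq A) : PT l -> PT (fun x => behead (l x)).
Proof.
move=> Pl; apply: (PT_match (f := fun=> [::]) (g := fun _ _ t => t)) => //; pt.
Qed.

Lemma PT_has X (EX : Enc X) A (EA : Enc A) (p : X -> A -> bool) (l : X -> seq A) :
  PT l -> PT (fun q : X * A => p q.1 q.2) -> PT (fun x => has (p x) (l x)).
Proof.
move=> Pl Pp; apply: (PT_ext (g := fun x => ~~ nilp (filter (p x) (l x)))).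
  by move=> x; elim: (l x) => //= a s ->; case: ifP.
by apply: PT_neg; apply: PT_nilp; apply: PT_filter.
Qed.

Lemma PT_all X (EX : Enc X) A (EA : Enc A) (p : X -> A -> bool) (l : X -> seq A) :
  PT l -> PT (fun q : X * A => p q.1 q.2) -> PT (fun x => all (p x) (l x)).
Proof.
move=> Pl Pp; apply: (PT_ext (g := fun x => ~~ has (fun a => ~~ p x a) (l x))).
  by move=> x; rewrite has_predC negbK.
by apply: PT_neg; apply: (PT_has (p := fun x a => ~~ p x a)) => //; apply: PT_neg.
Qed.

(** A number n and a list of n units have the same code, which turns iteration into a fold. *)
Lemma PT_units X (EX : Enc X) (n : X -> nat) : PT n -> PT (fun x => nseq (n x) tt).
Proof.
move=> Pn; apply: (PT_comp (g := fun n => nseq n tt)) => //.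
by apply: PT_cast; elim=> //= m IH; congr Node.
Qed.

Lemma PT_iter X (EX : Enc X) A (EA : Enc A) (n : X -> nat) (f : X -> A -> A) (a : X -> A) :
  PT n -> PT a -> PT (fun p : X * A => f p.1 p.2) ->
  (exists2 q, isP q & forall x b, sz (f x b) <= sz b + q (sz x)) ->
  PT (fun x => iter (n x) (f x) (a x)).
Proof.
move=> Pn Pa Pf [q [k hk] Hq].
apply: (PT_ext (g := fun x => foldl (fun b _ => f x b) (a x) (nseq (n x) tt))).
  by move=> x; elim: (n x) (a x) => //= m IH b; rewrite -IH -iterSr.
apply: (PT_foldl_add (step := fun x b _ => f x b)) => //; first exact: PT_units.
  by apply: (PT_comp (f := fun p : X * (A * unit) => (p.1, p.2.1)) Pf); pt.
exists (fun n => (n + 2) ^ k); first exact: isP_pow.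
move=> x b u; apply: leq_trans (Hq x b) _; rewrite leq_add2l; apply: leq_trans (hk _) _.
case: (k) => [|k']; first by rewrite !expn0.
by rewrite leq_exp2r // leq_add2r leq_addr.
Qed.

Lemma sz_nat (n : nat) : sz n = (2 * n).+1.
Proof. by elim: n => // n; rewrite /sz /enc /enc_natI /= => ->; lia. Qed.

Lemma PT_add X (EX : Enc X) (m n : X -> nat) : PT m -> PT n -> PT (fun x => m x + n x).
Proof.
move=> Pm Pn; apply: (PT_ext (g := fun x => iter (m x) S (n x))).
  by move=> x; rewrite iter_succn addnC.
apply: (PT_iter (f := fun _ n => n.+1)) => //; first by pt.
by exists (fun=> 2); [exact: isP_const | move=> _ b; rewrite !sz_nat; lia].
Qed.

Lemma PT_sub X (EX : Enc X) (m n : X -> nat) : PT m -> PT n -> PT (fun x => m x - n x).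
Proof.
move=> Pm Pn; apply: (PT_ext (g := fun x => iter (n x) predn (m x))).
  by move=> x; rewrite iter_predn.
apply: (PT_iter (f := fun _ n => n.-1)) => //; first by pt.
by exists (fun=> 2); [exact: isP_const | move=> _ b; rewrite !sz_nat; lia].
Qed.

Lemma PT_leq X (EX : Enc X) (m n : X -> nat) : PT m -> PT n -> PT (fun x => m x <= n x).
Proof. by move=> Pm Pn; apply: PT_iszero; apply: PT_sub. Qed.

Lemma PT_eqn X (EX : Enc X) (m n : X -> nat) : PT m -> PT n -> PT (fun x => m x == n x).
Proof.
move=> Pm Pn; apply: (PT_ext (g := fun x => (m x <= n x) && (n x <= m x))).
  by move=> x; rewrite eqn_leq.
by apply: PT_and; apply: PT_leq.
Qed.

Lemma PT_minn X (EX : Enc X) (m n : X -> nat) : PT m -> PT n -> PT (fun x => minn (m x) (n x)).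
Proof.
by move=> Pm Pn; apply: (PT_if (f := m) (g := n)) => //;
  apply: (PT_leq (m := fun x => (m x).+1)) => //; pt.
Qed.

Lemma PT_sizel X (EX : Enc X) A (EA : Enc A) (l : X -> seq A) : PT l -> PT (fun x => size (l x)).
Proof.
move=> Pl; apply: (PT_ext (g := fun x => foldl (fun b _ => b.+1) 0 (l x))).
  move=> x; suff H s n : foldl (fun b (_ : A) => b.+1) n s = size s + n by rewrite H addn0.
  by elim: s n => //= a s IH n; rewrite IH addnS.
apply: (PT_foldl_add (step := fun _ b _ => b.+1)) => //; first by pt.
  by pt.
by exists (fun=> 2); [exact: isP_const | move=> _ b _; rewrite !sz_nat; lia].
Qed.

Lemma sz_behead A (EA : Enc A) (s : seq A) : sz (behead s) <= sz s.
Proof. by case: s => //= a s; rewrite sz_cons; lia. Qed.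

Lemma PT_drop X (EX : Enc X) A (EA : Enc A) (n : X -> nat) (l : X -> seq A) : PT n -> PT l ->
  PT (fun x => drop (n x) (l x)).
Proof.
move=> Pn Pl; apply: (PT_ext (g := fun x => iter (n x) behead (l x))).
  by move=> x; elim: (n x) (l x) => [|m IH] s;
    [rewrite drop0 | rewrite iterSr -IH; case: s => //=; rewrite drop_nil].
apply: (PT_iter (f := fun _ s => behead s)) => //; first by apply: PT_behead; pt.
by exists (fun=> 0); [exact: isP_const | move=> _ b; rewrite addn0; apply: sz_behead].
Qed.

Lemma PT_nth X (EX : Enc X) A (EA : Enc A) (d : X -> A) (l : X -> seq A) (n : X -> nat) :
  PT d -> PT l -> PT n ->
  PT (fun x => nth (d x) (l x) (n x)).
Proof.
move=> Pd Pl Pn; apply: (PT_ext (g := fun x => head (d x) (drop (n x) (l x)))).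
  by move=> x; rewrite -nth0 nth_drop addn0.
by apply: PT_head => //; apply: PT_drop.
Qed.

Lemma PT_mem X (EX : Enc X) (v : X -> nat) (l : X -> seq nat) : PT v -> PT l -> PT (fun x => v x \in l x).
Proof.
move=> Pv Pl; apply: (PT_ext (g := fun x => has (fun w => w == v x) (l x))).
  by move=> x; rewrite -has_pred1; apply: eq_has => w.
apply: (PT_has (p := fun x w => w == v x)) => //; apply: PT_eqn; first by pt.
by apply: (PT_comp Pv); pt.
Qed.

Lemma sz_rcons A (EA : Enc A) (s : seq A) a : sz (rcons s a) = (sz s + sz a).+1.
Proof. by elim: s => [|b s IH]; rewrite ?rcons_cons !sz_cons ?IH; [rewrite addnC | lia]. Qed.

Lemma PT_iota X (EX : Enc X) (n : X -> nat) : PT n -> PT (fun x => iota 0 (n x)).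
Proof.
(* The truncation by [minn] has no effect on the values that occur; it bounds the growth of the step
   for arbitrary accumulators. *)
move=> Pn; apply: (PT_ext (g := fun x => iter (n x) (fun s => s ++ [:: minn (size s) (n x)]) [::])).
  move=> x; suff H m : m <= n x -> iter m (fun s => s ++ [:: minn (size s) (n x)]) [::] = iota 0 m.
    by rewrite H.
  elim: m => // m IH h; rewrite iterS IH ?(ltnW h) // size_iota -addn1 iotaD /=.
  by rewrite (minn_idPl (ltnW h)).
apply: (PT_iter (f := fun x s => s ++ [:: minn (size s) (n x)])) => //; first exact: PT_const.
  apply: PT_cat; first by pt.
  apply: PT_cons; last exact: PT_const.
  apply: PT_minn; first by apply: PT_sizel; pt.
  by apply: (PT_comp Pn); pt.
have [p Pp hp] := PT_size Pn; exists (fun n => p n + 1).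
  by apply: isP_add Pp (isP_const _).
move=> x b; rewrite cats1 sz_rcons; have := hp x; rewrite !sz_nat.
by have := geq_minr (size b) (n x); lia.
Qed.

Lemma eqseq_nth (s t : seq nat) :
  (s == t) = (size s == size t) && all (fun i => nth 0 s i == nth 0 t i) (iota 0 (size s)).
Proof.
apply/eqP/andP => [->|[/eqP e /allP H]].
  by split=> //; apply/allP.
by apply: (@eq_from_nth _ 0) => // i hi; apply/eqP; apply: H; rewrite mem_iota.
Qed.

Lemma PT_eqseq X (EX : Enc X) (f g : X -> seq nat) : PT f -> PT g -> PT (fun x => f x == g x).
Proof.
move=> Pf Pg; apply: (PT_ext (fun x => eqseq_nth (f x) (g x))).
apply: PT_and; first by apply: PT_eqn; apply: PT_sizel.
apply: (PT_all (p := fun x i => nth 0 (f x) i == nth 0 (g x) i)).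
  by apply: PT_iota; apply: PT_sizel.
apply: PT_eqn; apply: (PT_nth (d := fun=> 0)); pt; [apply: (PT_comp Pf) | apply: (PT_comp Pg)]; pt.
Qed.

Ltac pt_user1 := fail.
Ltac pt_user ::=
  first [ assumption
  | match goal with H : PT ?g |- PT (fun x => ?g (@?f x)) => refine (PT_comp (f := f) H _) end
  | lazymatch goal with
  | |- PT (fun x => map (@?f x) (@?l x)) => refine (PT_map (f := f) (l := l) _ _); cbv beta
  | |- PT (fun x => filter (@?f x) (@?l x)) => refine (PT_filter (p := f) (l := l) _ _); cbv beta
  | |- PT (fun x => has (@?f x) (@?l x)) => refine (PT_has (p := f) (l := l) _ _); cbv beta
  | |- PT (fun x => all (@?f x) (@?l x)) => refine (PT_all (p := f) (l := l) _ _); cbv beta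
  | |- PT (fun x => flatten (@?f x)) => refine (PT_flatten (f := f) _)
  | |- PT (fun x => rev (@?f x)) => refine (PT_rev (f := f) _)
  | |- PT (fun x => (@?f x) ++ (@?g x)) => refine (PT_cat (f := f) (g := g) _ _)
  | |- PT (fun x => size (@?f x)) => refine (PT_sizel (l := f) _)
  | |- PT (fun x => behead (@?f x)) => refine (PT_behead (l := f) _)
  | |- PT (fun x => head (@?d x) (@?f x)) => refine (PT_head (d := d) (l := f) _ _)
  | |- PT (fun x => nth (@?d x) (@?f x) (@?n x)) => refine (PT_nth (d := d) (l := f) (n := n) _ _ _)
  | |- PT (fun x => iota 0 (@?f x)) => refine (PT_iota (n := f) _)
  | |- PT (fun x => (@?f x) + (@?g x)) => refine (PT_add (m := f) (n := g) _ _)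
  | |- PT (fun x => (@?f x) - (@?g x)) => refine (PT_sub (m := f) (n := g) _ _)
  | |- PT (fun x => minn (@?f x) (@?g x)) => refine (PT_minn (m := f) (n := g) _ _)
  | |- PT (fun x => @eq_op _ (@?f x) (@?g x)) =>
      first [ refine (PT_eqn (m := f) (n := g) _ _) | refine (PT_eqseq (f := f) (g := g) _ _)
            | refine (PT_eqb (b := f) (c := g) _ _) ]
  | |- PT (fun x => (@?f x) \in (@?g x : seq nat)) => refine (PT_mem (v := f) (l := g) _ _)
  | |- _ => pt_user1
  end ].

(** * The algorithm *)

(* Permutations of {0..N-1} are lists of images; the entries of a product are truncated at [N]
   so that its size is bounded whatever the arguments are. *)
Definition lmul (N : nat) (p q : seq nat) : seq nat :=
  [seq minn N (nth 0 q (nth 0 p i)) | i <- iota 0 N].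
Definition linv (N : nat) (p : seq nat) : seq nat :=
  [seq head 0 [seq j <- iota 0 N | nth 0 p j == i] | i <- iota 0 N].

Lemma PT_lmul X (EX : Enc X) (N : X -> nat) (p q : X -> seq nat) :
  PT N -> PT p -> PT q -> PT (fun x => lmul (N x) (p x) (q x)).
Proof. by move=> PN Pp Pq; rewrite /lmul; pt. Qed.
Lemma PT_linv X (EX : Enc X) (N : X -> nat) (p : X -> seq nat) :
  PT N -> PT p -> PT (fun x => linv (N x) (p x)).
Proof. by move=> PN Pp; rewrite /linv; pt. Qed.

Ltac pt_user2 := fail.
Ltac pt_user1 ::= lazymatch goal with
  | |- PT (fun x => lmul (@?f x) (@?g x) (@?h x)) => refine (PT_lmul (N := f) (p := g) (q := h) _ _ _)
  | |- PT (fun x => linv (@?f x) (@?g x)) => refine (PT_linv (N := f) (p := g) _ _)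
  | |- _ => pt_user2
  end.

Definition small (N : nat) (s : seq nat) := (size s <= N) && all (fun v => v <= N) s.

Lemma small_lmul N p q : small N (lmul N p q).
Proof.
rewrite /small size_map size_iota leqnn; apply/allP => _ /mapP[i _ ->].
exact: geq_minl.
Qed.

Lemma sz_small N s : small N s -> sz s <= N * (2 * N + 2) + 1.
Proof.
case/andP=> h1 h2; apply: leq_trans (_ : size s * (2 * N + 2) + 1 <= _); last first.
  by rewrite leq_add2r leq_mul2r h1 orbT.
elim: s h2 {h1} => // v s IH /= /andP[hv /IH]; rewrite sz_cons sz_nat mulSn; lia.
Qed.

(** Numbers are encoded in unary, so a bound polynomial in the value [N x] is polynomial in the size
    of x. *)
Lemma PT_foldl_bd X A B (EX : Enc X) (EA : Enc A) (EB : Enc B) (l : X -> seq A) (b0 : X -> B)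
    (step : X -> B -> A -> B) (N : X -> nat) k :
  PT l -> PT b0 -> PT (fun p : X * (B * A) => step p.1 p.2.1 p.2.2) -> PT N ->
  (forall x b a, sz (step x b a) <= sz b + (N x + 2) ^ k) ->
  PT (fun x => foldl (step x) (b0 x) (l x)).
Proof.
move=> Pl Pb Ps PN H; apply: PT_foldl_add => //.
have [q Pq [hq mq]] := PT_rel PN.
exists (fun n => (q n + 2) ^ k); first exact: isP_comp (isP_pow 2 k) Pq.
move=> x b a; apply: leq_trans (H x b a) _; rewrite leq_add2l.
case: (k) => [|k']; first by rewrite !expn0.
rewrite leq_exp2r // leq_add2r.
have h1 : q (sz x) <= q (sz x + sz a) by apply: mq; rewrite leq_addr.
by apply: leq_trans h1; have := hq x; rewrite sz_nat; lia.
Qed.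

(** * Reducing lists of generators by sifting *)

Definition moved (N : nat) (y : seq nat) : nat :=
  head N [seq i <- iota 0 N | ~~ (nth 0 y i == i)].
Definition key (N : nat) (y : seq nat) : seq nat := [:: moved N y; nth 0 y (moved N y)].
Definition sift1 N (Q : seq (seq nat)) (y : seq nat) : seq nat :=
  let zs := [seq z <- Q | key N z == key N y] in
  if nilp zs then y else lmul N y (linv N (head [::] zs)).
(** Each division pushes the first moved point of y forward. This point is at most N, the value that
    [moved] gives to the identity, so N + 1 rounds lead to the identity or to an element whose key
    does not occur in Q. *)
Definition sift N Q y := foldl (fun y _ => sift1 N Q y) y (iota 0 N.+1).
(* No closure under products is needed: only the generated group has to be preserved, and keeping
   at most one element for each key bounds the number of generators by (N + 1)^2. *)
Definition insert N (Q : seq (seq nat)) (y : seq nat) : seq (seq nat) :=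
  let y' := lmul N (sift N Q y) (iota 0 N) in
  if has (fun z => key N z == key N y') Q then Q else y' :: Q.
Definition gens_reduce N (T : seq (seq nat)) : seq (seq nat) :=
  foldl (insert N) [:: iota 0 N] T.
(** A coset is x0 H, where x0 heads the list and H is generated by the x0^-1 x. The generators of H
    are reduced and translated back; [gens_reduce] starts from the identity, so x0 itself
    survives. *)
Definition reduce N (T : seq (seq nat)) : seq (seq nat) :=
  if nilp T then [::] else
  [seq lmul N (head [::] T) z
    | z <- gens_reduce N [seq lmul N (linv N (head [::] T)) x | x <- T]].

Lemma PT_key X (EX : Enc X) (N : X -> nat) (p : X -> seq nat) :
  PT N -> PT p -> PT (fun x => key (N x) (p x)).
Proof. by move=> PN Pp; rewrite /key /moved; pt. Qed.

Ltac pt_user3 := fail.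
Ltac pt_user2 ::= lazymatch goal with
  | |- PT (fun x => key (@?f x) (@?g x)) => refine (PT_key (N := f) (p := g) _ _)
  | |- PT (fun x => nilp (@?f x)) => refine (PT_nilp (l := f) _)
  | |- _ => pt_user3
  end.

Lemma sz_lmul N p q : sz (lmul N p q) <= (N + 2) ^ 3.
Proof. by have := sz_small (small_lmul N p q); rewrite !expnS expn0; nia. Qed.

Lemma PT_sift X (EX : Enc X) (N : X -> nat) (Q : X -> seq (seq nat)) (p : X -> seq nat) :
  PT N -> PT Q -> PT p -> PT (fun x => sift (N x) (Q x) (p x)).
Proof.
move=> PN PQ Pp; apply: (PT_foldl_bd (step := fun x y _ => sift1 (N x) (Q x) y) (N := N) (k := 3)) => //.
- by apply: (PT_iota (n := fun x => (N x).+1)); pt.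
- by rewrite /sift1; cbv zeta; apply: PT_if; pt.
- move=> x y a; rewrite /sift1; case: ifP => _; first exact: leq_addr.
  by have := sz_lmul (N x) y (linv (N x) (head [::] [seq z <- Q x | key (N x) z == key (N x) y])); lia.
Qed.

Ltac pt_user4 := fail.
Ltac pt_user3 ::= lazymatch goal with
  | |- PT (fun x => sift (@?f x) (@?g x) (@?h x)) =>
      refine (PT_sift (N := f) (Q := g) (p := h) _ _ _)
  | |- _ => pt_user4
  end.

Lemma PT_insert X (EX : Enc X) (N : X -> nat) (Q : X -> seq (seq nat)) (p : X -> seq nat) :
  PT N -> PT Q -> PT p -> PT (fun x => insert (N x) (Q x) (p x)).
Proof.
by move=> PN PQ Pp; rewrite /insert; cbv zeta; apply: PT_if; pt.
Qed.

Lemma PT_gens_reduce X (EX : Enc X) (N : X -> nat) (Q : X -> seq (seq nat)) :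
  PT N -> PT Q -> PT (fun x => gens_reduce (N x) (Q x)).
Proof.
move=> PN PQ; apply: (PT_foldl_bd (step := fun x Q y => insert (N x) Q y) (N := N) (k := 4)); pt.
  by apply: (PT_insert (N := fun p => N p.1) (Q := fun p => p.2.1) (p := fun p => p.2.2)); pt.
move=> x T y; rewrite /insert; case: ifP => _; first exact: leq_addr.
rewrite sz_cons; set z := lmul _ _ _; have : sz z <= (N x + 2) ^ 3 by apply: sz_lmul.
by rewrite !expnS expn0; nia.
Qed.

Lemma PT_reduce X (EX : Enc X) (N : X -> nat) (Q : X -> seq (seq nat)) :
  PT N -> PT Q -> PT (fun x => reduce (N x) (Q x)).
Proof.
move=> PN PQ; rewrite /reduce; apply: PT_if; pt.
by apply: PT_gens_reduce => //; pt.
Qed.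

Lemma key_bd N y : small N y -> key N y \in [seq [:: i; j] | i <- iota 0 N.+1, j <- iota 0 N.+1].
Proof.
move=> /andP[h1 /allP h2]; apply/allpairsP; exists (moved N y, nth 0 y (moved N y)).
split=> //; rewrite mem_iota.
  rewrite /moved; have : all (fun i => i < N.+1) [seq i <- iota 0 N | ~~ (nth 0 y i == i)].
    by apply/allP => i; rewrite mem_filter mem_iota => /andP[_]; lia.
  by case: [seq _ <- _ | _] => //= a s /andP[].
case: (ltnP (moved N y) (size y)) => h; last by rewrite nth_default.
by have := h2 _ (mem_nth 0 h); rewrite add0n ltnS.
Qed.

Lemma small_iota N : small N (iota 0 N).
Proof. by rewrite /small size_iota leqnn; apply/allP => i; rewrite mem_iota; lia. Qed.

(** The elements added are values of [lmul], hence small even if T does not consist of permutations,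
    and the keys are distinct elements of a square of side N + 1. *)
Lemma size_gens_reduce N T : size (gens_reduce N T) <= N.+1 * N.+1.
Proof.
rewrite /gens_reduce.
suff H Q : all (small N) Q && uniq (map (key N) Q) ->
   let Q' := foldl (insert N) Q T in all (small N) Q' && uniq (map (key N) Q').
  have /= := H [:: iota 0 N]; rewrite small_iota => /(_ isT) /andP[/allP h1 h2].
  rewrite -(size_map (key N)).
  have := @uniq_leq_size _ _ [seq [:: i; j] | i <- iota 0 N.+1, j <- iota 0 N.+1] h2.
  rewrite size_allpairs !size_iota; apply => _ /mapP[y hy ->]; apply: key_bd; exact: h1.
elim: T Q => //= y T IH Q hQ; apply: IH.
rewrite /insert; case: ifP => // /hasPn h; case/andP: hQ => h1 h2.
rewrite /= small_lmul h1 h2 !andbT /=; apply/negP => /mapP[z hz e].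
by have := h _ hz; rewrite e eqxx.
Qed.

(** The independence of T is what keeps the folds over cosets polynomial. One factor (N + 2)^3
    bounds the number of elements, the other the size of each of them. *)
Lemma sz_reduce N T : sz (reduce N T) <= (N + 2) ^ 6.
Proof.
rewrite /reduce; case: nilp.
  have -> : sz (Nil (seq nat)) = 1 by [].
  exact: ppow_gt0.
set s := gens_reduce _ _; have : size s <= N.+1 * N.+1 by apply: size_gens_reduce.
move: (head _ _) => x0.
have : sz [seq lmul N x0 z | z <- s] <= size s * (N * (2 * N + 2) + 2) + 1.
  elim: s => // z s IH; rewrite /= sz_cons mulSn; have := sz_small (small_lmul N x0 z); lia.
move=> h hs; apply: (leq_trans h); rewrite (expnD _ 3 3); set A := (N + 2) ^ 3.
have hA : N * (2 * N + 2) + 2 <= A by rewrite /A !expnS expn0; nia.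
have hB : N.+1 * N.+1 + 1 <= A by rewrite /A !expnS expn0; nia.
apply: leq_trans (leq_mul hB (leqnn A)); rewrite mulnDl mul1n.
by apply: leq_add; [apply: leq_mul | exact: ppow_gt0].
Qed.

Ltac pt_user5 := fail.
Ltac pt_user4 ::= lazymatch goal with
  | |- PT (fun x => reduce (@?f x) (@?g x)) => refine (PT_reduce (N := f) (Q := g) _ _)
  | |- _ => pt_user5
  end.

(* A pair (a, b) of permutations of {0..n-1} is the permutation of {0..2n-1}
   acting as a on the first half and as b on the second one. *)
Definition lpair n (a b : seq nat) : seq nat := a ++ [seq n + v | v <- b].

(* For [x = lpair n a b], the values on [c] of [a^-1 * b], shifted by [n]. *)
Definition fval n (c : seq nat) (x : seq nat) : seq nat :=
  [seq nth 0 x (n + nth 0 (linv (n + n) x) v) | v <- c].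

(** * Orbits, transporters and intersections of cosets *)

Definition grow n c (S R : seq (seq nat)) : seq (seq nat) :=
  let cs := [seq y <- flatten [seq [seq lmul (n + n) r s | s <- S] | r <- R] |
              ~~ has (fun r => fval n c r == fval n c y) R] in
  if nilp cs then R else head [::] cs :: R.

(** L, in use the elements of G_i, serves as the counter of the iteration: its length bounds the
    number of orbit points, and each round adds at most one of them. *)
Definition orbit_reps n c (L S : seq (seq nat)) (x0 : seq nat) : seq (seq nat) :=
  foldl (fun R _ => grow n c S R) [:: x0] L.

(** The elements r s r'^-1 are the Schreier generators for S acting by right multiplication on the
    values of [fval]. The right factor z, an element with the desired value, carries them into the
    transporter. *)
Definition schreier n c (S R : seq (seq nat)) (z : seq nat) : seq (seq nat) :=
  flatten [seq flatten [seq
    [seq lmul (n + n) (lmul (n + n) (lmul (n + n) r s) (linv (n + n) r')) z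
       | r' <- [seq r' <- R | fval n c r' == fval n c (lmul (n + n) r s)]]
    | s <- S] | r <- R].

Definition agree n (c : seq nat) (L T : seq (seq nat)) : seq (seq nat) :=
  if nilp T then [::] else
  let S := [seq lmul (n + n) (linv (n + n) (head [::] T)) x | x <- T] in
  let R := orbit_reps n c L S (head [::] T) in
  let zs := [seq r <- R | fval n c r == [seq n + v | v <- c]] in
  if nilp zs then [::] else head [::] zs :: schreier n c S R (head [::] zs).

Definition classes_t := seq (seq nat * seq (seq nat)).

Definition meet2 n (cg : classes_t) (T1 T2 : seq (seq nat)) : seq (seq nat) :=
  reduce n [seq [seq nth 0 x i | i <- iota 0 n]
    | x <- foldl (fun T c => reduce (n + n) (agree n c.1 c.2 T))
             (flatten [seq [seq lpair n a b | b <- T2] | a <- T1]) cg].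

Definition meet n cg (Ts : seq (seq (seq nat))) : seq (seq nat) :=
  foldl (meet2 n cg) (head [::] Ts) (behead Ts).

Definition same (W e f : seq nat) := all (fun v => (v \in e) == (v \in f)) W.
Definition sends (c g e f : seq nat) := all (fun v => (v \in e) == (nth 0 g v \in f)) c.

(* The entries (e, (f, T)) are such that T represents Iso(e, f). *)
Definition table_t := seq (seq nat * (seq nat * seq (seq nat))).

(** Only the sets of traces on c are compared here; what the matched edges do on the classes already
    processed is left to the table. *)
Definition compatible (E : seq (seq nat)) W c g e f : bool :=
  all (fun e' => same W e' e ==>
     has (fun f' => same W f' f && sends c g e' f') E) E &&
  all (fun f' => same W f' f ==>
     has (fun e' => same W e' e && sends c g e' f') E) E.

Definition entry n (E : seq (seq nat)) (cg : classes_t) W (c : seq nat * seq (seq nat))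
    (M : table_t) (e f : seq nat) : seq (seq nat) :=
  reduce n (flatten [seq if compatible E W c.1 g e f then
      [seq lmul n g h | h <- meet n cg [seq t.2.2 | t <- M &
          same W t.1 e && same W t.2.1 f && sends c.1 g t.1 t.2.1]]
    else [::] | g <- c.2]).

Definition level n E cg W c M : table_t :=
  flatten [seq [seq (e, (f, entry n E cg W c M e f)) | f <- E] | e <- E].

(** In use [s.1] is the reversed list of classes from the current one on, so its tail consists of
    the classes that precede it, whose union is W. *)
Definition solve_step n E cg (s : classes_t * table_t) (c : seq nat * seq (seq nat)) :=
  (behead s.1, level n E cg (flatten [seq c'.1 | c' <- behead s.1]) c s.2).

(** Without edges the table has no entry to read, but then every permutation is an automorphism and
    the lists of the G_i generate the answer. Otherwise W is empty at the end, all entries represent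
    the same group, and the first one is returned. *)
Definition solve n E (classes : seq (seq nat)) (Gs : seq (seq (seq nat))) : seq (seq nat) :=
  let cg := [seq (nth [::] classes i, nth [::] Gs i) | i <- iota 0 (size classes)] in
  let M := (foldl (solve_step n E cg)
     (rev cg, flatten [seq [seq (e, (f, [:: iota 0 n])) | f <- E] | e <- E]) (rev cg)).2 in
  if nilp E then flatten Gs else (head ([::], ([::], [::])) M).2.2.

(** * The algorithm runs in polynomial time *)

Section PTalgo.
Variables (X : Type) (EX : Enc X).

Lemma PT_fval (n : X -> nat) (c x : X -> seq nat) : PT n -> PT c -> PT x ->
  PT (fun t => fval (n t) (c t) (x t)).
Proof. by move=> Pn Pc Px; rewrite /fval; pt. Qed.

Lemma PT_lpair (n : X -> nat) (c x : X -> seq nat) : PT n -> PT c -> PT x ->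
  PT (fun t => lpair (n t) (c t) (x t)).
Proof. by move=> Pn Pc Px; rewrite /lpair; pt. Qed.

Lemma PT_same (n c x : X -> seq nat) : PT n -> PT c -> PT x ->
  PT (fun t => same (n t) (c t) (x t)).
Proof. by move=> Pn Pc Px; rewrite /same; pt. Qed.

Lemma PT_sends (c g e f : X -> seq nat) : PT c -> PT g -> PT e -> PT f ->
  PT (fun t => sends (c t) (g t) (e t) (f t)).
Proof. by move=> Pc Pg Pe Pf; rewrite /sends; pt. Qed.
End PTalgo.

Ltac pt_user6 := fail.
Ltac pt_user5 ::= lazymatch goal with
  | |- PT (fun x => fval (@?f x) (@?g x) (@?h x)) =>
      refine (PT_fval (n := f) (c := g) (x := h) _ _ _)
  | |- PT (fun x => lpair (@?f x) (@?g x) (@?h x)) =>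
      refine (PT_lpair (n := f) (c := g) (x := h) _ _ _)
  | |- PT (fun x => same (@?f x) (@?g x) (@?h x)) =>
      refine (PT_same (n := f) (c := g) (x := h) _ _ _)
  | |- PT (fun x => sends (@?f x) (@?g x) (@?h x) (@?k x)) =>
      refine (PT_sends (c := f) (g := g) (e := h) (f := k) _ _ _ _)
  | |- _ => pt_user6
  end.

Section PTalgo.
Variables (X : Type) (EX : Enc X).

Lemma PT_grow (n : X -> nat) (c : X -> seq nat) (S R : X -> seq (seq nat)) :
  PT n -> PT c -> PT S -> PT R -> PT (fun x => grow (n x) (c x) (S x) (R x)).
Proof. by move=> Pn Pc PS PR; rewrite /grow; cbv zeta; apply: PT_if; pt. Qed.

Lemma PT_schreier (n : X -> nat) (c z : X -> seq nat) (S R : X -> seq (seq nat)) :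
  PT n -> PT c -> PT S -> PT R -> PT z ->
  PT (fun x => schreier (n x) (c x) (S x) (R x) (z x)).
Proof. by move=> Pn Pc PS PR Pz; rewrite /schreier; pt. Qed.

Lemma PT_compatible (E : X -> seq (seq nat)) (W c g e f : X -> seq nat) :
  PT E -> PT W -> PT c -> PT g -> PT e -> PT f ->
  PT (fun x => compatible (E x) (W x) (c x) (g x) (e x) (f x)).
Proof. by move=> *; rewrite /compatible; pt. Qed.
End PTalgo.

Ltac pt_user7 := fail.
Ltac pt_user6 ::= lazymatch goal with
  | |- PT (fun x => grow (@?f x) (@?g x) (@?h x) (@?k x)) =>
      refine (PT_grow (n := f) (c := g) (S := h) (R := k) _ _ _ _)
  | |- PT (fun x => schreier (@?f x) (@?g x) (@?h x) (@?k x) (@?l x)) =>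
      refine (PT_schreier (n := f) (c := g) (S := h) (R := k) (z := l) _ _ _ _ _)
  | |- PT (fun x => compatible (@?f x) (@?g x) (@?h x) (@?k x) (@?l x) (@?m x)) =>
      refine (PT_compatible (E := f) (W := g) (c := h) (g := k) (e := l) (f := m) _ _ _ _ _ _)
  | |- _ => pt_user7
  end.

Lemma sz_grow n c S R : sz (grow n c S R) <= sz R + (n + n + 2) ^ 4.
Proof.
rewrite /grow; case: ifP => [_|]; first exact: leq_addr.
set cs := [seq _ <- _ | _]; case E : cs => [|y cs'] //= _.
have : y \in cs by rewrite E mem_head.
rewrite mem_filter => /andP[_ /flattenP[_ /mapP[r _ ->] /mapP[s _ ->]]].
rewrite sz_cons; have := sz_lmul (n + n) r s; rewrite (expnS _ 3).
by have := ppow_gt0 (n + n) 3; nia.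
Qed.

Section PTalgo.
Variables (X : Type) (EX : Enc X).

Lemma PT_orbit_reps (n : X -> nat) (c x0 : X -> seq nat) (L S : X -> seq (seq nat)) :
  PT n -> PT c -> PT L -> PT S -> PT x0 ->
  PT (fun x => orbit_reps (n x) (c x) (L x) (S x) (x0 x)).
Proof.
move=> *; apply: (PT_foldl_bd (step := fun x R _ => grow (n x) (c x) (S x) R)
  (N := fun x => n x + n x) (k := 4)); pt.
by move=> x R _; apply: sz_grow.
Qed.
End PTalgo.

Ltac pt_user8 := fail.
Ltac pt_user7 ::= lazymatch goal with
  | |- PT (fun x => orbit_reps (@?f x) (@?g x) (@?h x) (@?k x) (@?l x)) =>
      refine (PT_orbit_reps (n := f) (c := g) (L := h) (S := k) (x0 := l) _ _ _ _ _)
  | |- _ => pt_user8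
  end.

Lemma PT_agree X (EX : Enc X) (n : X -> nat) (c : X -> seq nat) (L T : X -> seq (seq nat)) :
  PT n -> PT c -> PT L -> PT T -> PT (fun x => agree (n x) (c x) (L x) (T x)).
Proof.
by move=> *; rewrite /agree; cbv zeta; apply: PT_if; pt; apply: PT_if; pt.
Qed.

Ltac pt_user9 := fail.
Ltac pt_user8 ::= lazymatch goal with
  | |- PT (fun x => agree (@?f x) (@?g x) (@?h x) (@?k x)) =>
      refine (PT_agree (n := f) (c := g) (L := h) (T := k) _ _ _ _)
  | |- _ => pt_user9
  end.

Lemma PT_meet2 X (EX : Enc X) (n : X -> nat) (cg : X -> classes_t) (T U : X -> seq (seq nat)) :
  PT n -> PT cg -> PT T -> PT U -> PT (fun x => meet2 (n x) (cg x) (T x) (U x)).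
Proof.
move=> *; rewrite /meet2; pt.
apply: (PT_foldl_bd (step := fun x T c => reduce (n x + n x) (agree (n x) c.1 c.2 T))
  (N := fun x => n x + n x) (k := 6)); pt.
by move=> x V c'; have := sz_reduce (n x + n x) (agree (n x) c'.1 c'.2 V); lia.
Qed.

Lemma PT_meet X (EX : Enc X) (n : X -> nat) (cg : X -> classes_t) (T : X -> seq (seq (seq nat))) :
  PT n -> PT cg -> PT T -> PT (fun x => meet (n x) (cg x) (T x)).
Proof.
move=> Pn Pcg PT0; apply: (PT_foldl_bd (step := fun x T U => meet2 (n x) (cg x) T U)
  (N := n) (k := 6)); pt.
  by apply: (PT_meet2 (n := fun p => n p.1) (cg := fun p => cg p.1)
     (T := fun p => p.2.1) (U := fun p => p.2.2)); pt.
by move=> x V U; apply: leq_trans (sz_reduce _ _) _; lia.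
Qed.

Ltac pt_user10 := fail.
Ltac pt_user9 ::= lazymatch goal with
  | |- PT (fun x => meet (@?f x) (@?g x) (@?h x)) =>
      refine (PT_meet (n := f) (cg := g) (T := h) _ _ _)
  | |- _ => pt_user10
  end.

Lemma PT_entry X (EX : Enc X) (n : X -> nat) (E : X -> seq (seq nat)) (cg : X -> classes_t)
   (W : X -> seq nat) (c : X -> seq nat * seq (seq nat)) (M : X -> table_t) (e f : X -> seq nat) :
  PT n -> PT E -> PT cg -> PT W -> PT c -> PT M -> PT e -> PT f ->
  PT (fun x => entry (n x) (E x) (cg x) (W x) (c x) (M x) (e x) (f x)).
Proof. by move=> *; rewrite /entry; pt; apply: PT_if; pt. Qed.

Ltac pt_user10 ::= lazymatch goal with
  | |- PT (fun x => entry (@?f x) (@?g x) (@?h x) (@?k x) (@?l x) (@?m x) (@?p x) (@?q x)) =>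
      refine (PT_entry (n := f) (E := g) (cg := h) (W := k) (c := l) (M := m) (e := p) (f := q)
        _ _ _ _ _ _ _ _)
  end.

Lemma size_le_sz A (EA : Enc A) (s : seq A) : size s < sz s.
Proof. by elim: s => // a s IH; rewrite sz_cons /=; lia. Qed.

Lemma sz_seq_le A (EA : Enc A) (s : seq A) m : (forall a, List.In a s -> sz a < m) ->
  sz s <= size s * m + 1.
Proof.
elim: s => // a s IH H; rewrite sz_cons [size (a :: s)]/= mulSn.
have := H a (or_introl erefl); have := IH (fun b hb => H b (or_intror hb)); lia.
Qed.

Lemma sz_mem (e : seq nat) (E : seq (seq nat)) : e \in E -> sz e <= sz E.
Proof.
elim: E => // f E IH; rewrite inE sz_cons => /orP[/eqP -> | /IH h].
  by apply: leqW; apply: leq_addr.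
by apply: leq_trans h _; apply: leqW; apply: leq_addl.
Qed.

Lemma In_mem (T : eqType) (a : T) s : List.In a s -> a \in s.
Proof. by elim: s => //= b s IH [-> | /IH]; rewrite inE ?eqxx // => ->; rewrite orbT. Qed.

(** The previous table M does not occur in the bound, since every entry is reduced; sizes therefore
    do not compound from class to class. *)
Lemma sz_level n E cg W c M :
  sz (level n E cg W c M) <= sz E * sz E * (2 * sz E + (n + 2) ^ 6 + 3) + 1.
Proof.
have [B EB] : exists B, B = 2 * sz E + (n + 2) ^ 6 + 3 by eexists.
rewrite -EB.
apply: leq_trans (@sz_seq_le _ _ _ B _) _; last first.
  have -> : size (level n E cg W c M) = size E * size E by rewrite /level size_allpairs.
  by rewrite leq_add2r leq_mul2r leq_mul ?orbT // ltnW // size_le_sz.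
move=> t /In_mem /flattenP[_ /mapP[e he ->] /mapP[f hf ->]].
have := sz_mem he; have := sz_mem hf; have := sz_reduce n.
by rewrite !sz_pair /= EB /entry; set T := flatten _ => /(_ T); lia.
Qed.

Section Solve.
Variables (X : Type) (EX : Enc X) (n : X -> nat) (E classes : X -> seq (seq nat))
  (Gs : X -> seq (seq (seq nat))).

Lemma PT_solve : PT n -> PT E -> PT classes -> PT Gs ->
  PT (fun x => solve (n x) (E x) (classes x) (Gs x)).
Proof.
move=> Pn PE Pc PG; rewrite /solve; cbv zeta; apply: PT_if; pt.
pose cg x := [seq (nth [::] (classes x) i, nth [::] (Gs x) i) | i <- iota 0 (size (classes x))].
have Pcg : PT cg by rewrite /cg; pt.
apply: (PT_foldl_add (step := fun x s c => solve_step (n x) (E x) (cg x) s c)); pt.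
  by rewrite /solve_step /level; pt.
have [q Pq [hq mq]] := PT_rel PE; have [p Pp [hp mp]] := PT_rel Pn.
exists (fun m => q m * q m * (2 * q m + (p m + 2) ^ 6 + 3) + 2).
  apply: isP_add (isP_const _); apply: isP_mul (isP_mul Pq Pq) _.
  apply: isP_add (isP_const _); apply: isP_add (isP_mul (isP_const _) Pq) _.
  exact: (isP_comp (isP_pow 2 6) Pp).
move=> x [pre M] c; rewrite !sz_pair /= -sz_pair.
have h1 : sz (behead pre) <= sz pre by apply: sz_behead.
have h2 := sz_level (n x) (E x) (cg x) (flatten [seq c'.1 | c' <- behead pre]) c M.
have hE : sz (E x) <= q (sz x + sz c) by apply: leq_trans (hq x) (mq _ _ (leq_addr _ _)).
have hn : n x <= p (sz x + sz c).
  apply: leq_trans (mp _ _ (leq_addr (sz c) (sz x))); have := hp x; rewrite sz_nat; lia.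
have h3 : sz (E x) * sz (E x) * (2 * sz (E x) + (n x + 2) ^ 6 + 3) <=
  q (sz x + sz c) * q (sz x + sz c) * (2 * q (sz x + sz c) + (p (sz x + sz c) + 2) ^ 6 + 3).
  apply: leq_mul; first exact: leq_mul.
  by rewrite leq_add2r leq_add ?leq_mul2l // leq_exp2r // leq_add2r.
apply: leq_trans (_ : (sz pre + (q (sz x + sz c) * q (sz x + sz c) *
  (2 * q (sz x + sz c) + (p (sz x + sz c) + 2) ^ 6 + 3) + 1)).+1 <= _).
  by rewrite ltnS leq_add // (leq_trans h2) // leq_add2r.
by move: (_ * (_ + _ + 3)) => R; lia.
Qed.
End Solve.

(** * Input and output *)

Definition sym_num (a : sym) : nat :=
  match a with blank => 0 | zero => 1 | one => 2 | lbr => 3 | rbr => 4 end.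

Definition pstate := (seq tree * seq (seq tree))%type.

(* Reading the input from right to left, [st.1] is the list of values parsed so far at the
   current bracket level, and [st.2] contains the lists of the enclosing levels. *)
Definition parse_step (st : pstate) (a : sym) : pstate :=
  if sym_num a == 0 then st
  else if sym_num a == 1 then (Leaf :: st.1, st.2)
  else if sym_num a == 2 then (Node Leaf (head Leaf st.1) :: behead st.1, st.2)
  else if sym_num a == 3 then ((enc st.1 : tree) :: head [::] st.2, behead st.2)
  else ([::], st.1 :: st.2).

(** The list of the four top-level values has the code of a nested tuple whose last component is
    [tt], the leaf that ends the list; this explains the type [instance_t]. *)
Definition parse (w : seq sym) : tree := enc (foldl parse_step ([::], [::]) (rev w)).1.

Lemma PT_node X (EX : Enc X) (f g : X -> tree) : PT f -> PT g -> PT (fun x => Node (f x) (g x)).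
Proof.
move=> Pf Pg; apply: (PT_comp (f := fun x => (f x, g x)) (g := fun p : tree * tree => Node p.1 p.2)).
  exact: PT_cast.
exact: PT_pair.
Qed.

Lemma PT_sym_num X (EX : Enc X) (f : X -> sym) : PT f -> PT (fun x => sym_num (f x)).
Proof. by move=> Pf; apply: (PT_comp (g := sym_num) _ Pf); apply: PT_cast; case. Qed.

Lemma PT_enc X A (EX : Enc X) (EA : Enc A) (f : X -> A) : PT f -> PT (fun x => enc (f x) : tree).
Proof. by move=> Pf; apply: (PT_comp (g := enc) _ Pf); apply: PT_cast. Qed.

Lemma sz_parse_step st a : sz (parse_step st a) <= sz st + 4.
Proof.
case: st => cur stk; rewrite /parse_step.
have n1 : sz (Nil tree) = 1 by [].
have n2 : sz (Nil (seq tree)) = 1 by [].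
have e1 : sz (enc cur : tree) = sz cur by [].
have e2 : sz Leaf = 1 by [].
have e3 t u : sz (Node t u) = (sz t + sz u).+1 by rewrite /sz /= size_cat.
case: (sym_num a) => [|[|[|[|k]]]]; rewrite !eqE /= ?sz_pair /= ?sz_cons ?e1 ?n1 ?n2 ?e2; try lia.
  by case: cur e1 => [|t cur] _ /=; rewrite ?e3 ?sz_cons ?e2 ?n1; lia.
by case: stk => [|s stk] /=; rewrite ?sz_cons ?n1 ?n2; lia.
Qed.

Lemma PT_parse : PT parse.
Proof.
apply: PT_enc; pt.
apply: (PT_foldl_bd (step := fun _ s a => parse_step s a) (N := fun=> 2) (k := 1)); pt.
- exact (PT_rev (PT_id _)).
- rewrite /parse_step; do 2 (apply: PT_if; pt; first by apply: PT_sym_num; pt).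
  apply: PT_if; pt; [by apply: PT_sym_num; pt | by apply: PT_node; pt |].
  by apply: PT_if; pt; [apply: PT_sym_num | apply: PT_enc]; pt.
by move=> _ st a; apply: leq_trans (sz_parse_step _ _) _.
Qed.

Lemma parse_nat n cur stk :
  foldr (fun a s => parse_step s a) (cur, stk) (enc_nat n) = (enc n :: cur, stk).
Proof.
rewrite /enc_nat foldr_cat /= {1}/parse_step /=.
by elim: n => //= n ->; rewrite /parse_step.
Qed.

Lemma parse_list A (EA : Enc A) (e : A -> seq sym) s cur stk :
  (forall a cur stk,
     foldr (fun a s => parse_step s a) (cur, stk) (e a) = (enc a :: cur, stk)) ->
  foldr (fun a s => parse_step s a) (cur, stk) (enc_list e s) = (enc s :: cur, stk).
Proof.
move=> H; rewrite /enc_list /= foldr_cat /= {2}/parse_step /=.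
have -> : foldr (fun a s => parse_step s a) ([::], cur :: stk) (flatten (map e s)) =
  (map enc s, cur :: stk).
  by elim: s => //= a s IH; rewrite foldr_cat IH H.
rewrite /parse_step /=; congr (_ :: _, _).
by rewrite /enc /enc_seq; elim: s => //= a s ->.
Qed.

Lemma parse_instance I : parse (enc_instance I) =
  enc (inst_n I, (inst_edges I, (inst_classes I, (inst_groups I, tt)))).
Proof.
rewrite /parse foldl_rev /enc_instance !foldr_cat.
have H1 := parse_nat; have H2 s c k := @parse_list _ _ _ s c k H1.
have H3 s c k := @parse_list _ _ _ s c k H2; have H4 s c k := @parse_list _ _ _ s c k H3.
rewrite /enc_natsss H4 (H3 (inst_classes I)) (H3 (inst_edges I)) -foldr_cat H1.
by [].
Qed.

Lemma PT_enc_natss : PT enc_natss.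
Proof.
apply: (PT_ext (g := fun s => lbr :: flatten [seq lbr :: flatten
   [seq [seq one | _ <- iota 0 k] ++ [:: zero] | k <- t] ++ [:: rbr] | t <- s] ++ [:: rbr])).
  have E k : enc_nat k = [seq one | _ <- iota 0 k] ++ [:: zero].
    by rewrite /enc_nat; congr cat; elim: k 0 => //= k IH m; rewrite -IH.
  move=> s; rewrite /enc_natss /enc_list; congr (_ :: flatten _ ++ _).
  by apply: eq_map => t; rewrite /enc_nats /enc_list; congr (_ :: flatten _ ++ _); apply: eq_map.
by pt.
Qed.

Definition instance_t :=
  (nat * (seq (seq nat) * (seq (seq nat) * (seq (seq (seq nat)) * unit))))%type.

Definition solve_instance (t : instance_t) : seq (seq nat) :=
  solve t.1 t.2.1 t.2.2.1 t.2.2.2.1.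

Lemma PT_solve_instance : PT (fun t => enc_natss (solve_instance t)).
Proof.
by apply: (PT_comp PT_enc_natss); apply: (PT_solve (n := fun t : instance_t => t.1)); pt.
Qed.

Definition cread := Seq (Loop 0 (fun a => Push 1 a)) (Seq (Push 0 zero)
  (Loop 1 (fun a => Seq (cconst (code (enc a))) (Push 0 one)))).

Lemma does_read_input (w : seq sym) : blank \notin w -> does_on cread (40 * (size w).+1) w (code (enc w)).
Proof.
have e1 (u x : seq sym) : blank \notin u -> exec (Loop 0 (fun a => Push 1 a)) (2 * size u + 1)
    [:: u; x; [::]; [::]] [:: [::]; rev u ++ x; [::]; [::]].
  elim: u x => [|a u IH] x /=; first by move=> _; apply: EStop.
  rewrite inE negb_or eq_sym => /andP[na /(IH (a :: x))].
  rewrite rev_cons cat_rcons (_ : 2 * (size u).+1 + 1 = (1 + (2 * size u + 1)).+1); last by lia.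
  by apply: ELoop => //; apply: EPush'.
have sa a : size (code (enc a)) <= 9 by case: a.
have e2 (u v : seq sym) : exists2 n, n <= 21 * size u + 1 &
   exec (Loop 1 (fun a => Seq (cconst (code (enc a))) (Push 0 one))) n
    [:: code (enc (v : seq sym)); rev u; [::]; [::]] [:: code (enc (u ++ v)); [::]; [::]; [::]].
  elim/last_ind: u v => [|u a IH] v; first by exists 1 => //; apply: EStop.
  rewrite cat_rcons rev_rcons size_rcons; have [n hn e] := IH (a :: v).
  exists ((2 * size (code (enc a)) + 1).+1 + n).+1; first by have := sa a; lia.
  apply: ELoop e => //; apply: ESeq; first by apply: exec_const; apply: code_pure.
  by apply: EPush'.
move=> bw; have := e1 w [::] bw; rewrite cats0 => E1.
have [n hn E2] := e2 w [::]; rewrite cats0 in E2.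
eexists; last first.
  by apply: ESeq E1 _; apply: ESeq E2; apply: EPush'.
by lia.
Qed.

(** A symbol is encoded by a unary number, each unit of which is a node with a leaf, hence two
    symbols to pop. *)
Fixpoint cdecode (l : seq sym) : cmd :=
  if l is a :: l' then Case 0 (fun x => if x is zero then Push 1 a else Case 0 (fun=> cdecode l'))
  else Skip.

Definition cwrite := Seq (Push 3 zero) (Seq (Loop 3 (fun=> Case 0 (fun x =>
   if x is zero then Skip
   else Seq (cdecode [:: blank; zero; one; lbr; rbr]) (Push 3 zero)))) (Loop 1 (fun a => Push 0 a))).

Lemma does_write_output (o : seq sym) : blank \notin o ->
  does_on cwrite (40 * (size o).+1) (code (enc o)) o.
Proof.
rewrite /cwrite => bo; set L := Loop 3 _.
have e1 (u x : seq sym) : blank \notin u -> exists2 n, n <= 20 * size u + 3 &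
   exec L n [:: code (enc (u : seq sym)); x; [::]; [:: zero]] [:: [::]; rev u ++ x; [::]; [::]].
  elim: u x => [|a u IH] x /=.
    exists (1 + 1).+1 => //; apply: ELoop => //; last by apply: EStop.
    by apply: ECase => //; apply: ESkip.
  rewrite inE negb_or eq_sym => /andP[na /(IH (a :: x)) [n hn e]].
  rewrite rev_cons cat_rcons.
  have [m hm em] : exists2 m, m <= 12 & exec (cdecode [:: blank; zero; one; lbr; rbr]) m
     [:: code (enc a) ++ code (enc u); x; [::]; [::]] [:: code (enc u); a :: x; [::]; [::]].
    case: a na {e} => // _; eexists; last first;
      try (repeat (apply: ECase => //=); by apply: EPush'); by [].
  exists ((m + 1).+2 + n).+1; first by lia.
  apply: ELoop e => //; apply: ECase => //.
  have : exec (Seq (cdecode [:: blank; zero; one; lbr; rbr]) (Push 3 zero)) (m + 1).+1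
     [:: code (enc a) ++ code (enc u); x; [::]; [::]] [:: code (enc u); a :: x; [::]; [:: zero]].
    by apply: ESeq em _; apply: EPush'.
  by apply.
have e2 (u x : seq sym) : blank \notin u -> exec (Loop 1 (fun a => Push 0 a)) (2 * size u + 1)
    [:: x; rev u; [::]; [::]] [:: u ++ x; [::]; [::]; [::]].
  elim/last_ind: u x => [|u a IH] x; first by move=> _; apply: EStop.
  rewrite mem_rcons inE negb_or eq_sym => /andP[na /(IH (a :: x))].
  rewrite cat_rcons rev_rcons size_rcons.
  rewrite (_ : 2 * (size u).+1 + 1 = (1 + (2 * size u + 1)).+1); last by lia.
  by apply: ELoop => //; apply: EPush'.
have [n hn E1] := e1 o [::] bo; rewrite cats0 in E1.
have := e2 o [::] bo; rewrite cats0 => E2.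
eexists; last first.
  by apply: ESeq _ (ESeq E1 E2); apply: EPush'.
by lia.
Qed.

Lemma enc_nat_pure k : blank \notin enc_nat k.
Proof. by rewrite /enc_nat mem_cat mem_nseq andbF. Qed.

Lemma enc_list_pure A (e : A -> seq sym) s :
  (forall a, blank \notin e a) -> blank \notin enc_list e s.
Proof.
move=> H; rewrite /enc_list inE mem_cat /= orbF.
by elim: s => //= a s IH; rewrite mem_cat negb_or H.
Qed.

Lemma enc_natss_pure s : blank \notin enc_natss s.
Proof. by do 2 apply: enc_list_pure => ?; apply: enc_nat_pure. Qed.

Lemma enc_instance_pure I : blank \notin enc_instance I.
Proof.
have catP (a b : seq sym) : blank \notin a -> blank \notin b -> blank \notin a ++ b.
  by rewrite mem_cat negb_or => -> ->.
by do 3 (apply: (catP _ _); rewrite ?enc_nat_pure ?enc_natss_pure //);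
  apply: enc_list_pure => ?; apply: enc_natss_pure.
Qed.

Lemma PT_program : exists c k, forall I,
  does_on c ((size (enc_instance I) + 2) ^ k) (enc_instance I)
    (enc_natss (solve (inst_n I) (inst_edges I) (inst_classes I) (inst_groups I))).
Proof.
have [p Pp [hp mp]] := PT_rel PT_parse; have [q Pq [hq mq]] := PT_rel PT_solve_instance.
have [cp [kp Hp]] := PT_parse; have [cs [ks Hs]] := PT_solve_instance.
have szw (w : seq sym) : sz w <= 20 * (size w + 1).
  elim: w => // a w IH; rewrite sz_cons /=.
  have : sz a <= 10 by case: a.
  by lia.
pose r m := 20 * (m + 1).
have Pr : isP r by apply: isP_mul (isP_const _) (isP_add isP_id (isP_const _)).
have [k hk] : isP (fun m => 40 * (m + 1) + ((r m + 2) ^ kp + ((p (r m) + 2) ^ ks +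
    40 * (q (p (r m)) + 1))) + 3).
  apply: isP_add (isP_const _); apply: isP_add.
    by apply: isP_mul (isP_const _) (isP_add isP_id (isP_const _)).
  apply: isP_add; first exact: (isP_comp (isP_pow 2 kp) Pr).
  have Ppr := isP_comp Pp Pr.
  apply: isP_add; first exact: (isP_comp (isP_pow 2 ks) Ppr).
  exact: isP_mul (isP_const _) (isP_add (isP_comp Pq Ppr) (isP_const _)).
exists (Seq cread (Seq cp (Seq cs cwrite))), k => I; set w := enc_instance I.
pose t : instance_t := (inst_n I, (inst_edges I, (inst_classes I, (inst_groups I, tt)))).
have D1 := does_read_input (enc_instance_pure I).
have D2 := Hp w [::]; rewrite parse_instance -/t !cats0 in D2.
have D3 := Hs t [::]; rewrite !cats0 in D3.
have D4 := does_write_output (enc_natss_pure (solve_instance t)).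
apply: does_on_le (does_on_seq D1 (does_on_seq D2 (does_on_seq D3 D4))) _.
apply: leq_trans _ (hk (size w)); rewrite -/w.
have expm a b c : a <= b -> (a + 2) ^ c <= (b + 2) ^ c.
  by move=> h; case: c => [|c]; rewrite ?expn0 // leq_exp2r // leq_add2r.
have hw : sz w <= r (size w) by apply: szw.
have ht : sz t <= p (r (size w)).
  have -> : sz t = sz (parse w) by rewrite parse_instance.
  exact: leq_trans (hp w) (mp _ _ hw).
have ho : size (enc_natss (solve_instance t)) <= q (p (r (size w))).
  apply: leq_trans (leq_trans (hq t) (mq _ _ ht)).
  exact: ltnW (size_le_sz _ _).
have h2 := expm _ _ kp hw; have h3 := expm _ _ ks ht.
by lia.
Qed.

Lemma TM_program (T : Type) (c : cmd) k (input output : T -> seq sym) :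
  (forall I, does_on c ((size (input I) + 2) ^ k) (input I) (output I)) ->
  (forall I, blank \notin input I) -> (forall I, 0 < size (input I)) ->
  (forall I, blank \notin output I) -> (forall I, 0 < size (output I)) ->
  exists (M : TM) (a b : nat), forall I, exists t,
    [/\ t <= a * (size (input I)) ^ b + a, @tm_halt M (cf_state (tm_run M t (input I))) &
        exists j, tm_output (tm_run M t (input I)) = output I ++ nseq j blank].
Proof.
move=> H bi si bo so; pose f m := (m + 2) ^ k * (40 * (m + 4 + (m + 2) ^ k + 10)).
have [b hb] : isP f.
  apply: isP_mul (isP_pow _ _) (isP_mul (isP_const _) (isP_add (isP_add _ (isP_pow _ _)) (isP_const _))).
  exact: isP_add isP_id (isP_const _).
(* The input is not empty, so its size n satisfies n + 2 <= 3 n. *)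
exists (comp c), (3 ^ b), b => I; have [n hn e] := H I.
have := exec_sound e; rewrite /= bi => /(_ isT erefl) [_ _ _ /(_ _ (leqnn _)) [t [l [ht D]]]].
(* Up to trailing blanks, the bare input is already a store with three empty stacks and a blank on
   its left. *)
have E0 : teq (home (V1 (input I))) (tp [::] (input I)).
  apply: teq_tp; first exact: seq_sim_blank.
  rewrite /V1 /flat /= -!catA; rewrite -[X in seq_sim _ X]cats0; apply: seq_sim_cat.
  by case=> [|[|[|[|i]]]] //=; rewrite !nth_nil.
have [q [u [R hq _ tu]]] := D _ E0.
have Hrun : tm_run (comp c) t (input I) = config_of q u by rewrite -(runs_iter R).
exists t; rewrite Hrun; split=> //.
  apply: leq_trans (leq_addr _ _); apply: leq_trans ht _.
  have hm : (size (input I) + 2) ^ b <= 3 ^ b * size (input I) ^ b.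
    by rewrite -expnMn; case: (b) => [|b']; rewrite ?expn0 // leq_exp2r //; have := si I; lia.
  apply: leq_trans hm; apply: leq_trans (hb _); rewrite /f.
  have -> : size (flat (V1 (input I))) = size (input I) + 4 by rewrite /flat /= !size_cat /=; lia.
  by apply: leq_mul => //; rewrite leq_mul2l leq_add2r leq_add2l hn.
case: tu => _ e1 e2; rewrite /tm_output /config_of /=.
have {e2}e2 i : nth blank (u.1.2 :: u.2) i = nth blank (output I ++ nseq 4 blank) i.
  rewrite -e1; case: i => [|i] /=.
    by rewrite /V1 /flat /= -catA; case: (output I).
  rewrite -e2 /= /tl_sym nth_behead /V1 /flat /= -catA.
  by rewrite !nth_cat.
set o := u.1.2 :: u.2 in e2 *.
(* The tape is known up to trailing blanks only, but the last symbol of the output is not blank and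
   must be present. *)
have so' : size (output I) <= size o.
  case: leqP => // hs.
  have : nth blank (output I) (size (output I)).-1 = blank.
    have := e2 (size (output I)).-1; rewrite nth_cat prednK // leqnn => <-.
    by rewrite nth_default //; have := so I; lia.
  by move=> hbl; have := bo I; rewrite -{1}hbl mem_nth // prednK.
exists (size o - size (output I)); apply: (@eq_from_nth _ blank).
  by rewrite size_cat size_nseq subnKC.
move=> i hi; rewrite e2 !nth_cat; case: ifP => // _.
by rewrite !nth_nseq !if_same.
Qed.

(** * Correctness *)

Import GroupScope.

(** * Permutations as lists, and generation of cosets *)

Section Lists.
Variable N : nat.
Implicit Types p q x y z : {perm 'I_N}.

Definition lp p : seq nat := [seq val (p i) | i <- enum 'I_N].

Lemma size_lp p : size (lp p) = N.
Proof. by rewrite size_map size_enum_ord. Qed.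

Lemma nth_lp p (i : 'I_N) : nth 0%N (lp p) i = p i.
Proof. by rewrite (nth_map i) ?size_enum_ord // nth_ord_enum. Qed.

Lemma lp_inj : injective lp.
Proof. by move=> p q e; apply/permP => i; apply: val_inj; rewrite /= -!nth_lp e. Qed.

Lemma lp_eq s p : size s = N -> (forall i : 'I_N, nth 0%N s i = p i) -> s = lp p.
Proof.
move=> sz H; apply: (@eq_from_nth _ 0%N); rewrite ?size_lp // => i.
by rewrite sz => hi; rewrite (H (Ordinal hi)) -nth_lp.
Qed.

Lemma lp_valid p : valid_perm N (lp p).
Proof.
rewrite /valid_perm; apply: uniq_perm; rewrite ?iota_uniq //.
  by rewrite map_inj_uniq ?enum_uniq //; apply: inj_comp val_inj perm_inj.
move=> v; rewrite mem_iota /= add0n; apply/mapP/idP => [[i _ ->]|hv]; first exact: ltn_ord.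
by exists (p^-1 (Ordinal hv)); rewrite ?mem_enum // permKV.
Qed.

Lemma perm_of_lp p : perm_of N (lp p) = p.
Proof.
rewrite /perm_of; case: pickP => [q /forallP H|/(_ p) /forallP []] /=.
  apply/permP => i; move/eqP: (H i) => ->; rewrite /seq_fun nth_lp.
  by rewrite valK.
by move=> i; rewrite /seq_fun nth_lp valK.
Qed.

Lemma valid_lp s : valid_perm N s -> s = lp (perm_of N s).
Proof.
move=> vs; have sz : size s = N by rewrite (perm_size vs) size_iota.
have us : uniq s by rewrite (perm_uniq vs) iota_uniq.
have hs i : i < N -> nth 0%N s i < N.
  move=> hi; have : nth 0%N s i \in s by rewrite mem_nth ?sz.
  by rewrite (perm_mem vs) mem_iota.
have inj : injective (fun i : 'I_N => Ordinal (hs i (ltn_ord i))).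
  move=> i j [] /eqP; rewrite nth_uniq ?sz // => /eqP; exact: val_inj.
have e : s = lp (perm inj) by apply: lp_eq => // i; rewrite permE.
by rewrite {2}e perm_of_lp.
Qed.

Lemma lmul_lp p q : lmul N (lp p) (lp q) = lp (p * q).
Proof.
apply: lp_eq; rewrite ?size_map ?size_iota // => i.
rewrite (nth_map 0%N) ?size_iota // nth_iota // add0n !nth_lp permM.
by apply/minn_idPr; apply: ltnW.
Qed.

Lemma linv_lp p : linv N (lp p) = lp p^-1.
Proof.
apply: lp_eq; rewrite ?size_map ?size_iota // => i.
rewrite (nth_map 0%N) ?size_iota // nth_iota // add0n.
set s := [seq _ <- _ | _].
have hs j : j \in s -> j = p^-1 i.
  rewrite mem_filter mem_iota add0n => /andP[/eqP e /= hj]; move: e.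
  by rewrite (nth_lp p (Ordinal hj)) => /val_inj <-; rewrite permK.
have : (p^-1 i : nat) \in s by rewrite mem_filter mem_iota add0n ltn_ord nth_lp permKV eqxx.
case: s hs => //= j s hs _; apply: hs; exact: mem_head.
Qed.

Lemma iota_lp : iota 0 N = lp 1.
Proof. by apply: lp_eq; rewrite ?size_iota // => i; rewrite nth_iota ?perm1. Qed.

Lemma moved_lp p : let m := moved N (lp p) in
  [/\ m <= N, forall i : 'I_N, i < m -> p i = i &
      forall k, k <= N -> (forall i : 'I_N, i < k -> p i = i) -> k <= m].
Proof.
rewrite /moved /=; set s := [seq _ <- _ | _].
have hs i : (i \in s) = (i < N) && (nth 0%N (lp p) i != i) by rewrite mem_filter mem_iota andbC.
have srt : sorted ltn s by apply: sorted_filter; [exact: ltn_trans | exact: iota_ltn_sorted].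
split.
- case E : s => [|a s'] //=; have := hs a; rewrite E mem_head => /esym /andP[h _].
  exact: ltnW.
- move=> i hi; apply/eqP; apply: contraLR hi => ne; rewrite -leqNgt.
  have : (i : nat) \in s by rewrite hs ltn_ord nth_lp.
  case: s srt {hs} => //= a s srt; rewrite inE => /orP[/eqP -> // | hi].
  by move: srt; rewrite (path_sortedE ltn_trans) => /andP[/allP /(_ _ hi) /ltnW].
- move=> k kN hk; case E : s => [|a s'] //=; have := hs a; rewrite E mem_head.
  move=> /esym /andP[h]; rewrite leqNgt; apply: contra => ak.
  by rewrite (nth_lp p (Ordinal h)) hk.
Qed.

(** Exactly the empty set and the cosets of subgroups have this property, so emptiness needs no
    separate treatment. *)
Definition hclosed (C : {set {perm 'I_N}}) := forall x y z,
  x \in C -> y \in C -> z \in C -> x * y^-1 * z \in C.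

(** Generation is stated as minimality: an inclusion of C in a closed set is proved by looking at
    the listed elements only. *)
Definition gen (l : seq (seq nat)) (C : {set {perm 'I_N}}) :=
  [/\ forall s, s \in l -> exists2 p, p \in C & s = lp p, hclosed C &
      forall D, hclosed D -> (forall p, lp p \in l -> p \in D) -> C \subset D].

Lemma gen_in l C p : gen l C -> lp p \in l -> p \in C.
Proof. by case=> H _ _ /H [q qC /lp_inj ->]. Qed.

Lemma hclosed_group C x0 : hclosed C -> x0 \in C -> group_set [set h | x0 * h \in C].
Proof.
move=> hC xC; apply/group_setP; split; first by rewrite inE mulg1.
move=> a b; rewrite !inE => aC bC.
by have := hC _ _ _ aC xC bC; rewrite -mulgA mulKg -mulgA.
Qed.

Definition lset (l : seq (seq nat)) : {set {perm 'I_N}} := [set p | lp p \in l].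

Definition perms_in (l : seq (seq nat)) := forall s, s \in l -> exists p, s = lp p.

Lemma sift1_lp Q y : perms_in Q -> exists2 y', sift1 N Q (lp y) = lp y' &
  <<y' |: lset Q>> = <<y |: lset Q>> /\
  ((forall z, lp z \in Q -> key N (lp z) <> key N (lp y)) /\ y' = y \/
   (exists z, [/\ lp z \in Q, key N (lp z) = key N (lp y) & y' = y * z^-1])).
Proof.
move=> hQ; rewrite /sift1; set zs := [seq _ <- _ | _].
case E : zs => [|z zs'] /=.
  exists y => //; split=> //; left; split=> // z hz /eqP e.
  have : lp z \in zs by rewrite mem_filter e hz.
  by rewrite E.
have : z \in zs by rewrite E mem_head.
rewrite mem_filter => /andP[/eqP ez zQ]; have [z' ez'] := hQ _ zQ; subst z.
exists (y * z'^-1); first by rewrite linv_lp lmul_lp.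
split; last by right; exists z'; split.
have zg A : lset Q \subset <<A |: lset Q>> by rewrite sub_gen // subsetUr.
have zg' a : z' \in <<a |: lset Q>> by rewrite mem_gen // !inE zQ orbT.
apply/eqP; rewrite eqEsubset !gen_subG !subUset !sub1set; rewrite -!andbA; apply/and4P; split.
- by apply: groupM; rewrite ?groupV; [apply: mem_gen; apply: setU11 | apply: zg'].
- exact: zg.
- by rewrite -{1}(mulgKV z' y); apply: groupM; [apply: mem_gen; apply: setU11 | apply: zg'].
- exact: zg.
Qed.

Lemma sift_lp Q y : perms_in Q -> exists2 y', sift N Q (lp y) = lp y' &
  <<y' |: lset Q>> = <<y |: lset Q>> /\
  ((forall z, lp z \in Q -> key N (lp z) <> key N (lp y')) \/ y' = 1).
Proof.
move=> hQ.
(* Invariant after k rounds: no element of Q has the key of y0, or y0 fixes all points below k. *)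
suff H k (s : seq nat) y0 : size s + k = N.+1 ->
    (forall z, lp z \in Q -> key N (lp z) <> key N (lp y0)) \/ minn k N <= moved N (lp y0) ->
  exists2 y', foldl (fun t _ => sift1 N Q t) (lp y0) s = lp y' &
  <<y' |: lset Q>> = <<y0 |: lset Q>> /\
  ((forall z, lp z \in Q -> key N (lp z) <> key N (lp y')) \/ N <= moved N (lp y')).
  have [||y' e [g h]] := H 0%N (iota 0 N.+1) y; first by rewrite size_iota addn0.
    by right; rewrite min0n.
  exists y' => //; split=> //; case: h => h; [by left | right].
  apply/permP => i; rewrite perm1; have [_ m2 _] := moved_lp y'.
  by apply: m2; apply: leq_trans h.
elim: s k y0 => [|a s IH] k y0.
  rewrite add0n => -> hk; exists y0 => //; split=> //; case: hk => hk; [by left | right].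
  by move: hk; rewrite (minn_idPr _).
rewrite /= => e hk; have [y1 -> [g1 h1]] := sift1_lp y0 hQ.
have [||y' -> [g' h']] := IH k.+1 y1; first by rewrite addnS -addSn.
  case: h1 => [[h1 ->]|[z [zQ ez ->]]]; first by left.
  case: hk => hk; first by have := hk z zQ.
  (* y0 and z have the same first moved point and the same image of it, so y0 z^-1 fixes that point
     as well as the smaller ones. *)
  right; have [m1 m2 _] := moved_lp y0; have [_ m2z _] := moved_lp z.
  case: ez => ez1 ez2; rewrite ez1 in ez2 m2z.
  have fixlt (i : 'I_N) : i < moved N (lp y0) -> (y0 * z^-1) i = i.
    by move=> hi; rewrite permM m2 // -{1}(m2z i hi) permK.
  have [_ _ m3] := moved_lp (y0 * z^-1).
  apply: m3; first exact: geq_minr.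
  move=> i; rewrite leq_min => /andP[hi _].
  have [/fixlt //|hi'] := ltnP i (moved N (lp y0)).
  have ei : moved N (lp y0) = i.
    apply/eqP; rewrite eqn_leq hi' -ltnS; apply: leq_trans hi _.
    move: hk; have [kN|kN] := leqP k N; first by rewrite ltnS.
    by move/(leq_trans (ltn_ord i)); rewrite ltnNge hi'.
  by rewrite permM; apply: (@perm_inj _ z); rewrite permKV; apply: val_inj;
    rewrite /= -!nth_lp -ei.
by exists y' => //; rewrite g' g1.
Qed.

Lemma gens_reduce_lp T : perms_in T ->
  [/\ perms_in (gens_reduce N T), lp 1 \in gens_reduce N T &
      <<lset (gens_reduce N T)>> = <<lset T>>].
Proof.
move=> hT; rewrite /gens_reduce.
suff H T0 Q : perms_in T0 -> perms_in Q -> lp 1 \in Q ->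
  [/\ perms_in (foldl (insert N) Q T0), lp 1 \in foldl (insert N) Q T0 &
      <<lset (foldl (insert N) Q T0)>> = <<lset Q :|: lset T0>>].
  have [||h1 h2 ->] := H T [:: iota 0 N] hT.
  - by move=> s; rewrite inE iota_lp => /eqP ->; exists 1.
  - by rewrite iota_lp mem_head.
  split=> //; have -> : lset [:: iota 0 N] = 1.
    apply/setP => p; rewrite !inE iota_lp; apply/eqP/eqP => [/lp_inj //| -> //].
  apply/eqP; rewrite eqEsubset !gen_subG subUset sub1G subset_gen /=.
  by rewrite sub_gen // subsetUr.
elim: T0 Q {T hT} => [|t T IH] Q hT hQ h1 /=.
  by split=> //; congr <<_>>; apply/setP => p; rewrite !inE orbF.
have [y ey] : exists y, t = lp y by apply: hT; rewrite mem_head.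
have hT' : perms_in T by move=> s hs; apply: hT; rewrite inE hs orbT.
have [y' es [g h]] := sift_lp y hQ.
have eT : lset (t :: T) = y |: lset T.
  by apply/setP => p; rewrite !inE ey; congr orb; apply/eqP/eqP => [/lp_inj | ->].
have gU (A B C : {set {perm 'I_N}}) : <<A>> = <<B>> -> <<A :|: C>> = <<B :|: C>>.
  by move=> e; rewrite -[LHS]/(A <*> C) -joing_idl e joing_idl.
have -> : insert N Q t = if has (fun t => key N t == key N (lp y')) Q then Q else lp y' :: Q.
  by rewrite /insert ey es iota_lp lmul_lp mulg1.
case: ifP => hk.
  have [a b ->] := IH Q hT' hQ h1; split=> //; rewrite eT.
  (* A residue whose key occurs in Q is trivial, so the discarded element already belongs to the
     generated group. *)
  have y1 : y' = 1.
    case: h => // h; case/hasP: hk => z zQ /eqP ez; have [z' ez'] := hQ _ zQ.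
    by case: (h z'); rewrite -?ez'.
  rewrite setUCA setUA; apply: gU; rewrite -g y1.
  apply/eqP; rewrite eqEsubset !gen_subG subUset sub1G subset_gen /= sub_gen //.
  exact: subsetUr.
have hQ' : perms_in (lp y' :: Q) by move=> s; rewrite inE => /orP[/eqP ->|/hQ //]; exists y'.
have [|a b ->] := IH (lp y' :: Q) hT' hQ'; first by rewrite inE h1 orbT.
split=> //; rewrite eT setUCA setUA.
have -> : lset (lp y' :: Q) = y' |: lset Q.
  by apply/setP => p; rewrite !inE; congr orb; apply/eqP/eqP => [/lp_inj | ->].
exact: gU.
Qed.

(** For D closed and containing x0, the set x0^-1 D is a group, and a group contains the translated
    list if and only if it contains its reduction. *)
Lemma gen_reduce l C : gen l C -> gen (reduce N l) C.
Proof.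
case: l => [//|x l] G; have [G1 G2 G3] := G.
have [x0 x0C ex] := G1 x (mem_head _ _).
rewrite /reduce /= ex linv_lp.
set T := lmul _ _ _ :: _.
have eT : T = [seq lmul N (lp x0^-1) t | t <- x :: l] by rewrite /T ex.
have hT : perms_in T.
  by rewrite eT => _ /mapP[t /G1 [p pC ->] ->]; exists (x0^-1 * p); rewrite lmul_lp.
have TE p : (lp p \in T) = (lp (x0 * p) \in x :: l).
  rewrite eT; apply/mapP/idP => [[t tl]|h]; last first.
    by exists (lp (x0 * p)); rewrite // lmul_lp mulKg.
  by have [q qC eq] := G1 _ tl; rewrite eq lmul_lp => /lp_inj ->; rewrite mulKVg -eq.
have [h1 h2 h3] := gens_reduce_lp hT.
have mE p : (lp p \in [seq lmul N (lp x0) t | t <- gens_reduce N T]) =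
   (lp (x0^-1 * p) \in gens_reduce N T).
  apply/mapP/idP => [[t tl]|h]; last by exists (lp (x0^-1 * p)); rewrite // lmul_lp mulKVg.
  by have [q eq] := h1 _ tl; rewrite eq lmul_lp => /lp_inj ->; rewrite mulKg -eq.
pose grp D (hD : hclosed D) (xD : x0 \in D) := Group (hclosed_group hD xD).
split=> //.
  move=> _ /mapP[t tl ->]; have [q eq] := h1 _ tl; exists (x0 * q); last by rewrite eq lmul_lp.
  have : q \in <<lset T>> by rewrite -h3 mem_gen // inE -eq.
  have : <<lset T>> \subset grp C G2 x0C.
    rewrite gen_subG; apply/subsetP => p; rewrite /= !in_set TE; exact: gen_in G.
  by move/subsetP => H /H; rewrite inE.
move=> D hD lD; have xD : x0 \in D by apply: lD; rewrite mE mulVg.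
apply: G3 => // p pl.
have : <<lset (gens_reduce N T)>> \subset grp D hD xD.
  rewrite gen_subG; apply/subsetP => q; rewrite !inE => hq; apply: lD.
  by rewrite mE mulKg.
rewrite h3 => /subsetP /(_ (x0^-1 * p)); rewrite inE mulKVg; apply.
by rewrite mem_gen // in_set TE mulKVg.
Qed.

End Lists.

(** * Transporters in an orbit *)

Section Agree.
Variables (n : nat) (c : seq nat).
Notation N := (n + n)%N.
Notation perm2 := {perm 'I_N}.
Let f (x : perm2) := fval n c (lp x).
Variables (G : {group perm2}) (C : {set perm2}) (l L F : seq (seq nat)).
Hypothesis genC : gen l C.
Hypothesis sCG : C \subset G.
(** Right multiplication by G acts on the values of f; the algorithm enumerates an orbit of this
    action. *)
Hypothesis equiv : forall x y z, x \in G -> y \in G -> z \in G ->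
  f x = f y -> f (x * z) = f (y * z).
Hypothesis valF : forall x, x \in C -> f x \in F.
Hypothesis sizeF : size F <= size L.

Let hC : hclosed C. Proof. by case: genC. Qed.

Let closed_reps (S R : seq perm2) := forall r s : perm2,
  r \in R -> s \in S -> exists2 r' : perm2, r' \in R & f r' = f (r * s).

Lemma grow_lp (S R : seq perm2) : exists2 R' : seq perm2,
  grow n c (map (@lp N) S) (map (@lp N) R) = map (@lp N) R' &
  (R' = R /\ closed_reps S R) \/
  (exists r s : perm2, [/\ r \in R, s \in S, R' = r * s :: R & f (r * s) \notin map f R]).
Proof.
rewrite /grow; set cs := [seq _ <- _ | _].
have csE y : y \in cs -> exists r s : perm2,
    [/\ r \in R, s \in S, y = lp (r * s) & f (r * s) \notin map f R].
  rewrite mem_filter => /andP[h /flattenP[_ /mapP[_ /mapP[r rR ->] ->]]].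
  case/mapP=> _ /mapP[s sS ->]; rewrite lmul_lp => ey; subst y; exists r, s; split=> //.
  apply/negP => /mapP[r' r'R e]; case/negP: h; apply/hasP; exists (lp r').
    exact: map_f.
  exact/eqP.
case E : cs => [|y cs'] /=.
  exists R => //; left; split=> // r s rR sS.
  have : lp (r * s) \in flatten [seq [seq lmul N r s | s <- map (@lp N) S] | r <- map (@lp N) R].
    apply/flattenP; exists [seq lmul N (lp r) s | s <- map (@lp N) S].
      by apply/mapP; exists (lp r) => //; apply: map_f.
    by apply/mapP; exists (lp s); rewrite ?lmul_lp //; apply: map_f.
  have : lp (r * s) \notin cs by rewrite E.
  rewrite mem_filter => /nandP[|/negP //]; rewrite negbK => /hasP[_ /mapP[r' r'R ->] /eqP e] _.
  by exists r'.
have [r [s [rR sS -> nf]]] := csE y ltac:(by rewrite E mem_head).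
by exists (r * s :: R) => //; right; exists r, s.
Qed.

(** A round either finds R closed or adds a new value to it. After as many rounds as L has elements,
    an R that kept growing takes all the values in F and is closed as well. *)
Lemma orbit_reps_lp (S : seq perm2) x0 :
  x0 \in C -> (forall x s : perm2, x \in C -> s \in S -> x * s \in C) ->
  exists R : seq perm2, [/\ orbit_reps n c L (map (@lp N) S) (lp x0) = map (@lp N) R,
    x0 \in R, {subset R <= C}, uniq (map f R) & closed_reps S R].
Proof.
move=> x0C hS; rewrite /orbit_reps.
suff H (K : seq (seq nat)) (R : seq perm2) : x0 \in R -> {subset R <= C} -> uniq (map f R) ->
   (closed_reps S R \/ size L <= size R + size K) ->
   exists R' : seq perm2, [/\
    foldl (fun R _ => grow n c (map (@lp N) S) R) (map (@lp N) R) K = map (@lp N) R',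
    x0 \in R', {subset R' <= C}, uniq (map f R') & closed_reps S R'].
  apply: (H L [:: x0]); rewrite ?mem_head //.
    by move=> x; rewrite inE => /eqP ->.
  by right; rewrite leq_addl.
elim: K R => [|k K IH] R xR RC uR hK /=.
  exists R; split=> //; case: hK => // hK r s rR sS.
  have hrs : f (r * s) \in F by apply: valF; apply: hS => //; apply: RC.
  have [] := @uniq_min_size _ (map f R) F uR.
  - by move=> _ /mapP[y yR ->]; apply: valF; apply: RC.
  - by rewrite size_map; apply: leq_trans sizeF _; rewrite addn0 in hK.
  by move=> _ /(_ (f (r * s))); rewrite hrs => /mapP[r' r'R e]; exists r'.
have [R' -> [[-> cl]|[r [s [rR sS -> nf]]]]] := grow_lp S R.
  by apply: IH => //; left.
apply: IH => /=.
- by rewrite inE xR orbT.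
- by move=> y; rewrite inE => /orP[/eqP ->|/RC //]; apply: hS => //; apply: RC.
- by rewrite nf.
case: hK => [cl|hK]; last by right; move: hK; rewrite /= addnS addSn.
by have [r' r'R e] := cl r s rR sS; case/mapP: nf; exists r'.
Qed.

Variable tgt : seq nat.
Hypothesis tgtE : tgt = [seq (n + v)%N | v <- c].

(** Schreier's lemma, transported from stabilisers in groups to the elements of a coset that have a
    given value. *)
Lemma gen_agree : gen (agree n c L l) [set x in C | f x == tgt].
Proof.
have hCt : hclosed [set x in C | f x == tgt].
  move=> x y z; rewrite !inE => /andP[xC /eqP fx] /andP[yC /eqP fy] /andP[zC /eqP fz].
  rewrite hC //= -fz -{2}(mulKVg y z) -mulgA; apply/eqP; apply: equiv; rewrite ?fx ?fy //;
  rewrite ?groupM ?groupV //; exact: (subsetP sCG).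
have [G1 _ G3] := genC; rewrite /agree; case: nilP => [l0|].
  split=> //; move=> D hD _; have /subsetP e : C \subset set0.
    by apply: G3 => [x y z|p]; rewrite ?inE // l0.
  by apply/subsetP => x; rewrite inE => /andP[/e]; rewrite inE.
case: l genC G1 G3 => // x l1 genC' G1 G3 _.
have [x0 x0C ex] := G1 x (mem_head _ _); subst x.
have [T eT] : exists T : seq perm2, lp x0 :: l1 = map (@lp N) T.
  exists (map (perm_of N) (lp x0 :: l1)); rewrite -map_comp -[LHS]map_id.
  by apply/eq_in_map => s /G1[p _ ->] /=; rewrite perm_of_lp.
have TC t : t \in T -> t \in C by move=> tT; apply: (gen_in genC'); rewrite eT map_f.
pose S := [seq x0^-1 * t | t <- T].
have eS : [seq lmul N (linv N (lp x0)) y | y <- lp x0 :: l1] = map (@lp N) S.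
  rewrite eT -!map_comp; apply: eq_map => t /=.
  by rewrite linv_lp lmul_lp.
rewrite [head [::] _]/= eS.
have hS y s : y \in C -> s \in S -> y * s \in C.
  by move=> yC /mapP[t tT ->]; rewrite mulgA; apply: hC => //; apply: TC.
have [R [-> x0R RC uR cl]] := orbit_reps_lp x0C hS.
(* Groups being finite, every element of C is x0 times a product of elements of S, without
   inverses. *)
have coset_ind (P : perm2 -> Prop) : P x0 ->
    (forall y s : perm2, y \in C -> s \in S -> P y -> P (y * s)) -> forall y, y \in C -> P y.
  move=> P0 PS y yC; pose A : {set perm2} := [set s in S].
  have : C \subset [set y | x0^-1 * y \in <<A>>].
    apply: G3 => [u v w|p pl].
      rewrite !inE => hu hv hw.
      have -> : x0^-1 * (u * v^-1 * w) = (x0^-1 * u) * (x0^-1 * v)^-1 * (x0^-1 * w).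
        by rewrite invMg invgK !mulgA mulgK.
      by apply: groupM; [apply: groupM; rewrite ?groupV; [exact: hu | exact: hv] | exact: hw].
    rewrite inE mem_gen // inE; apply/mapP; exists p => //.
    by move: pl; rewrite eT => /mapP[q qT /lp_inj ->].
  move/subsetP => /(_ y yC); rewrite inE => /gen_prodgP[k [d dA e]].
  rewrite -(mulKVg x0 y) e; clear e y yC.
  suff [] : x0 * \prod_(i < k) d i \in C /\ P (x0 * \prod_(i < k) d i) by [].
  elim: k d dA => [|k IH] d dA; first by rewrite big_ord0 mulg1.
  rewrite big_ord_recr /= mulgA; have [i|yC Py] := IH (fun i => d (widen_ord (leqnSn k) i)).
    exact: dA.
  have dS : d ord_max \in S by have := dA ord_max; rewrite inE.
  by split; [apply: hS | apply: PS].
have clC y : y \in C -> exists2 r : perm2, r \in R & f r = f y.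
  move: y; apply: coset_ind => [|y s yC sS [r rR e]]; first by exists x0.
  have [r' r'R e'] := cl r s rR sS; exists r' => //; rewrite e'.
  have sG : s \in G.
    by case/mapP: sS => t tT ->; rewrite groupM ?groupV ?(subsetP sCG) // TC.
  by apply: equiv => //; apply: (subsetP sCG) => //; apply: RC.
set zs := [seq _ <- _ | _].
have zsE r : (lp r \in zs) = (r \in R) && (f r == tgt).
  by rewrite mem_filter (mem_map (@lp_inj N)) tgtE andbC.
case E : zs => [|z zs'] /=.
  split=> // D hD _; apply/subsetP => y; rewrite inE => /andP[yC /eqP fy].
  have [r rR e] := clC y yC; have := zsE r; rewrite E rR e fy eqxx /=.
  by rewrite in_nil.
have : z \in zs by rewrite E mem_head.
rewrite {1}/zs mem_filter => /andP[_ /mapP[rs rsR ez]]; subst z.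
have := zsE rs; rewrite E mem_head rsR /= => /esym /eqP frs.
have SG s : s \in S -> s \in G.
  by case/mapP=> t tT ->; rewrite groupM ?groupV ?(subsetP sCG) // TC.
have RG r : r \in R -> r \in G by move=> rR; apply: (subsetP sCG); apply: RC.
have schE y : y \in schreier n c (map (@lp N) S) (map (@lp N) R) (lp rs) <->
   exists r s r' : perm2, [/\ r \in R, s \in S, r' \in R, f r' = f (r * s) & y = lp (r * s * r'^-1 * rs)].
  split.
    case/flattenP=> _ /mapP[_ /mapP[r rR ->] ->] /flattenP[_ /mapP[_ /mapP[s sS ->] ->]].
    case/mapP=> r'; rewrite mem_filter => /andP[/eqP fr /mapP[r2 r2R e2]] ->; subst r'.
    exists r, s, r2; split=> //; first by rewrite /f -lmul_lp.
    by rewrite linv_lp !lmul_lp.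
  case=> r [s [r' [rR sS r'R e ->]]].
  apply/flattenP; eexists; first by apply/mapP; exists (lp r); [apply: map_f | reflexivity].
  apply/flattenP; eexists; first by apply/mapP; exists (lp s); [apply: map_f | reflexivity].
  apply/mapP; exists (lp r'); last by rewrite linv_lp !lmul_lp.
  by rewrite mem_filter map_f // andbT lmul_lp; apply/eqP.
split=> //.
  move=> y; rewrite inE => /orP[/eqP -> | /schE [r [s [r' [rR sS r'R e ->]]]]].
    by exists rs => //; rewrite inE frs eqxx andbT RC.
  exists (r * s * r'^-1 * rs) => //; rewrite inE; apply/andP; split.
    by apply: hC; [apply: hS => //; apply: RC | apply: RC | apply: RC].
  rewrite -frs -{2}(mulKVg r' rs) -mulgA; apply/eqP; apply: equiv; last by [].
  - by apply: groupM; [apply: RG | apply: SG].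
  - exact: RG.
  - by apply: groupM; rewrite ?groupV; apply: RG.
move=> D hD lD; apply/subsetP => y; rewrite inE => /andP[yC /eqP fy].
have rsD : rs \in D by apply: lD; rewrite mem_head.
(* Multiplying y by s multiplies y r^-1 by a conjugate-free Schreier factor r s r'^-1 on the right,
   so membership in D propagates along the product. When y has the target value, r is rs and the
   element is y. *)
have [r [rR fr]] : exists r : perm2, [/\ r \in R, f r = f y & y * r^-1 * rs \in D].
  move: y yC {fy}; apply: coset_ind.
    by exists x0; rewrite mulgV mul1g.
  move=> y s yC sS [r [rR fr hr]]; have [r' r'R fr'] := cl r s rR sS.
  exists r'; split=> //.
    by rewrite fr'; apply: equiv => //; [apply: RG | apply: (subsetP sCG) | apply: SG].
  have -> : y * s * r'^-1 * rs = (y * r^-1 * rs) * rs^-1 * (r * s * r'^-1 * rs).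
    by rewrite !mulgA mulgK mulgKV.
  apply: hD => //; apply: lD; rewrite inE; apply/orP; right; apply/schE.
  by exists r, s, r'.
have -> : r = rs; last by rewrite mulgKV.
move: rR rsR => /(nthP x0)[i hi ei] /(nthP x0)[j hj ej].
have : nth (f x0) (map f R) i == nth (f x0) (map f R) j.
  by rewrite !(nth_map x0) // ei ej fr fy frs.
by rewrite nth_uniq ?size_map // => /eqP e; rewrite -ei -ej e.
Qed.
End Agree.

(** * Pairs of permutations on a doubled set *)

Section Embed.
Variable n : nat.
Implicit Types a b : {perm 'I_n}.

Definition emb_fun a b (i : 'I_(n + n)) : 'I_(n + n) :=
  match split i with inl j => lshift n (a j) | inr k => rshift n (b k) end.

Lemma emb_funK a b : cancel (emb_fun a b) (emb_fun a^-1 b^-1).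
Proof.
move=> i; rewrite /emb_fun -[RHS](splitK i); case: (split i) => j.
  by rewrite (unsplitK (inl (a j))) permK.
by rewrite (unsplitK (inr (b j))) permK.
Qed.

Definition emb a b : {perm 'I_(n + n)} := perm (can_inj (emb_funK a b)).

Lemma emb_l a b (i : 'I_n) : emb a b (lshift n i) = lshift n (a i).
Proof. by rewrite permE /emb_fun (unsplitK (inl i)). Qed.
Lemma emb_r a b (i : 'I_n) : emb a b (rshift n i) = rshift n (b i).
Proof. by rewrite permE /emb_fun (unsplitK (inr i)). Qed.

Lemma embP a b (p : {perm 'I_(n + n)}) : (forall i, p (lshift n i) = lshift n (a i)) ->
  (forall i, p (rshift n i) = rshift n (b i)) -> p = emb a b.
Proof.
move=> hl hr; apply/permP => i.
by rewrite -(splitK i); case: (split i) => j /=; rewrite ?hl ?hr ?emb_l ?emb_r.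
Qed.

Lemma emb_inj a b a' b' : emb a b = emb a' b' -> a = a' /\ b = b'.
Proof.
move=> e; split; apply/permP => i.
  have := congr1 (fun p : {perm 'I_(n + n)} => p (lshift n i)) e.
  by rewrite !emb_l => /lshift_inj.
have := congr1 (fun p : {perm 'I_(n + n)} => p (rshift n i)) e.
by rewrite !emb_r => /rshift_inj.
Qed.

Lemma embM a b a' b' : emb a b * emb a' b' = emb (a * a') (b * b').
Proof. by apply: embP => i; rewrite !permM ?emb_l ?emb_r. Qed.
Lemma emb1 : emb 1 1 = 1.
Proof. by apply/esym/embP => i; rewrite !perm1. Qed.
Lemma embV a b : (emb a b)^-1 = emb a^-1 b^-1.
Proof. by apply/eqP; rewrite eq_invg_mul embM !mulgV emb1. Qed.

Lemma lpair_lp a b : lpair n (lp a) (lp b) = lp (emb a b).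
Proof.
apply: lp_eq; first by rewrite size_cat size_map !size_lp.
move=> i; rewrite nth_cat size_lp.
case: (splitP i) => j ej.
  have -> : i = lshift n j by apply: val_inj; rewrite /= ej.
  by rewrite emb_l /= nth_lp.
have -> : i = rshift n j by apply: val_inj; rewrite /= ej.
rewrite emb_r /= addKn (nth_map 0%N) ?size_lp //.
by rewrite nth_lp.
Qed.

Lemma nth_lp_l a b v : v < n -> nth 0%N (lp (emb a b)) v = nth 0%N (lp a) v.
Proof. by move=> h; rewrite -lpair_lp nth_cat size_lp h. Qed.

Lemma nth_lp_r a b v : v < n -> nth 0%N (lp (emb a b)) (n + v)%N = (n + nth 0%N (lp b) v)%N.
Proof.
move=> h; rewrite -lpair_lp nth_cat size_lp ltnNge leq_addr /= addKn.
by rewrite (nth_map 0%N) ?size_lp.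
Qed.

Lemma nth_lpM a b v : v < n -> nth 0%N (lp (a * b)) v = nth 0%N (lp b) (nth 0%N (lp a) v).
Proof. by move=> h; rewrite (nth_lp (a * b) (Ordinal h)) (nth_lp a (Ordinal h)) permM nth_lp. Qed.

Lemma nth_lp_lt a v : v < n -> nth 0%N (lp a) v < n.
Proof. by move=> h; rewrite (nth_lp a (Ordinal h)). Qed.

Lemma fval_emb (c : seq nat) a b : {subset c <= gtn n} ->
  fval n c (lp (emb a b)) = [seq (n + nth 0%N (lp (a^-1 * b)) v)%N | v <- c].
Proof.
move=> hc; apply/eq_in_map => v /hc hv.
by rewrite linv_lp embV (@nth_lp_l _ _ v hv) nth_lp_r ?nth_lp_lt // (@nth_lpM _ _ v hv).
Qed.

End Embed.

(** * The product of the groups and intersections inside it *)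

Section Classes.
Variables (n : nat) (cg : classes_t).
Hypothesis Hvalid : forall cL, cL \in cg -> all (valid_perm n) cL.2.
Hypothesis Hout : forall cL s v, cL \in cg -> s \in cL.2 -> v < n -> v \notin cL.1 ->
  nth 0%N s v = v.
Hypothesis Hgrp : forall cL, cL \in cg -> group_set (perms_of n cL.2).
Hypothesis Huniq : uniq (flatten [seq x.1 | x <- cg]).
Hypothesis Hcov : flatten [seq x.1 | x <- cg] =i gtn n.
Notation perm1n := {perm 'I_n}.

Lemma perms_ofE cL (p : perm1n) : cL \in cg -> (p \in perms_of n cL.2) = (lp p \in cL.2).
Proof.
move=> /Hvalid /allP hv; rewrite inE; apply/hasP/idP => [[s sL /eqP <-]|h].
  by rewrite -valid_lp // hv.
by exists (lp p) => //; rewrite perm_of_lp.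
Qed.

Lemma class_lt cL v : cL \in cg -> v \in cL.1 -> v < n.
Proof.
by move=> h hv; rewrite -[_ < _]/(v \in gtn n) -Hcov; apply/flattenP; exists cL.1 => //; apply: map_f.
Qed.

Lemma class_disj cL cL' v : cL \in cg -> cL' \in cg -> v \in cL.1 -> v \in cL'.1 -> cL = cL'.
Proof.
elim: (cg) Huniq => //= d D IH; rewrite cat_uniq => /and3P[_ /hasPn hd uD].
have hD e : e \in D -> v \in e.1 -> v \in flatten [seq x.1 | x <- D].
  by move=> eD ve; apply/flattenP; exists e.1 => //; apply: map_f.
rewrite !inE => /orP[/eqP ->|h] /orP[/eqP ->|h'] v1 v2 //; last exact: IH.
  by have := hd _ (hD _ h' v2); rewrite /= v1.
by have := hd _ (hD _ h v1); rewrite /= v2.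
Qed.

Lemma gen_out cL (g : perm1n) (v : 'I_n) : cL \in cg -> g \in perms_of n cL.2 ->
  val v \notin cL.1 -> g v = v.
Proof.
move=> h; rewrite perms_ofE // => gL hv; apply: val_inj; rewrite /= -nth_lp.
exact: Hout h gL (ltn_ord v) hv.
Qed.

Lemma gen_pres cL (g : perm1n) (v : 'I_n) : cL \in cg -> g \in perms_of n cL.2 ->
  (val (g v) \in cL.1) = (val v \in cL.1).
Proof.
move=> h gG; apply/idP/idP => hv; apply: contraLR hv => nv.
  by rewrite (gen_out h gG).
by have e := perm_inj (gen_out h gG nv); rewrite e in nv.
Qed.

(* The internal product of the groups of the classes (see [local_gen]). *)
Definition local_prod : {set perm1n} := [set p : perm1n |
  all (fun cL => [exists g in perms_of n cL.2, [forall v : 'I_n, (val v \in cL.1) ==> (p v == g v)]]) cg].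

Lemma local_prodP (p : perm1n) : reflect (forall cL, cL \in cg ->
  exists2 g, g \in perms_of n cL.2 & forall v : 'I_n, val v \in cL.1 -> p v = g v)
  (p \in local_prod).
Proof.
rewrite inE; apply: (iffP allP) => H cL h.
  have /exists_inP[g gG /forallP hg] := H cL h.
  by exists g => // v hv; apply/eqP; have := hg v; rewrite hv.
have [g gG hg] := H cL h; apply/exists_inP; exists g => //.
by apply/forallP => v; apply/implyP => hv; rewrite hg.
Qed.

Lemma local_pres (p : perm1n) cL (v : 'I_n) : p \in local_prod -> cL \in cg ->
  (val (p v) \in cL.1) = (val v \in cL.1).
Proof.
move=> /local_prodP hp h.
have Hin (q : 'I_n) d : d \in cg -> val q \in d.1 -> val (p q) \in d.1.
  by move=> hd hq; have [g gG ->] := hp d hd; rewrite // gen_pres.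
apply/idP/idP => hv; last exact: Hin.
have : val v \in flatten [seq x.1 | x <- cg] by rewrite Hcov; apply: ltn_ord.
case/flattenP => _ /mapP[d dcg ->] vd.
by have := class_disj h dcg hv (Hin v d dcg vd) => ->.
Qed.

Lemma local_group : group_set local_prod.
Proof.
apply/group_setP; split.
  apply/local_prodP => cL h; exists 1 => //.
  by have /group_setP[] := Hgrp h.
move=> p q pP qP; apply/local_prodP => cL h.
have [g gG hg] := local_prodP _ pP cL h; have [g' gG' hg'] := local_prodP _ qP cL h.
exists (g * g'); first by have /group_setP[_ ->] := Hgrp h.
move=> v hv; rewrite !permM hg // hg' //.
by rewrite gen_pres.
Qed.
Canonical local_prod_group := Group local_group.

Lemma class_local cL (g : perm1n) : cL \in cg -> g \in perms_of n cL.2 -> g \in local_prod.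
Proof.
move=> h gG; apply/local_prodP => d hd; have [e|ne] := eqVneq d cL.
  by exists g; rewrite ?e.
exists 1; first by have /group_setP[] := Hgrp hd.
move=> v vd; rewrite perm1; apply: (gen_out h gG); apply/negP => vc.
by case/eqP: ne; apply: class_disj hd h vd vc.
Qed.

(** A member of the product is peeled class by class: dividing it by its component on the first
    class leaves a member that fixes this class. *)
Lemma local_gen : local_prod = <<\bigcup_(cL <- cg) perms_of n cL.2>>.
Proof.
apply/eqP; rewrite eqEsubset; apply/andP; split; last first.
  rewrite gen_subG; apply/subsetP => g.
  have H D : {subset D <= cg} -> g \in \bigcup_(cL <- D) perms_of n cL.2 -> g \in local_prod.
    elim: D => [|d D IH] hD; first by rewrite big_nil inE.
    rewrite big_cons inE => /orP[|]; first by apply: class_local; apply: hD; rewrite mem_head.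
    by apply: IH => e he; apply: hD; rewrite inE he orbT.
  exact: H.
apply/subsetP => p.
have H D : {subset D <= cg} -> forall p, p \in local_prod ->
   (forall v : 'I_n, val v \notin flatten [seq x.1 | x <- D] -> p v = v) ->
   p \in <<\bigcup_(cL <- D) perms_of n cL.2>>.
  elim: D => [|d D IH] hD q qP hq.
    have -> : q = 1 by apply/permP => v; rewrite perm1 hq.
    exact: group1.
  have dcg : d \in cg by apply: hD; rewrite mem_head.
  have [g gG hg] := local_prodP _ qP d dcg.
  have gP := class_local dcg gG.
  rewrite big_cons -(mulKVg g q); apply: groupM; first by rewrite mem_gen // inE gG.
  apply: (subsetP (genS (subsetUr _ _))); apply: IH.
  - by move=> e he; apply: hD; rewrite inE he orbT.
  - by rewrite groupM ?groupV.
  move=> v hv; rewrite permM.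
  have [vd|vd] := boolP (val v \in d.1).
    by rewrite hg ?permKV //; rewrite -(gen_pres _ dcg gG) permKV.
  have -> : g^-1 v = v by apply: (@perm_inj _ g); rewrite permKV (gen_out dcg gG).
  by apply: hq; rewrite /= mem_cat negb_or vd.
move=> pP; apply: H => // v; rewrite Hcov => /negP; case; exact: ltn_ord.
Qed.

(** As b b^-1 b = b, a slice of a closed set at fixed b is closed, so the product is reached one
    coordinate at a time. *)
Lemma gen_pair T1 T2 (A B : {set perm1n}) : gen T1 A -> gen T2 B ->
  gen (flatten [seq [seq lpair n a b | b <- T2] | a <- T1]) [set emb x.1 x.2 | x in setX A B].
Proof.
move=> [A1 A2 A3] [B1 B2 B3].
have memE (a b : perm1n) (D : {set perm1n}) (E : {set perm1n}) :
   (emb a b \in [set emb x.1 x.2 | x in setX D E]) = (a \in D) && (b \in E).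
  apply/imsetP/andP => [[[a' b'] /setXP[aD bE] /= /emb_inj[-> ->]]|[aD bE]] //.
  by exists (a, b) => //; apply/setXP.
split.
- move=> _ /flattenP[_ /mapP[_ /A1[a aA ->] ->] /mapP[_ /B1[b bB ->] ->]].
  by exists (emb a b); rewrite ?lpair_lp // memE aA bB.
- move=> _ _ _ /imsetP[[a b] /setXP[aA bB] ->] /imsetP[[a' b'] /setXP[aA' bB'] ->]
    /imsetP[[a2 b2] /setXP[aA2 bB2] ->] /=.
  by rewrite embV !embM memE A2 // B2.
move=> D hD lD; apply/subsetP => _ /imsetP[[a b] /setXP[/= aA bB] ->].
have hD1 (b0 : perm1n) : hclosed [set a0 : perm1n | emb a0 b0 \in D].
  move=> x y z; rewrite !inE => hx hy hz.
  by have := hD _ _ _ hx hy hz; rewrite embV !embM mulgV mul1g.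
have hD2 (a0 : perm1n) : hclosed [set b0 : perm1n | emb a0 b0 \in D].
  move=> x y z; rewrite !inE => hx hy hz.
  by have := hD _ _ _ hx hy hz; rewrite embV !embM mulgV mul1g.
suff H : B \subset [set b0 : perm1n | emb a b0 \in D] by have := subsetP H b bB; rewrite inE.
apply: (B3 _ (hD2 a)) => b0 hb0; rewrite inE.
suff H : A \subset [set a0 : perm1n | emb a0 b0 \in D] by have := subsetP H a aA; rewrite inE.
apply: (A3 _ (hD1 b0)) => a0 ha0; rewrite inE.
apply: lD; apply/flattenP; exists [seq lpair n (lp a0) x | x <- T2].
  by apply/mapP; exists (lp a0).
by apply/mapP; exists (lp b0); rewrite ?lpair_lp.
Qed.

Definition local_pairs : {set {perm 'I_(n + n)}} :=
  [set emb x.1 x.2 | x in setX local_prod local_prod].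

Lemma local_pairsP x : reflect (exists a b, [/\ a \in local_prod, b \in local_prod & x = emb a b])
  (x \in local_pairs).
Proof.
apply: (iffP imsetP) => [[[a b] /setXP[aA bB] ->]|[a [b [aA bB ->]]]]; first by exists a, b.
by exists (a, b) => //; apply/setXP.
Qed.

Lemma local_pairs_group : group_set local_pairs.
Proof.
apply/group_setP; split.
  by apply/local_pairsP; exists 1, 1; rewrite emb1 group1.
move=> _ _ /local_pairsP[a [b [aA bB ->]]] /local_pairsP[a' [b' [aA' bB' ->]]].
by apply/local_pairsP; exists (a * a'), (b * b'); rewrite embM !groupM.
Qed.
Canonical local_pairs_groupG := Group local_pairs_group.

Definition agrees (x : {perm 'I_(n + n)}) (c : seq nat) :=
  fval n c (lp x) == [seq (n + v)%N | v <- c].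

(** On the class, a^-1 b coincides with an element of the listed group, so there are no more values
    than listed elements. Right multiplication by (s, t) turns it into s^-1 a^-1 b t, which on the
    class depends only on the values there because s preserves the class. *)
Lemma gen_agree_class cL T C : cL \in cg -> gen T C -> C \subset local_pairs ->
  gen (agree n cL.1 cL.2 T) [set x in C | agrees x cL.1].
Proof.
move=> h gT sC.
have hc : {subset cL.1 <= gtn n} by move=> v hv; apply: class_lt h hv.
pose F := [seq [seq (n + nth 0%N s v)%N | v <- cL.1] | s <- cL.2].
apply: (@gen_agree n cL.1 local_pairs_groupG C T cL.2 F gT sC) => //.
- move=> _ _ _ /local_pairsP[a [b [aP bP ->]]] /local_pairsP[a' [b' [aP' bP' ->]]]
    /local_pairsP[s [t [sP tP ->]]]; rewrite !embM !fval_emb // => e.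
  have {}e v : v \in cL.1 -> nth 0%N (lp (a^-1 * b)) v = nth 0%N (lp (a'^-1 * b')) v.
    by move=> hv; have /eq_in_map /(_ v hv) /addnI := e.
  apply/eq_in_map => v hv; congr addn.
  have vn := hc v hv.
  have Ex (x y : perm1n) : (x * s)^-1 * (y * t) = s^-1 * ((x^-1 * y) * t).
    by rewrite invMg !mulgA.
  rewrite !Ex !(@nth_lpM _ _ _ v vn).
  have vn' : nth 0%N (lp s^-1) v < n by apply: nth_lp_lt.
  rewrite !(@nth_lpM _ (_ * _) _ _ vn') e //.
  rewrite (nth_lp s^-1 (Ordinal vn)).
  by rewrite (@local_pres s^-1) ?groupV.
- move=> x /(subsetP sC) /local_pairsP[a [b [aP bP ->]]].
  have abP : a^-1 * b \in local_prod by rewrite groupM ?groupV.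
  have [g gG hg] := local_prodP _ abP cL h.
  rewrite fval_emb //; apply/mapP; exists (lp g); first by rewrite -perms_ofE.
  apply/eq_in_map => v hv; congr addn; have vn := hc v hv.
  by rewrite !(nth_lp _ (Ordinal vn)) hg.
- by rewrite size_map.
Qed.

Lemma gen_agree_all D T C : {subset D <= cg} -> gen T C -> C \subset local_pairs ->
  gen (foldl (fun T c => reduce (n + n) (agree n c.1 c.2 T)) T D)
    [set x in C | all (fun c : seq nat * seq (seq nat) => agrees x c.1) D].
Proof.
elim: D T C => [|d D IH] T C hD gT sC /=.
  have -> // : [set x in C | true] = C by apply/setP => x; rewrite inE andbT.
have dcg : d \in cg by apply: hD; rewrite mem_head.
have g1 := gen_reduce (gen_agree_class dcg gT sC).
have -> : [set x in C | agrees x d.1 && all (fun c : seq nat * seq (seq nat) => agrees x c.1) D]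
   = [set x in [set x in C | agrees x d.1] | all (fun c : seq nat * seq (seq nat) => agrees x c.1) D].
  by apply/setP => x; rewrite !inE andbA.
apply: IH g1 _; first by move=> e he; apply: hD; rewrite inE he orbT.
by apply: subset_trans sC; apply/subsetP => x; rewrite inE => /andP[].
Qed.

Lemma agrees_emb (a b : perm1n) :
  all (fun c : seq nat * seq (seq nat) => agrees (emb a b) c.1) cg = (a == b).
Proof.
apply/idP/eqP => [/allP H|->]; last first.
  apply/allP => d dcg; have hc : {subset d.1 <= gtn n} by move=> v hv; apply: class_lt dcg hv.
  rewrite /agrees fval_emb // mulVg; apply/eqP/eq_in_map => v hv.
  by rewrite (nth_lp 1 (Ordinal (hc v hv))) perm1.
suff e : a^-1 * b = 1 by rewrite -(mulKVg a b) e mulg1.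
apply/permP => v; rewrite perm1; apply: val_inj; rewrite /= -nth_lp.
have : val v \in flatten [seq x.1 | x <- cg] by rewrite Hcov; apply: ltn_ord.
case/flattenP => _ /mapP[d dcg ->] vd.
have hc : {subset d.1 <= gtn n} by move=> w hw; apply: class_lt dcg hw.
have := H d dcg; rewrite /agrees fval_emb // => /eqP /eq_in_map /(_ _ vd).
exact: addnI.
Qed.

(** The pairs that agree on all classes form the diagonal of the intersection, on which the
    projection to the first half is injective. *)
Lemma gen_meet2 T1 T2 (A B : {set perm1n}) : gen T1 A -> gen T2 B ->
  A \subset local_prod -> B \subset local_prod -> gen (meet2 n cg T1 T2) (A :&: B).
Proof.
move=> gA gB sA sB; rewrite /meet2; apply: gen_reduce.
set U := foldl _ _ _.
have gU : gen U [set emb a a | a in A :&: B].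
  have := gen_agree_all (fun _ => id) (gen_pair gA gB) _.
  set C := [set emb x.1 x.2 | x in setX A B].
  have -> : [set x in C | all (fun c : seq nat * seq (seq nat) => agrees x c.1) cg] =
     [set emb a a | a in A :&: B].
    apply/setP => x; rewrite inE; apply/andP/imsetP.
      case=> /imsetP[[a b] /setXP[/= aA bB] ->]; rewrite agrees_emb => /eqP e; subst b.
      by exists a => //; apply/setIP.
    case=> a /setIP[aA aB] ->; rewrite agrees_emb eqxx; split=> //.
    by apply/imsetP; exists (a, a) => //; apply/setXP.
  apply; apply/subsetP => _ /imsetP[[a b] /setXP[/= aA bB] ->].
  by apply/local_pairsP; exists a, b; rewrite (subsetP sA) ?(subsetP sB).
have prE (a b : perm1n) : [seq nth 0%N (lp (emb a b)) i | i <- iota 0 n] = lp a.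
  apply: lp_eq; rewrite ?size_map ?size_iota // => i.
  by rewrite (nth_map 0%N) ?size_iota // nth_iota // add0n nth_lp_l // nth_lp.
have [U1 U2 U3] := gU.
have [[_ A2 _] [_ B2 _]] := (gA, gB).
split.
- move=> _ /mapP[_ /U1[_ /imsetP[a aI ->] ->] ->]; exists a => //.
- move=> x y z /setIP[xA xB] /setIP[yA yB] /setIP[zA zB].
  by apply/setIP; split; [apply: A2 | apply: B2].
move=> D hD lD; apply/subsetP => a aI.
have hD2 : hclosed [set emb d d | d in D].
  move=> _ _ _ /imsetP[d1 dD1 ->] /imsetP[d2 dD2 ->] /imsetP[d3 dD3 ->].
  by rewrite embV !embM; apply: imset_f; apply: hD.
have H : [set emb a a | a in A :&: B] \subset [set emb d d | d in D]; last first.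
  have /imsetP[d dD /emb_inj[-> _] //] : emb a a \in [set emb d d | d in D].
  by apply: (subsetP H); apply: imset_f.
apply: (U3 _ hD2) => p pU; have [_ /imsetP[d dI ->] e] := U1 _ pU; rewrite (lp_inj e).
apply: imset_f; apply: lD; apply/mapP; exists (lp p) => //.
by rewrite e prE.
Qed.

(** The empty family is excluded: its intersection would be the whole symmetric group, while [meet]
    returns the empty list. *)
Lemma gen_meet (C : seq nat * (seq nat * seq (seq nat)) -> {set perm1n}) (ts : table_t) :
  ~~ nilp ts -> (forall t, t \in ts -> gen t.2.2 (C t) /\ C t \subset local_prod) ->
  gen (meet n cg [seq t.2.2 | t <- ts]) [set p | all (fun t => p \in C t) ts].
Proof.
case: ts => // t0 ts _ H; rewrite /meet /=.
suff K (U : table_t) T A : gen T A -> A \subset local_prod ->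
    (forall t, t \in U -> gen t.2.2 (C t) /\ C t \subset local_prod) ->
    gen (foldl (meet2 n cg) T [seq t.2.2 | t <- U]) [set p in A | all (fun t => p \in C t) U].
  have [g0 s0] := H t0 (mem_head _ _).
  by apply: K g0 s0 _ => t ht; apply: H; rewrite inE ht orbT.
elim: U T A => [|t U IH] T A gA sA hU /=.
  by have -> // : [set p in A | true] = A by apply/setP => x; rewrite inE andbT.
have [gt st] := hU t (mem_head _ _).
have -> : [set p in A | (p \in C t) && all (fun t => p \in C t) U] =
    [set p in A :&: C t | all (fun t => p \in C t) U].
  by apply/setP => x; rewrite !inE andbA.
apply: IH; first exact: gen_meet2.
  by apply: subset_trans sA; apply: subsetIl.
by move=> u hu; apply: hU; rewrite inE hu orbT.
Qed.

(** * Isomorphisms between sub-hypergraphs *)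

(** For a union W of classes, this is the product of the groups of the other classes. *)
Definition fixes (W : seq nat) : {set perm1n} :=
  [set p in local_prod | [forall v : 'I_n, (val v \in W) ==> (p v == v)]].

Lemma fixesP (W : seq nat) (p : perm1n) :
  reflect (p \in local_prod /\ forall v : 'I_n, val v \in W -> p v = v)
  (p \in fixes W).
Proof.
rewrite [p \in fixes W]in_set; apply: (iffP andP) => [[-> /forallP H]|[-> H]]; split=> //.
  by move=> v hv; apply/eqP; have := H v; rewrite hv.
by apply/forallP => v; apply/implyP => /H ->.
Qed.

Lemma fixes_group W : group_set (fixes W).
Proof.
apply/group_setP; split; first by apply/fixesP; split=> [|v _]; rewrite ?perm1.
move=> p q /fixesP[pP hp] /fixesP[qP hq]; apply/fixesP; split; first exact: groupM.
by move=> v hv; rewrite permM hp // hq.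
Qed.
Canonical fixes_groupG W := Group (fixes_group W).

Lemma fixes_out (W : seq nat) (p : perm1n) (v : 'I_n) :
  p \in fixes W -> val v \notin W -> val (p v) \notin W.
Proof.
case/fixesP=> _ hp; apply: contra => hv; have /perm_inj e := hp _ hv; by rewrite -e.
Qed.

Definition maps (W : seq nat) (h : perm1n) (e f : seq nat) :=
  [forall v : 'I_n, (val v \notin W) ==> ((val v \in e) == (val (h v) \in f))].

Lemma mapsP (W : seq nat) (h : perm1n) (e f : seq nat) :
  reflect (forall v : 'I_n, val v \notin W -> (val v \in e) = (val (h v) \in f))
  (maps W h e f).
Proof.
apply: (iffP forallP) => H v; last by apply/implyP => /H ->.
by move=> hv; apply/eqP; have := H v; rewrite hv.
Qed.

Lemma sameP (W e f : seq nat) : reflect {in W, e =i f} (same W e f).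
Proof. by apply: (iffP allP) => H v /H /eqP. Qed.

Lemma sendsP (c : seq nat) (g : perm1n) (e f : seq nat) : {subset c <= gtn n} ->
  reflect (forall v : 'I_n, val v \in c -> (val v \in e) = (val (g v) \in f)) (sends c (lp g) e f).
Proof.
move=> hc; apply: (iffP allP) => H v hv; first by have /eqP := H _ hv; rewrite nth_lp.
have hv' : v < n := hc v hv.
by rewrite (nth_lp g (Ordinal hv')) -(H (Ordinal hv')).
Qed.

Variable E : seq (seq nat).

(* The isomorphisms from the sub-hypergraph of the edges that coincide with [e] on [W]
   to that of the edges that coincide with [f] on [W], both restricted to the complement of [W]. *)
Definition isos (W e f : seq nat) : {set perm1n} := [set h in fixes W |
  all (fun e' => same W e' e ==> has (fun f' => same W f' f && maps W h e' f') E) E &&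
  all (fun f' => same W f' f ==> has (fun e' => same W e' e && maps W h e' f') E) E].

Definition iso_fwd (W e f : seq nat) (h : perm1n) := forall e', e' \in E -> same W e' e ->
  exists f', [/\ f' \in E, same W f' f & maps W h e' f'].
Definition iso_bwd (W e f : seq nat) (h : perm1n) := forall f', f' \in E -> same W f' f ->
  exists e', [/\ e' \in E, same W e' e & maps W h e' f'].

Lemma isosP (W e f : seq nat) (h : perm1n) :
  reflect [/\ h \in fixes W, iso_fwd W e f h & iso_bwd W e f h] (h \in isos W e f).
Proof.
rewrite [h \in isos W e f]in_set; apply: (iffP and3P) => [[-> /allP H1 /allP H2]|[-> H1 H2]];
  split=> //.
- move=> e' eE s; have /implyP /(_ s) /hasP[f' fE /andP[]] := H1 e' eE; by exists f'.
- move=> f' fE s; have /implyP /(_ s) /hasP[e' eE /andP[]] := H2 f' fE; by exists e'.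
- apply/allP => e' eE; apply/implyP => s; have [f' [fE s' m]] := H1 e' eE s.
  by apply/hasP; exists f' => //; rewrite s'.
- apply/allP => f' fE; apply/implyP => s; have [e' [eE s' m]] := H2 f' fE s.
  by apply/hasP; exists e' => //; rewrite s'.
Qed.

Lemma maps_mul (W : seq nat) (x y z : perm1n) (e f e' f' : seq nat) :
  x \in fixes W -> y \in fixes W ->
  maps W x e f -> maps W y e' f -> maps W z e' f' -> maps W (x * y^-1 * z) e f'.
Proof.
move=> xF yF /mapsP hx /mapsP hy /mapsP hz; apply/mapsP => v hv.
rewrite !permM hx // -{1}(permKV y (x v)).
have hu : val (y^-1 (x v)) \notin W.
  by apply: fixes_out; rewrite ?groupV //; apply: fixes_out.
by rewrite -hy // hz.
Qed.

Lemma hclosed_isos W e f : hclosed (isos W e f).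
Proof.
move=> x y z /isosP[xF x1 x2] /isosP[yF y1 y2] /isosP[zF z1 z2]; apply/isosP; split.
- by rewrite !groupM ?groupV.
- move=> e' eE s; have [f1 [fE s1 m1]] := x1 e' eE s.
  have [e2 [eE2 s2 m2]] := y2 f1 fE s1; have [f3 [fE3 s3 m3]] := z1 e2 eE2 s2.
  by exists f3; split=> //; apply: maps_mul m1 m2 m3.
- move=> f' fE s; have [e1 [eE s1 m1]] := z2 f' fE s.
  have [f2 [fE2 s2 m2]] := y1 e1 eE s1; have [e3 [eE3 s3 m3]] := x2 f2 fE2 s2.
  by exists e3; split=> //; apply: maps_mul m3 m2 m1.
Qed.

Definition table_ok (W : seq nat) (M : table_t) :=
  (forall t, t \in M -> [/\ t.1 \in E, t.2.1 \in E & gen t.2.2 (isos W t.1 t.2.1)]) /\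
  (forall e f, e \in E -> f \in E -> exists T, (e, (f, T)) \in M).

Lemma same_refl W e : same W e e. Proof. exact/sameP. Qed.

Section Entry.
Variables (W : seq nat) (c : seq nat * seq (seq nat)).
Hypothesis ccg : c \in cg.
Hypothesis cW : forall v, v \in c.1 -> v \notin W.
Let W' := c.1 ++ W.
Let hc : {subset c.1 <= gtn n}. Proof. by move=> v; apply: class_lt. Qed.

Lemma same_cat (e f : seq nat) : same W' e f -> same W e f /\ {in c.1, e =i f}.
Proof.
by move/sameP => H; split; [apply/sameP|] => v hv; apply: H; rewrite mem_cat hv ?orbT.
Qed.

Lemma same_trans (V e f g : seq nat) : same V e f -> same V f g -> same V e g.
Proof. by move=> /sameP h1 /sameP h2; apply/sameP => v hv; rewrite h1 ?h2. Qed.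
Lemma maps_glue (g p : perm1n) (e f : seq nat) : g \in perms_of n c.2 -> p \in fixes W' ->
  (forall v : 'I_n, val v \in c.1 -> (val v \in e) = (val (g v) \in f)) -> maps W' p e f ->
  maps W (g * p) e f.
Proof.
move=> gG /fixesP[_ pF] hg /mapsP hp; apply/mapsP => v hv; rewrite permM.
have [vc|vc] := boolP (val v \in c.1).
  by rewrite pF ?hg // mem_cat (gen_pres _ ccg gG) vc.
by rewrite (gen_out ccg gG vc) hp // mem_cat negb_or vc.
Qed.

(** Compatibility matches e' with some f' on the class. As p is an isomorphism for the pair (e',
    f'), it matches e' outside W' with an edge that agrees with f' on W', and g p sends e' to that
    edge outside W. *)
Lemma isos_glue (g p : perm1n) (e f : seq nat) : g \in perms_of n c.2 ->
  compatible E W c.1 (lp g) e f ->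
  (forall e' f', e' \in E -> f' \in E -> same W e' e -> same W f' f -> sends c.1 (lp g) e' f' ->
    p \in isos W' e' f') -> p \in fixes W' ->
  g * p \in isos W e f.
Proof.
move=> gG /andP[/allP k1 /allP k2] H pF.
have gP := class_local ccg gG.
apply/isosP; split.
- case/fixesP: pF => pP pF; apply/fixesP; split; first exact: groupM.
  move=> v hv; have vc : val v \notin c.1 by apply/negP => /cW; rewrite hv.
  by rewrite permM (gen_out ccg gG vc) pF // mem_cat hv orbT.
- move=> e' eE s; have /implyP /(_ s) /hasP[f' fE /andP[s' sd]] := k1 e' eE.
  have /isosP[_ q1 _] := H e' f' eE fE s s' sd.
  have [f2 [fE2 s2 m2]] := q1 e' eE (same_refl _ _).
  have [s3 s4] := same_cat s2.
  exists f2; split=> //; first exact: same_trans s3 s'.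
  apply: maps_glue => // v hv; have /sendsP /(_ v hv) -> // := sd.
  by rewrite s4 // (gen_pres _ ccg gG).
- move=> f' fE s; have /implyP /(_ s) /hasP[e' eE /andP[s' sd]] := k2 f' fE.
  have /isosP[_ _ q1] := H e' f' eE fE s' s sd.
  have [e2 [eE2 s2 m2]] := q1 f' fE (same_refl _ _).
  have [s3 s4] := same_cat s2.
  exists e2; split=> //; first exact: same_trans s3 s'.
  apply: maps_glue => // v hv; have /sendsP /(_ v hv) <- // := sd.
  by rewrite s4.
Qed.

(** g is the component of h on the class. If e' is matched with f', the h-image of an edge that
    agrees with e' on W' agrees with f' on W', because h acts on the class as g. *)
Lemma isos_split (h : perm1n) (e f : seq nat) : h \in isos W e f ->
  exists g, [/\ g \in perms_of n c.2,
  compatible E W c.1 (lp g) e f, g^-1 * h \in fixes W' &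
  forall e' f', same W e' e -> same W f' f -> sends c.1 (lp g) e' f' ->
    g^-1 * h \in isos W' e' f'].
Proof.
case/isosP=> hF q1 q2; have /fixesP[hP hW] := hF.
have [g gG hg] := local_prodP _ hP c ccg.
have gP := class_local ccg gG.
have hsend e' f' : maps W h e' f' -> sends c.1 (lp g) e' f'.
  by move=> /mapsP m; apply/sendsP => // v hv; rewrite m ?cW // hg.
have gV (v : 'I_n) : val v \in c.1 -> val (g^-1 v) \in c.1.
  by move=> vc; rewrite -(gen_pres _ ccg gG) permKV.
have gO (v : 'I_n) : val v \notin c.1 -> g^-1 v = v.
  by move=> vc; apply: (@perm_inj _ g); rewrite permKV (gen_out ccg gG).
have hF' : g^-1 * h \in fixes W'.
  apply/fixesP; split; first by rewrite groupM ?groupV.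
  move=> v; rewrite permM mem_cat; have [vc _|vc /= vW] := boolP (val v \in c.1).
    by rewrite hg ?gV // permKV.
  by rewrite gO // hW.
exists g; split=> //.
  apply/andP; split; apply/allP => e' eE; apply/implyP => s.
    have [f' [fE s' m]] := q1 e' eE s; apply/hasP; exists f' => //.
    by rewrite s' hsend.
  have [f' [fE s' m]] := q2 e' eE s; apply/hasP; exists f' => //.
  by rewrite s' hsend.
have mW e' f' : maps W h e' f' -> maps W' (g^-1 * h) e' f'.
  move=> /mapsP m; apply/mapsP => v; rewrite mem_cat negb_or => /andP[vc vW].
  by rewrite permM gO // m.
move=> e' f' se sf /sendsP sd; apply/isosP; split=> //.
- move=> e2 eE2 /same_cat[s3 s4].
  have [f2 [fE2 s2 m]] := q1 e2 eE2 (same_trans s3 se).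
  exists f2; split=> //; last exact: mW.
  apply/sameP => u; rewrite mem_cat => /orP[uc|uW].
    have un : u < n := hc uc; pose v := g^-1 (Ordinal un).
    have vc : val v \in c.1 by apply: gV.
    have gv : g v = Ordinal un by rewrite permKV.
    have := sd hc v vc; have /mapsP /(_ v (cW vc)) := m; rewrite hg // gv /= s4 //.
    by move=> -> ->.
  by have /sameP := s2; have /sameP a := sf => b; rewrite b // a.
- move=> f2 fE2 /same_cat[s3 s4].
  have [e2 [eE2 s2 m]] := q2 f2 fE2 (same_trans s3 sf).
  exists e2; split=> //; last exact: mW.
  apply/sameP => u; rewrite mem_cat => /orP[uc|uW].
    have un : u < n := hc uc.
    have /mapsP /(_ (Ordinal un) (cW uc)) := m; rewrite /= => ->.
    rewrite hg // s4 ?(gen_pres _ ccg gG) //.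
    by rewrite -(sd hc (Ordinal un)).
  by have /sameP := s2; have /sameP a := se => b; rewrite b // a.
Qed.

(** The isomorphisms are the union of the translates by [isos_glue] and [isos_split]. Since this
    union is closed, the concatenated lists generate nothing beyond it. *)
Lemma gen_entry M e f : table_ok W' M -> e \in E -> f \in E ->
  gen (entry n E cg W c M e f) (isos W e f).
Proof.
move=> [M1 M2] eE fE; rewrite /entry; apply: gen_reduce.
have genL s : s \in c.2 -> exists2 g : perm1n, g \in perms_of n c.2 & s = lp g.
  move=> sL; have vs := allP (Hvalid ccg) s sL; exists (perm_of n s); last exact: valid_lp.
  by rewrite perms_ofE // -valid_lp.
pose ts s := [seq t <- M | same W t.1 e && same W t.2.1 f && sends c.1 s t.1 t.2.1].
have gmeet s : compatible E W c.1 s e f ->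
   gen (meet n cg [seq t.2.2 | t <- ts s]) [set p | all (fun t => p \in isos W' t.1 t.2.1) (ts s)].
  move=> /andP[/allP k1 _]; apply: (gen_meet (C := fun t => isos W' t.1 t.2.1)).
    (* e agrees with itself, so compatibility yields a matched pair and the family to intersect is
       not empty. *)
    have /implyP /(_ (same_refl _ _)) /hasP[f' fE' /andP[s' sd]] := k1 e eE.
    have [T hT] := M2 e f' eE fE'.
    have : (e, (f', T)) \in ts s by rewrite mem_filter hT /= same_refl s' sd.
    by case: (ts s).
  move=> t; rewrite mem_filter => /andP[_ /M1[_ _ g]]; split=> //.
  by apply/subsetP => h /isosP[/fixesP[]].
have pieceP s : compatible E W c.1 s e f -> exists2 t, t \in ts s & (t.1 \in E) && (t.2.1 \in E).
  move=> /andP[/allP k1 _].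
  have /implyP /(_ (same_refl _ _)) /hasP[f' fE' /andP[s' sd]] := k1 e eE.
  have [T hT] := M2 e f' eE fE'; exists (e, (f', T)); rewrite /= ?eE //.
  by rewrite mem_filter hT /= same_refl s' sd.
split.
- move=> y /flattenP[_ /mapP[s sL ->]]; have [g gG es] := genL s sL; subst s.
  case: ifP => // k.
  have [G1 _ _] := gmeet _ k.
  case/mapP=> u /G1[p]; rewrite inE => /allP hp -> ->; exists (g * p); last exact: lmul_lp.
  apply: isos_glue => // [e' f' eE' fE' se sf sd|].
    have [T hT] := M2 e' f' eE' fE'; apply: (hp (e', (f', T))).
    by rewrite mem_filter hT /= se sf sd.
  by have [t tt _] := pieceP _ k; have /isosP[] := hp t tt.
- exact: hclosed_isos.
move=> D hD lD; apply/subsetP => h /isos_split[g [gG k hF H]].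
have [_ _ G3] := gmeet _ k.
(* Left translates of closed sets are closed, which reduces the inclusion to the generators of one
   intersection. *)
pose D' := [set p : perm1n | g * p \in D].
have hD' : hclosed D'.
  move=> x y z; rewrite !inE => hx hy hz.
  by have := hD _ _ _ hx hy hz; rewrite invMg !mulgA mulgKV.
have sD : [set p | all (fun t => p \in isos W' t.1 t.2.1) (ts (lp g))] \subset D'.
  apply: (G3 D' hD') => p hp; rewrite inE; apply: lD; apply/flattenP.
  exists [seq lmul n (lp g) h | h <- meet n cg [seq t.2.2 | t <- ts (lp g)]].
    by apply/mapP; exists (lp g); rewrite ?k // -perms_ofE.
  by apply/mapP; exists (lp p); rewrite ?lmul_lp.
have : g^-1 * h \in D'; last by rewrite inE mulKVg.
apply: (subsetP sD); rewrite inE.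
apply/allP => t; rewrite mem_filter => /andP[/andP[/andP[se sf] sd] _].
exact: H.
Qed.

End Entry.

Lemma level_ok W c M : c \in cg -> (forall v, v \in c.1 -> v \notin W) ->
  table_ok (c.1 ++ W) M -> table_ok W (level n E cg W c M).
Proof.
move=> ccg cW okM; split.
  move=> _ /flattenP[_ /mapP[e eE ->] /mapP[f fE ->]] /=; split=> //.
  exact: gen_entry.
move=> e f eE fE; exists (entry n E cg W c M e f); apply/flattenP.
exists [seq (e, (f, entry n E cg W c M e f)) | f <- E]; first by apply: map_f.
by apply/mapP; exists f.
Qed.

Lemma solve_steps_ok (pre : classes_t) M : {subset pre <= cg} ->
  uniq (flatten [seq x.1 | x <- pre]) -> table_ok (flatten [seq x.1 | x <- pre]) M ->
  table_ok [::] (foldl (solve_step n E cg) (pre, M) pre).2.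
Proof.
elim: pre M => //= c pre IH M sub; rewrite cat_uniq => /and3P[_ /hasPn dis u] ok.
apply: IH => //; first by move=> d hd; apply: sub; rewrite inE hd orbT.
apply: level_ok => //; first by apply: sub; rewrite mem_head.
by move=> v vc; apply/negP => /dis; rewrite vc.
Qed.

(** When W is everything, [maps] is vacuous and only the identity fixes W, so each Iso(e, f) is
    trivial, even for distinct e and f. *)
Lemma init_ok W : W =i gtn n ->
  table_ok W (flatten [seq [seq (e, (f, [:: iota 0 n])) | f <- E] | e <- E]).
Proof.
move=> hW; split; last first.
  move=> e f eE fE; exists [:: iota 0 n]; apply/flattenP.
  exists [seq (e, (f, [:: iota 0 n])) | f <- E]; last by apply: map_f.
  by apply/mapP; exists e.
move=> _ /flattenP[_ /mapP[e eE ->] /mapP[f fE ->]] /=; split=> //.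
have m x y h : maps W h x y.
  by apply/mapsP => v; rewrite hW => /negP; case; apply: ltn_ord.
have i1 : 1 \in isos W e f.
  apply/isosP; split; first exact: group1.
    by move=> e' eE' _; exists f; split=> //; exact: same_refl.
  by move=> f' fE' _; exists e; split=> //; exact: same_refl.
split.
- by move=> s; rewrite inE => /eqP ->; exists 1; rewrite ?iota_lp.
- exact: hclosed_isos.
move=> D _ lD; apply/subsetP => h /isosP[/fixesP[_ hW'] _ _].
have -> : h = 1 by apply/permP => v; rewrite perm1 hW' // hW; apply: ltn_ord.
by apply: lD; rewrite iota_lp mem_head.
Qed.

(** A subgroup is closed under the ternary operation, so generation as a coset implies generation as
    a group. *)
Lemma gen_group l (H : {group perm1n}) : gen l H -> all (valid_perm n) l /\ <<perms_of n l>> = H.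
Proof.
case=> G1 _ G3; have vl : all (valid_perm n) l.
  by apply/allP => s /G1[p _ ->]; apply: lp_valid.
split=> //; apply/eqP; rewrite eqEsubset gen_subG; apply/andP; split.
  apply/subsetP => p; rewrite inE => /hasP[s sl /eqP <-].
  by have [q qH ->] := G1 s sl; rewrite perm_of_lp.
apply: G3 => [x y z xD yD zD|p pl]; first by rewrite !groupM ?groupV.
apply: mem_gen; rewrite inE; apply/hasP; exists (lp p) => //.
by rewrite perm_of_lp.
Qed.

End Classes.

Lemma maps_nil n (h : {perm 'I_n}) (e f : seq nat) :
  maps [::] h e f = (h @: [set i : 'I_n | val i \in e] == [set i : 'I_n | val i \in f]).
Proof.
apply/mapsP/eqP => [H|H v _].
  apply/setP => v; rewrite -(permKV h v) (mem_imset _ _ (@perm_inj _ h)) !inE.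
  by rewrite (H (h^-1 v)).
have : (h v \in h @: [set i : 'I_n | val i \in e]) =
  (h v \in [set i : 'I_n | val i \in f]) by rewrite H.
by rewrite (mem_imset _ _ (@perm_inj _ h)) !inE.
Qed.

Lemma hyp_autP I (p : {perm 'I_(inst_n I)}) : reflect
  ((forall e, e \in inst_edges I -> exists2 f, f \in inst_edges I & maps [::] p e f) /\
   (forall f, f \in inst_edges I -> exists2 e, e \in inst_edges I & maps [::] p e f))
  (p \in hyp_aut I).
Proof.
pose st (e : seq nat) := [set i : 'I_(inst_n I) | val i \in e].
have eE A : reflect (exists2 e, e \in inst_edges I & A = st e) (A \in edge_set I).
  rewrite inE; apply: (iffP hasP) => [[l lE /eqP <-]|[l lE ->]]; exists l => //; exact/eqP.
rewrite inE; apply: (iffP forallP) => [H|[H1 H2] A].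
  split.
    move=> e he; have /eqP := H (st e); have -> : st e \in edge_set I by apply/eE; exists e.
    move/esym/eE => [f fE ef]; exists f => //; rewrite maps_nil; exact/eqP.
  move=> f hf; have /eqP := H (p^-1 @: st f).
  have -> : p @: (p^-1 @: st f) = st f.
    by rewrite -imset_comp -[RHS]imset_id; apply: eq_imset => v /=; rewrite permKV.
  have -> : st f \in edge_set I by apply/eE; exists f.
  move/eE => [e he ee]; exists e => //; rewrite maps_nil -/(st e) -/(st f) -ee.
  by rewrite -imset_comp -[X in _ == X]imset_id; apply/eqP/eq_imset => v /=; rewrite permKV.
apply/eqP; apply/idP/idP => [/eE[e he ->]|/eE[f hf ef]]; apply/eE.
  have [f fE] := H1 e he; rewrite maps_nil => /eqP ef; exists f => //.
have [e he] := H2 f hf; rewrite maps_nil -/(st e) -/(st f) -ef.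
move=> /eqP /(imset_inj (@perm_inj _ p)) e1.
by exists e.
Qed.

Lemma solve_correct I : well_formed I ->
  let gens := solve (inst_n I) (inst_edges I) (inst_classes I) (inst_groups I) in
  all (valid_perm (inst_n I)) gens /\ <<perms_of (inst_n I) gens>> = target_group I.
Proof.
case: I => n E cls Gs; rewrite /well_formed /=.
case/and5P=> _ _ _ hpart /and3P[/eqP szG hval hgrp].
rewrite /solve /=; set cg := [seq _ | i <- _].
have cg1 : [seq x.1 | x <- cg] = cls by rewrite /cg -map_comp -[RHS](mkseq_nth [::]).
have cg2 : [seq x.2 | x <- cg] = Gs.
  by rewrite /cg -map_comp -szG -[RHS](mkseq_nth [::]).
have cgE cL : cL \in cg -> exists i, [/\ i < size Gs, cL.1 = nth [::] cls i & cL.2 = nth [::] Gs i].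
  by move=> /mapP[i]; rewrite mem_iota -szG /= => hi ->; exists i.
have Hvalid cL : cL \in cg -> all (valid_perm n) cL.2.
  move=> /cgE[i [hi _ ->]]; have /andP[] // := allP hval (nth [::] Gs i) (mem_nth _ hi).
have hg i : i < size Gs ->
  all (fun s => all (fun v => (v \in nth [::] cls i) || (nth 0%N s v == v)) (iota 0 n)) (nth [::] Gs i)
             && group_set (perms_of n (nth [::] Gs i)).
  move=> hi; apply: (allP hgrp (i, nth [::] Gs i)).
  have -> : (i, nth [::] Gs i) = nth (0%N, [::]) (zip (iota 0 (size Gs)) Gs) i.
    by rewrite nth_zip ?size_iota // nth_iota.
  by rewrite mem_nth // size_zip size_iota minnn.
have Hout cL s v : cL \in cg -> s \in cL.2 -> v < n -> v \notin cL.1 -> nth 0%N s v = v.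
  move=> /cgE[i [hi -> ->]] sL vn vc; have /andP[/allP /(_ s sL) /allP /(_ v)] := hg i hi.
  by rewrite mem_iota vn (negbTE vc) => /(_ isT) /eqP.
have Hgrp cL : cL \in cg -> group_set (perms_of n cL.2).
  by move=> /cgE[i [hi _ ->]]; have /andP[] := hg i hi.
have Huniq : uniq (flatten [seq x.1 | x <- cg]) by rewrite cg1 (perm_uniq hpart) iota_uniq.
have Hcov : flatten [seq x.1 | x <- cg] =i gtn n.
  by move=> v; rewrite cg1 (perm_mem hpart) mem_iota.
have prodE : prod_groups (Instance n E cls Gs) = local_prod n cg.
  rewrite (local_gen Hvalid Hout Hgrp Huniq Hcov) /prod_groups /= -{1}cg2.
  by rewrite big_map.
rewrite /target_group prodE; case: nilP => E0.
  have -> : hyp_aut (Instance n E cls Gs) = setT.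
    by apply/setP => p; rewrite [RHS]inE; apply/hyp_autP; rewrite /= E0; split.
  rewrite setTI -prodE; split.
    apply/allP => s /flattenP[L LG sL]; have /andP[_ /allP] := allP hval L LG; exact.
  rewrite /prod_groups /=; congr <<_>>; apply/setP => p; rewrite inE.
  elim: (Gs) => [|L D IH]; first by rewrite big_nil inE.
  by rewrite big_cons /= has_cat IH !inE.
set M := (foldl _ _ _).2.
have revU : perm_eq (flatten [seq x.1 | x <- rev cg]) (flatten [seq x.1 | x <- cg]).
  by apply: perm_flatten; rewrite map_rev perm_rev.
have okM : table_ok n cg E [::] M.
  apply: (solve_steps_ok Hvalid Hout Hgrp Huniq Hcov).
  - by move=> x; rewrite mem_rev.
  - by rewrite (perm_uniq revU).
  by apply: init_ok => // v; rewrite (perm_mem revU).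
have [e0 e0E] : exists e0, e0 \in E by case: (E) E0 => // e0 E' _; exists e0; rewrite mem_head.
have [M1 M2] := okM; have [T hT] := M2 e0 e0 e0E e0E.
have : head ([::], ([::], [::])) M \in M by case: (M) hT => //= a b; rewrite mem_head.
move/M1 => [t1 t2 g].
have eI : isos n cg E [::] (head ([::], ([::], [::])) M).1 (head ([::], ([::], [::])) M).2.1 =
   hyp_aut (Instance n E cls Gs) :&: local_prod n cg.
  apply/setP => p; rewrite [RHS]inE; apply/isosP/andP.
    case=> /fixesP[pP _] h1 h2; split=> //; apply/hyp_autP; split=> [e eE|f fE].
      by have [|f [fE _ m]] := h1 e eE; [apply/sameP | exists f].
    by have [|e [eE _ m]] := h2 f fE; [apply/sameP | exists e].
  case=> /hyp_autP[h1 h2] pP; split; first by apply/fixesP.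
    by move=> e /h1[f fE m] _; exists f; split=> //; apply/sameP.
  by move=> f /h2[e eE m] _; exists e; split=> //; apply/sameP.
rewrite eI in g.
(* The ternary operation with the identity in the middle is the product. *)
have gA : group_set (hyp_aut (Instance n E cls Gs) :&: local_prod n cg).
  have i1 : 1 \in hyp_aut (Instance n E cls Gs) :&: local_prod n cg.
    rewrite inE; apply/andP; split; last by have /group_setP[] := local_group Hvalid Hout Hgrp.
    apply/hyp_autP; split=> e eE; exists e => //; apply/mapsP => v _; by rewrite perm1.
  apply/group_setP; split=> // x y xA yA; have [_ hc _] := g.
  by have := hc _ _ _ xA i1 yA; rewrite invg1 mulg1.
exact: (gen_group (H := Group gA) g).
Qed.

Close Scope group_scope.

Theorem theorem2 :
  exists (M : TM) (c k : nat),
    forall I : instance, well_formed I ->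
      exists t : nat,
        t <= c * (size (enc_instance I)) ^ k + c /\
        @tm_halt M (cf_state (tm_run M t (enc_instance I))) /\
        correct_output I (tm_output (tm_run M t (enc_instance I))).
Proof.
have [c [k H]] := PT_program.
have [||||M [a [b HM]]] := TM_program H.
- exact: enc_instance_pure.
- by move=> I; rewrite /enc_instance /enc_nat !size_cat /=; lia.
- by move=> I; apply: enc_natss_pure.
- by [].
exists M, a, b => I wf; have [t [ht hh [j ho]]] := HM I.
exists t; split=> //; split=> //; have [v e] := solve_correct wf.
by exists (solve (inst_n I) (inst_edges I) (inst_classes I) (inst_groups I)), j.
Qed.
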